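(* Let $(M,\omega)$ be a $2s$-dimensional symplectic manifold, $H\in C^{\infty}(M)$, and $m\in M$ a point with $\mathsf{d}H(m)\neq0$. Then, for every integer $l$ with $2s>l\geq s$, there exist an open neighborhood $U$ of $m$ and a submersion $F:U\to\mathbb{R}^{l}$ such that the pair $(H|_U,F)$ is a non-commutative integrable system. In particular, choosing $l=s$, the pair $(H|_U,F)$ is a commutative integrable system.
   Context: All manifolds and maps are smooth ($C^\infty$) and finite-dimensional. $\bot$ denotes the symplectic orthogonal with respect to $\omega$. The Hamiltonian vector field $X_H$ is defined by $\mathfrak{i}_{X_H}\omega=\mathsf{d}H$. Let $(M,\omega)$ be a symplectic manifold, $H\in C^\infty(M)$, and $F:M\to\Lambda$ a submersion into a manifold $\Lambda$. - $F$ is a first integrals submersion (for $H$) if $X_H(p)\in\mathsf{Ker}F_{*,p}$ for all $p\in M$. - $F$ is isotropic if $\mathsf{Ker}F_{*}\subseteq(\mathsf{Ker}F_{*})^{\bot}$, and Lagrangian if $\mathsf{Ker}F_{*}=(\mathsf{Ker}F_{*})^{\bot}$. - An isotropic submersion $F$ is symplectically complete if $(\mathsf{Ker}F_{*})^{\bot}$ is an integrable distribution. The pair $(H,F)$ is a non-commutative (Mischenko-Fomenko) integrable system if $F$ is a first integrals submersion, isotropic and symplectically complete. It is a commutative (Arnold-Liouville) integrable system if in addition $F$ is Lagrangian. No compactness or connectedness of the level sets of $F$ is required. For an open subset $U\subseteq M$, these notions are applied to $(U,\omega|_U)$, $H|_U$ and $F:U\to\mathbb{R}^l$. *)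

(* Defs.v *)
From HB Require Import structures.
From mathcomp Require Import all_boot all_order all_algebra.
From mathcomp Require Import all_classical all_reals all_analysis.

Set Implicit Arguments.
Unset Strict Implicit.
Unset Printing Implicit Defensive.

Import Order.TTheory GRing.Theory Num.Theory.
Import numFieldNormedType.Exports.

Local Open Scope classical_set_scope.
Local Open Scope ring_scope.

Fixpoint Ck_on (R : realType) (V W : normedModType R) (k : nat) (A : set V)
    (f : V -> W) : Prop :=
  if k is k'.+1 then
    (forall x, A x -> differentiable f x) /\ (forall v, Ck_on k' A ('D_v f))
  else forall x, A x -> {for x, continuous f}.

(* Meaningful for an open set A: the iterated derivatives at a point of A only
   depend on the germ of f there. *)
Definition smooth_on (R : realType) (V W : normedModType R) (A : set V)
    (f : V -> W) : Prop := forall k, Ck_on k A f.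

(* A chart is a homeomorphism cmap from the open set cdom onto the open set
   cmap @` cdom, with inverse cinv; outside of these sets, the values of cmap
   and cinv are irrelevant. *)
Record chart (R : realType) (n : nat) (M : topologicalType) := Chart {
  cdom : set M;
  cmap :> M -> 'rV[R]_n;
  cinv : 'rV[R]_n -> M;
  cdom_open : open cdom;
  cimg_open : open (cmap @` cdom);
  cmapK : forall p, cdom p -> cinv (cmap p) = p;
  cmap_continuous : forall p, cdom p -> {for p, continuous cmap};
  cinv_continuous :
    forall x, (cmap @` cdom) x -> {for x, continuous cinv} }.

(* chart_at p is an arbitrary chart of the atlas around p, used below as a frame
   in which tangent vectors at p are expressed. *)
Record manifold (R : realType) (n : nat) := Manifold {
  mspace :> topologicalType;
  mspace_hausdorff : hausdorff_space mspace;
  mspace_second_countable : @second_countable mspace;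
  atlas : set (chart R n mspace);
  chart_at : mspace -> chart R n mspace;
  chart_at_atlas : forall p, atlas (chart_at p);
  chart_at_dom : forall p, cdom (chart_at p) p;
  atlas_compatible : forall c c', atlas c -> atlas c' ->
    smooth_on (c @` (cdom c `&` cdom c')) (c' \o cinv c) }.


Lemma Ck_on_cst (R : realType) (V W : normedModType R) k (A : set V) (a : W) :
  Ck_on k A (cst a).
Proof.
elim: k a => [|k IHk] a /=; first by move=> x _; exact: cvg_cst.
split=> [x _|v]; first exact: differentiable_cst.
suff -> : 'D_v (cst a) = cst 0 :> (V -> W) by exact: IHk.
by apply/funext => x; exact: derive_cst.
Qed.

Lemma smooth_on_id (R : realType) (V : normedModType R) (A : set V) :
  smooth_on A (@id V).
Proof.
case=> [|k] /=; first by move=> x _; exact: cvg_id.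
split=> [x _|v].
  by apply: (@linear_differentiable _ _ _ (@idfun V)) => y; exact: cvg_id.
suff -> : 'D_v id = cst v :> (V -> V) by exact: Ck_on_cst.
by apply/funext => x; exact: derive_id.
Qed.

Lemma rV_second_countable (R : realType) (n : nat) :
  @second_countable 'rV[R]_n.
Proof.
pose f (qk : 'rV[rat]_n * nat) : set 'rV[R]_n :=
  ball (map_mx ratr qk.1 : 'rV[R]_n) qk.2.+1%:R^-1.
exists (range f); first exact: (card_le_trans (card_image_le _ _) (countableP _)).
split=> [_ [qk _ <-]|x A /nbhs_ballP[e /= e0 eA]].
  by apply: ball_open; rewrite invr_gt0.
have [k ke] : exists k : nat, k.+1%:R^-1 < e / 2 :> R.
  have [//|k] := @ltr_add_invr R 0 (e / 2) _; first by rewrite divr_gt0.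
  by rewrite add0r; exists k.
have k0 : 0 < k.+1%:R^-1 :> R by rewrite invr_gt0.
have /choice[q qP] (i : 'I_n) :
    exists q : rat, x 0 i - k.+1%:R^-1 < ratr q < x 0 i + k.+1%:R^-1.
  have /rat_in_itvoo[q] : x 0 i - k.+1%:R^-1 < x 0 i + k.+1%:R^-1.
    by rewrite ltrD2l gtrN.
  by rewrite in_itv; exists q.
have fx : f (\row_i q i, k) x.
  split=> // i j; rewrite !mxE (ord1 i) /ball /=.
  by rewrite ltr_distl; exact: qP.
exists (f (\row_i q i, k)); first by split=> //; exists (\row_i q i, k).
move=> y fy; apply: eA; rewrite [e]splitr.
apply: (@ball_triangle _ _ (map_mx ratr (\row_i q i) : 'rV[R]_n)).
  by apply: (le_ball (ltW ke)); exact: ball_sym.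
exact: (le_ball (ltW ke)).
Qed.

Section Euclidean.
Variables (R : realType) (n : nat).

Lemma id_image_open : open (@id 'rV[R]_n @` setT).
Proof. by rewrite image_id; exact: openT. Qed.

Definition id_chart : chart R n 'rV[R]_n :=
  @Chart R n 'rV[R]_n setT id id openT id_image_open (fun _ _ => erefl)
    (fun _ _ => cvg_id) (fun _ _ => cvg_id).

Lemma id_chart_compatible (c c' : chart R n 'rV[R]_n) :
  [set id_chart] c -> [set id_chart] c' ->
  smooth_on (c @` (cdom c `&` cdom c')) (c' \o cinv c).
Proof. by move=> -> ->; exact: smooth_on_id. Qed.

Definition euclidean : manifold R n :=
  @Manifold R n 'rV[R]_n (@norm_hausdorff _ _) (@rV_second_countable R n)
    [set id_chart] (fun=> id_chart) (fun=> erefl) (fun=> I)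
    id_chart_compatible.

End Euclidean.

(* A tangent vector at p is given by its coordinates in the chart chart_at p;
   its coordinates in another chart c around p are
   'd (c \o cinv (chart_at p)) (chart_at p p) v. *)
Definition tangent (R : realType) (n : nat) (M : manifold R n) (p : M) : Type :=
  'rV[R]_n.

Definition smooth_fun (R : realType) (n : nat) (M : manifold R n)
    (H : M -> R) : Prop :=
  forall c, atlas c -> smooth_on (c @` cdom c) (H \o cinv c).

Definition differential (R : realType) (n : nat) (M : manifold R n)
    (H : M -> R) (p : M) : tangent p -> R :=
  'd (H \o cinv (chart_at p)) (chart_at p p).
Arguments differential {R n M} H p v.

(* For U open in M; outside of U, the values of f are irrelevant. *)
Definition smooth_map (R : realType) (n k : nat) (M : manifold R n)
    (N : manifold R k) (U : set M) (f : M -> N) : Prop :=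
  (forall p, U p -> {for p, continuous f}) /\
  forall c c', atlas c -> atlas c' ->
    smooth_on (c @` (cdom c `&` U `&` f @^-1` cdom c')) (c' \o f \o cinv c).

Definition pushforward (R : realType) (n k : nat) (M : manifold R n)
    (N : manifold R k) (f : M -> N) (p : M) : tangent p -> tangent (f p) :=
  'd (chart_at (f p) \o f \o cinv (chart_at p)) (chart_at p p).
Arguments pushforward {R n k M N} f p v.

Definition submersion (R : realType) (n k : nat) (M : manifold R n)
    (N : manifold R k) (U : set M) (f : M -> N) : Prop :=
  smooth_map U f /\
  forall p, U p -> forall w : tangent (f p), exists v, pushforward f p v = w.

Definition immersion (R : realType) (n k : nat) (M : manifold R n)
    (N : manifold R k) (U : set M) (f : M -> N) : Prop :=
  smooth_map U f /\ forall p, U p -> injective (pushforward f p).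

Definition distribution (R : realType) (n : nat) (M : manifold R n) :=
  forall p : M, set (tangent p).

Definition ker_push (R : realType) (n k : nat) (M : manifold R n)
    (N : manifold R k) (f : M -> N) : distribution M :=
  fun p => [set v | pushforward f p v = 0 :> 'rV[R]_k].
Arguments ker_push {R n k M N} f p v.

(* Through every point q of U passes an integral manifold of D contained in U,
   i.e. the image of an injective immersion f of a manifold (an open subset V of
   a manifold N) whose tangent spaces are given by D. *)
Definition integrable_on (R : realType) (n : nat) (M : manifold R n)
    (U : set M) (D : distribution M) : Prop :=
  forall q, U q -> exists (k : nat) (N : manifold R k) (V : set N) (f : N -> M),
    [/\ open V, immersion V f, {in V &, injective f},
        f @` V `<=` U /\ (f @` V) q &
        forall y, V y -> range (pushforward f y) = D (f y)].

Section Forms.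
Variables (R : realType) (n : nat) (M : manifold R n).

Definition two_form := forall p : M, tangent p -> tangent p -> R.

(* The coordinate vector field d/dx_i of the chart c, at the point of
   coordinates x. *)
Definition coord_vf (c : chart R n M) (i : 'I_n) (x : 'rV[R]_n) :
    tangent (cinv c x) :=
  'd (chart_at (cinv c x) \o cinv c) x (delta_mx 0 i : 'rV[R]_n).

Definition form_coef (w : two_form) (c : chart R n M) (i j : 'I_n)
    (x : 'rV[R]_n) : R :=
  w (cinv c x) (coord_vf c i x) (coord_vf c j x).

Definition smooth_form (w : two_form) : Prop :=
  forall c i j, atlas c -> smooth_on (c @` cdom c) (form_coef w c i j).

Definition closed_form (w : two_form) : Prop :=
  forall c i j k x, atlas c -> (c @` cdom c) x ->
    'D_(delta_mx 0 i) (form_coef w c j k) x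
    + 'D_(delta_mx 0 j) (form_coef w c k i) x
    + 'D_(delta_mx 0 k) (form_coef w c i j) x = 0.

Record symplectic (w : two_form) : Prop := Symplectic {
  form_linear : forall p (v u u' : tangent p) (a : R),
    w p v (a *: (u : 'rV[R]_n) + u') = a * w p v u + w p v u';
  form_skew : forall p (u v : tangent p), w p u v = - w p v u;
  form_nondegenerate : forall p (v : tangent p),
    (forall u, w p v u = 0) -> v = 0 :> 'rV[R]_n;
  form_smooth : smooth_form w;
  form_closed : closed_form w }.

(* The vector field X with w(X, -) = dH, which exists and is unique when w is
   symplectic: see hamiltonian_vfP. *)
Definition hamiltonian_vf (w : two_form) (H : M -> R) (p : M) : tangent p :=
  get [set X : 'rV[R]_n | forall v, w p X v = differential H p v].

Definition sorth (w : two_form) (D : distribution M) : distribution M :=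
  fun p => [set u | forall v, D p v -> w p u v = 0].

End Forms.
Arguments hamiltonian_vf {R n M} w H p.
Arguments sorth {R n M} w D p v.

Lemma scalar_sum_delta (R : realType) (n : nat) (f : 'rV[R]_n -> R)
    (v : 'rV[R]_n) :
  scalar f -> f v = \sum_j v 0 j * f (delta_mx 0 j).
Proof.
move=> lf; have fD : {morph f : x y / x + y >-> x + y}.
  by move=> x y; have := lf 1 x y; rewrite scale1r mul1r.
have f0 : f 0 = 0 by apply: (addrI (f 0)); rewrite -fD !addr0.
have fZ a x : f (a *: x) = a * f x by rewrite -[a *: x]addr0 lf f0 addr0.
rewrite [in LHS](row_sum_delta v) (big_morph f fD f0).
by apply: eq_bigr => j _; rewrite fZ.
Qed.

Lemma hamiltonian_vfP (R : realType) (n : nat) (M : manifold R n)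
    (w : two_form M) (H : M -> R) (p : M) (X : tangent p) : symplectic w ->
  (forall v, w p X v = differential H p v) <-> X = hamiltonian_vf w H p.
Proof.
move=> sw; pose b (u v : 'rV[R]_n) : R := w p u v.
pose h (v : 'rV[R]_n) : R := differential H p v.
have lb u : scalar (b u).
  by move=> a x y; exact: (@form_linear _ _ _ _ sw p u x y a).
have bC u v : b u v = - b v u by exact: (@form_skew _ _ _ _ sw p).
have b0 u : (forall v, b u v = 0) -> u = 0.
  exact: (@form_nondegenerate _ _ _ _ sw p).
have lh : scalar h by move=> a x y; exact: linearP.
pose e (i : 'I_n) : 'rV[R]_n := delta_mx 0 i.
pose W := \matrix_(i, j) b (e i) (e j).
have bE u v : b u v = (u *m W *m v^T) 0 0.
  rewrite mxE (scalar_sum_delta v (lb u)); apply: eq_bigr => j _.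
  rewrite !mxE mulrC bC (scalar_sum_delta u (lb _)) -sumrN; congr (_ * _).
  by apply: eq_bigr => i _; rewrite -mulrN -bC mxE.
have Wu : W \in unitmx.
  rewrite -row_free_unit -kermx_eq0; apply/eqP/eqP/rowV0P => u.
  by move=> /sub_kermxP uW; apply: b0 => v; rewrite bE uW mul0mx mxE.
pose Y : 'rV[R]_n := (\row_j h (e j)) *m invmx W.
have bY v : b Y v = h v.
  rewrite bE mulmxKV // mxE (scalar_sum_delta v lh).
  by apply: eq_bigr => j _; rewrite !mxE mulrC.
have uniq (Z T : 'rV[R]_n) : (forall v, b Z v = h v) ->
    (forall v, b T v = h v) -> Z = T.
  move=> bZ bT; apply/eqP; rewrite -subr_eq0; apply/eqP/b0 => v.
  have -> : b (Z - T) v = b Z v - b T v.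
    by rewrite !bE !mulmxBl [LHS]mxE [X in _ + X = _]mxE.
  by rewrite bZ bT subrr.
pose S : set 'rV[R]_n := [set X0 | forall v, b X0 v = h v].
have getP : S (get S) by apply: getPex; exists Y.
split=> [bX|-> v]; last exact: getP.
exact: uniq bX getP.
Qed.

(* In the notions below U is an open subset of M and F : M -> L is only
   considered on U, on which it is a submersion. *)
Section IntegrableSystems.
Variables (R : realType) (n l : nat) (M : manifold R n) (L : manifold R l).
Variables (w : two_form M) (H : M -> R) (U : set M) (F : M -> L).

Definition first_integrals : Prop :=
  forall p, U p -> ker_push F p (hamiltonian_vf w H p).

Definition isotropic : Prop :=
  forall p, U p -> ker_push F p `<=` sorth w (ker_push F) p.

Definition lagrangian : Prop :=
  forall p, U p -> ker_push F p = sorth w (ker_push F) p.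

Definition symplectically_complete : Prop :=
  integrable_on U (sorth w (ker_push F)).

Definition noncommutative_integrable : Prop :=
  [/\ submersion U F, first_integrals, isotropic & symplectically_complete].

Definition commutative_integrable : Prop :=
  noncommutative_integrable /\ lagrangian.

End IntegrableSystems.

(* Main.v *)
(* In the coordinates of a chart, H is completed to functions P = (H, p_2, ..., p_k),
   k = n - l, independent and pairwise in involution. The span K of their
   Hamiltonian fields is the symplectic orthogonal of ker dP and is contained in it.
   K is involutive because the form is closed, and ker dP because second derivatives
   commute.

   A frame Y of an involutive distribution, normalized by Y S = 1 for a constant
   matrix S, consists of commuting fields. The time-one map E(p, u) of the flow of
   sum_i u_i Y_i then satisfies D_{(a Y(p), b)} E = (a + b) Y(E(p, u)), by uniqueness
   for the variational equation. Hence u |-> E(q, u) parametrizes the integral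
   manifold through q, and p |-> E(p, (m - p) S) is a system of first integrals,
   with differential the projection along Y at m; no inverse function theorem is
   needed.

   While k < l, ker dP is strictly larger than K at m, so some first integral of K
   is independent of P; it is in involution with P and is added to it. When
   k = n - l, l independent first integrals of K form F: then ker dF = K, and its
   orthogonal ker dP is integrable.

   Smoothness of the flow of Z is proved by induction on the order: the flow of
   the lifted field (Z, DZ) on pairs of vectors contains the differential of the
   flow of Z. *)
From HB Require Import structures.
Require Import Defs.
From mathcomp Require Import all_boot all_order all_algebra.
From mathcomp Require Import all_classical all_reals all_analysis.
From mathcomp Require Import zify ring lra.

Set Implicit Arguments.
Unset Strict Implicit.
Unset Printing Implicit Defensive.

Import Order.TTheory GRing.Theory Num.Theory.
Import numFieldNormedType.Exports.

Local Open Scope classical_set_scope.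
Local Open Scope ring_scope.

(** * Calculus *)

(** The numbers fit because K has rank k and ker dP has rank l: the inclusion of K in ker dP
    requires k <= l, which for k = n - l is the hypothesis l >= s, while l < 2s gives k >= 1, the
    room for H in P. Isotropy of F is the involution of P, and X_H lies in ker dF = K because dH
    vanishes on ker dP, whose orthogonal is K.

    The constant matrix S supplies coordinates along the leaves: p S changes at rate u along the
    field sum_i u_i Y_i, so (m - p) S is the parameter that carries p along its leaf to the affine
    slice { x : x S = m S }. The first integrals are thus the n coordinates of the point of this
    slice reached from p. Their differential at m has rank n - k, so that independent combinations
    still have to be selected.

    The point p and the parameter u form a single state of one flow, so that smoothness in the
    initial state includes smoothness in u. All differential equations are solved forward in time
    only. *)

Section Calculus.
Variable R : realType.
Implicit Types V W : normedModType R.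

(** Uniqueness of first-order expansions identifies the candidate [df] with the differential. The
    estimate has the form that Gronwall's inequality supplies for flows. *)
Lemma diff_epsP V W (f : V -> W) (x : V) (df : {linear V -> W}) :
  continuous df ->
  (forall e, 0 < e -> \forall h \near 0, `|f (h + x) - f x - df h| <= e * `|h|) ->
  differentiable f x /\ 'd f x = df :> (V -> W).
Proof.
move=> cdf fe.
have E : f \o shift x = cst (f x) + df +o_ 0 id.
  apply/eqaddoP => e e0; have := fe _ e0.
  by apply: filterS => h; rewrite !fctE /= opprD addrA.
have dE := diff_unique cdf E; split=> //.
apply/diff_locallyP; rewrite dE; split=> //.
Qed.

Lemma near_eq_differentiable V W (f g : V -> W) (x : V) :
  (\forall y \near x, f y = g y) -> differentiable f x ->
  differentiable g x /\ 'd g x = 'd f x :> (V -> W).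
Proof.
move=> fg df; apply: diff_epsP; first exact: diff_continuous.
move=> e e0; have /diff_locally/eqaddoP/(_ _ e0) := df.
have fg0 : \forall h \near 0, f (h + x) = g (h + x).
  by have := fg; rewrite (near_shift 0) subr0.
have fgx : f x = g x := nbhs_singleton fg.
apply: filterS2 fg0 => h; rewrite !fctE /= opprD addrA => <-.
by rewrite fgx.
Qed.

Lemma open_near V (A : set V) (P : V -> Prop) x : open A -> A x ->
  (forall y, A y -> P y) -> \forall y \near x, P y.
Proof. by move=> oA Ax AP; apply: filterS AP _; exact: open_nbhs_nbhs. Qed.

(** Since A is open, an equality on A passes to all directional derivatives on A. The closure
    properties below rest on this: the formula for a derivative holds on A only, while [Ck_on]
    speaks of the total function ['D_v f]. *)
Lemma Ck_on_eq V W k (A : set V) (f g : V -> W) : open A ->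
  (forall x, A x -> f x = g x) -> Ck_on k A f -> Ck_on k A g.
Proof.
move=> oA; elim: k f g => [|k IH] f g fg /=.
  move=> cf x Ax; have cfx : f y @[y --> x] --> f x by exact: cf.
  suff : g y @[y --> x] --> g x by [].
  rewrite -(fg _ Ax); apply: cvg_trans cfx; apply: near_eq_cvg.
  exact: open_near oA Ax fg.
move=> [df Df]; split=> [x Ax|v].
  exact: (near_eq_differentiable (open_near oA Ax fg) (df x Ax)).1.
apply: IH (Df v) => x Ax.
exact/near_eq_derive/(open_near oA Ax).
Qed.

Lemma Ck_on_sub V W k (A B : set V) (f : V -> W) :
  A `<=` B -> Ck_on k B f -> Ck_on k A f.
Proof.
move=> AB; elim: k f => [|k IH] f /=; first by move=> cf x /AB/cf.
by move=> [df Df]; split=> [x /AB/df//|v]; exact: IH.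
Qed.

Lemma Ck_onW V W k (A : set V) (f : V -> W) : Ck_on k.+1 A f -> Ck_on k A f.
Proof.
elim: k f => [|k IH] f.
  by move=> [df _] x /df/differentiable_continuous.
by move=> [df Df]; split=> // v; apply: IH.
Qed.

Lemma Ck_onD V W k (A : set V) (f g : V -> W) : open A ->
  Ck_on k A f -> Ck_on k A g -> Ck_on k A (fun x => f x + g x).
Proof.
move=> oA; elim: k f g => [|k IH] f g /=.
  by move=> cf cg x Ax; apply: cvgD; [exact: cf|exact: cg].
move=> [df Df] [dg Dg]; split=> [x Ax|v].
  by apply: differentiableD; [exact: df|exact: dg].
apply: (Ck_on_eq oA _ (IH _ _ (Df v) (Dg v))) => x Ax /=.
by rewrite deriveD//; apply: diff_derivable; [exact: df|exact: dg].
Qed.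

Lemma Ck_on_lin V W (W' : normedModType R) k (A : set V) (f : V -> W)
    (L : {linear W -> W'}) : open A -> continuous L ->
  Ck_on k A f -> Ck_on k A (fun x => L (f x)).
Proof.
move=> oA cL; elim: k f => [|k IH] f /=.
  move=> cf x Ax; have := cf x Ax => cfx.
  exact: (continuous_comp cfx (cL _)).
move=> [df Df]; have dL y : differentiable L y by exact: linear_differentiable.
have dLf x : A x -> differentiable (L \o f) x.
  by move=> Ax; apply: differentiable_comp; [exact: df|exact: dL].
split=> [//|v]; apply: (Ck_on_eq oA _ (IH _ (Df v))) => x Ax /=.
rewrite deriveE; last exact: df.
rewrite (@deriveE _ _ _ (L \o f)); last exact: dLf.
rewrite (diff_comp (df _ Ax)); last exact: dL.
by rewrite (diff_lin _ cL).
Qed.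


Lemma Ck_on_sum V W k (A : set V) (I : Type) (r : seq I) (P : pred I)
    (f : I -> V -> W) : open A -> (forall i, P i -> Ck_on k A (f i)) ->
  Ck_on k A (fun x => \sum_(i <- r | P i) f i x).
Proof.
move=> oA Cf; elim: r => [|i r IH].
  by apply: (Ck_on_eq oA _ (Ck_on_cst k A 0)) => x _; rewrite big_nil.
have [Pi|nPi] := boolP (P i).
  apply: (Ck_on_eq oA _ (Ck_onD oA (Cf i Pi) IH)) => x _.
  by rewrite big_cons Pi.
by apply: (Ck_on_eq oA _ IH) => x _; rewrite big_cons (negbTE nPi).
Qed.

Lemma Ck_onM V k (A : set V) (f g : V -> R) : open A ->
  Ck_on k A f -> Ck_on k A g -> Ck_on k A (fun x => f x * g x).
Proof.
move=> oA; elim: k f g => [|k IH] f g /=.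
  by move=> cf cg x Ax; apply: cvgM; [exact: cf|exact: cg].
move=> Cf Cg; have [df Df] := Cf; have [dg Dg] := Cg; split=> [x Ax|v].
  by apply: differentiableM; [exact: df|exact: dg].
apply: (Ck_on_eq oA _ (Ck_onD oA (IH _ _ (Ck_onW Cf) (Dg v))
  (IH _ _ (Ck_onW Cg) (Df v)))) => x Ax /=.
by rewrite deriveM//; apply: diff_derivable; [exact: df|exact: dg].
Qed.

Lemma Ck_on_prod V k (A : set V) (I : Type) (r : seq I) (P : pred I)
    (f : I -> V -> R) : open A -> (forall i, P i -> Ck_on k A (f i)) ->
  Ck_on k A (fun x => \prod_(i <- r | P i) f i x).
Proof.
move=> oA Cf; elim: r => [|i r IH].
  by apply: (Ck_on_eq oA _ (Ck_on_cst k A (1 : R))) => x _; rewrite big_nil.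
have [Pi|nPi] := boolP (P i).
  apply: (Ck_on_eq oA _ (Ck_onM oA (Cf i Pi) IH)) => x _.
  by rewrite big_cons Pi.
by apply: (Ck_on_eq oA _ IH) => x _; rewrite big_cons (negbTE nPi).
Qed.

Lemma Ck_onN V W k (A : set V) (f : V -> W) : open A ->
  Ck_on k A f -> Ck_on k A (fun x => - f x).
Proof.
move=> oA; elim: k f => [|k IH] f /=.
  by move=> cf x Ax; apply: cvgN; exact: cf.
move=> [df Df]; split=> [x Ax|v]; first by apply: differentiableN; exact: df.
apply: (Ck_on_eq oA _ (IH _ (Df v))) => x Ax /=.
by rewrite deriveN//; apply: diff_derivable; exact: df.
Qed.

Lemma Ck_onV V k (A : set V) (f : V -> R) : open A ->
  (forall x, A x -> f x != 0) -> Ck_on k A f -> Ck_on k A (fun x => (f x)^-1).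
Proof.
move=> oA f0; elim: k => [|k IH] /=.
  by move=> cf x Ax; apply: cvgV; [exact: f0|exact: cf].
move=> Cf; have [df Df] := Cf; have CV := IH (Ck_onW Cf).
split=> [x Ax|v]; first by apply: differentiableV; [exact: df|exact: f0].
apply: (Ck_on_eq oA _ (Ck_onN oA (Ck_onM oA (Ck_onM oA CV CV) (Df v)))).
move=> x Ax /=; rewrite deriveV ?f0//; last exact/diff_derivable/df.
by rewrite expr2 invfM scaleNr.
Qed.

Fact scalel_is_linear W (w : W) : linear (fun a : R => a *: w).
Proof. by move=> a x y; rewrite scalerDl scalerA. Qed.

Definition scalel W (w : W) : {linear R -> W} :=
  HB.pack (fun a : R => a *: w)
    (GRing.isLinear.Build R R W _ _ (scalel_is_linear w)).

Section Coordinates.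
Variables (V : normedModType R) (m n : nat).

Fact coordE (i : 'I_m) (j : 'I_n) : linear (fun N : 'M[R]_(m, n) => N i j : R).
Proof. by move=> a x y; rewrite !mxE. Qed.

Definition mxcoord i j : {linear 'M[R]_(m, n) -> R} :=
  HB.pack (fun N : 'M[R]_(m, n) => N i j : R)
    (GRing.isLinear.Build R 'M[R]_(m, n) R _ _ (coordE i j)).

Lemma Ck_on_mx k (A : set V) (f : V -> 'M[R]_(m, n)) : open A ->
  Ck_on k A f <-> (forall i j, Ck_on k A (fun x => f x i j)).
Proof.
move=> oA; split=> [Cf i j|Cf].
  by apply: (@Ck_on_lin V _ _ k A f (mxcoord i j)) => // x; exact: coord_continuous.
have E x : f x = \sum_i \sum_j f x i j *: delta_mx i j by exact: matrix_sum_delta.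
have CE : Ck_on k A (fun x => \sum_i \sum_j f x i j *: (delta_mx i j : 'M[R]_(m, n))).
  apply: Ck_on_sum => // i _; apply: Ck_on_sum => // j _.
  apply: (Ck_on_lin (L := scalel (delta_mx i j : 'M[R]_(m, n))) oA _ (Cf i j)).
  exact: scalel_continuous.
by apply: (Ck_on_eq oA _ CE) => x _; rewrite -E.
Qed.

Lemma derive_coord (f : V -> 'M[R]_(m, n)) x v i j : differentiable f x ->
  'D_v (fun y => f y i j) x = 'D_v f x i j.
Proof.
by move=> df; rewrite derive_mx ?mxE//; exact: diff_derivable.
Qed.

Lemma differentiable_mxcoord (f : V -> 'M[R]_(m, n)) x i j :
  differentiable f x -> differentiable (fun y => f y i j) x.
Proof.
move=> df; apply: (@differentiable_comp _ _ _ _ f (mxcoord i j)) => //.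
exact: differentiable_coord.
Qed.

Lemma differentiable_mx (f : V -> 'M[R]_(m, n)) x :
  (forall i j, differentiable (fun y => f y i j) x) -> differentiable f x.
Proof.
move=> df.
have -> : f = \sum_i \sum_j (fun y => f y i j *: (delta_mx i j : 'M[R]_(m, n))).
  apply/funext => y; rewrite [LHS]matrix_sum_delta fct_sumE.
  by apply: eq_bigr => i _; rewrite fct_sumE.
by do 2 (apply: differentiable_sum => ?); exact: differentiableZl.
Qed.

End Coordinates.

Lemma derive_delta n W (f : 'rV[R]_n -> W) x v : differentiable f x ->
  'D_v f x = \sum_i v 0 i *: 'D_(delta_mx 0 i) f x.
Proof.
move=> df; rewrite deriveE// [in LHS](row_sum_delta v) linear_sum.
by apply: eq_bigr => i _; rewrite linearZ deriveE.
Qed.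

Lemma derive_comp V n W (f : V -> 'rV[R]_n) (g : 'rV[R]_n -> W) x v :
  differentiable f x -> differentiable g (f x) ->
  'D_v (g \o f) x = 'D_('D_v f x) g (f x).
Proof.
move=> df dg; rewrite deriveE; last exact: differentiable_comp.
by rewrite diff_comp//= !deriveE.
Qed.

(** By the chain rule in coordinates, the derivative of the composite is a sum of products of a
    component of ['D_v f] with a composite of f and a partial derivative of g. The induction
    hypothesis applies to the latter, hence the generalization over g. *)
Lemma Ck_on_compR V n k (A : set V) (B : set 'rV[R]_n) (f : V -> 'rV[R]_n)
    (g : 'rV[R]_n -> R) : open A -> (forall x, A x -> B (f x)) ->
  Ck_on k A f -> Ck_on k B g -> Ck_on k A (g \o f).
Proof.
move=> oA fAB; elim: k g => [|k IH] g /=.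
  by move=> cf cg x Ax; apply: continuous_comp; [exact: cf|exact/cg/fAB].
move=> Cf [dg Dg]; have [df Df] := Cf; split=> [x Ax|v].
  by apply: differentiable_comp; [exact: df|exact/dg/fAB].
have CE : Ck_on k A
    (fun x => \sum_i 'D_v f x 0 i * ('D_(delta_mx 0 i) g \o f) x).
  apply: Ck_on_sum => // i _; apply: Ck_onM => //.
    by have /(Ck_on_mx _ _ oA) := Df v; apply.
  by apply: IH; [exact: Ck_onW|exact: Dg].
apply: (Ck_on_eq oA _ CE) => x Ax.
have dgx := dg _ (fAB _ Ax).
by rewrite (derive_comp _ (df _ Ax) dgx) (derive_delta _ dgx).
Qed.

Lemma Ck_on_comp V n m p k (A : set V) (B : set 'rV[R]_n) (f : V -> 'rV[R]_n)
    (g : 'rV[R]_n -> 'M[R]_(m, p)) : open A -> open B -> (forall x, A x -> B (f x)) ->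
  Ck_on k A f -> Ck_on k B g -> Ck_on k A (g \o f).
Proof.
move=> oA oB fAB Cf /(Ck_on_mx _ _ oB) Cg; apply/(Ck_on_mx _ _ oA) => i j.
exact: (Ck_on_compR oA fAB Cf (Cg i j)).
Qed.

Lemma differentiable_line V (x v : V) t :
  is_diff t (fun s : R => x + s *: v) ( *:%R^~ v).
Proof.
have cv : continuous (scalel v) by exact: scalel_continuous.
have dv : differentiable (scalel v) t by exact: linear_differentiable.
have dx : differentiable (cst x : R -> V) t by exact: differentiable_cst.
apply: DiffDef; first exact: (differentiableD dx dv).
rewrite (diffD dx dv) diff_cst (diff_lin _ cv).
by apply/funext => s; exact: add0r.
Qed.

Lemma is_derive_line V W (f : V -> W) (x v : V) t :
  differentiable f (x + t *: v) ->
  is_derive t 1 (fun s : R => f (x + s *: v)) ('D_v f (x + t *: v)).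
Proof.
move=> df; have dl := differentiable_line x v t.
have dc : differentiable (f \o (fun s : R => x + s *: v)) t.
  exact: differentiable_comp.
apply: DeriveDef; first exact: diff_derivable.
by rewrite [LHS]deriveE// diff_comp// deriveE//= diff_val scale1r.
Qed.

Lemma MVT_line V (f : V -> R) (x v : V) :
  (forall t, 0 <= t <= 1 -> differentiable f (x + t *: v)) ->
  exists2 t, 0 < t < 1 & f (x + v) - f x = 'D_v f (x + t *: v).
Proof.
move=> df; pose g t := f (x + t *: v).
have dg (t : R) : 0 <= t <= 1 -> is_derive t 1 g ('D_v f (x + t *: v)).
  by move=> t01; apply: is_derive_line; exact: df.
have [||t] := @MVT _ g (fun t => 'D_v f (x + t *: v)) 0 1 ltr01.
- by move=> t; rewrite in_itv/= => /andP[t0 t1]; apply: dg; rewrite !ltW.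
- apply: derivable_within_continuous => t; rewrite in_itv/= => t01.
  by have [] := dg _ t01.
rewrite in_itv/= => t01; rewrite /g scale1r scale0r addr0 subr0 mulr1 => E.
by exists t.
Qed.

End Calculus.

(** * Smooth functions and symmetry of second derivatives *)

Section SmoothFunctions.
Variable R : realType.
Implicit Types V W : normedModType R.

Lemma smooth_on_derive V W (A : set V) (f : V -> W) v :
  smooth_on A f -> smooth_on A ('D_v f).
Proof. by move=> sf k; exact: (sf k.+1).2 v. Qed.

Lemma smooth_on_differentiable V W (A : set V) (f : V -> W) x :
  smooth_on A f -> A x -> differentiable f x.
Proof. by move=> sf; exact: (sf 1%N).1 x. Qed.

Lemma smooth_on_continuous V W (A : set V) (f : V -> W) x :
  smooth_on A f -> A x -> {for x, continuous f}.
Proof. by move=> sf; exact: sf 0%N x. Qed.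

Lemma smooth_on_sub V W (A B : set V) (f : V -> W) :
  A `<=` B -> smooth_on B f -> smooth_on A f.
Proof. by move=> AB sf k; exact: Ck_on_sub (sf k). Qed.

Lemma smooth_on_eq V W (A : set V) (f g : V -> W) : open A ->
  (forall x, A x -> f x = g x) -> smooth_on A f -> smooth_on A g.
Proof. by move=> oA fg sf k; exact: Ck_on_eq (sf k). Qed.

Lemma smooth_onM V (A : set V) (f g : V -> R) : open A ->
  smooth_on A f -> smooth_on A g -> smooth_on A (fun x => f x * g x).
Proof. by move=> oA sf sg k; exact: Ck_onM. Qed.

Lemma smooth_onD V W (A : set V) (f g : V -> W) : open A ->
  smooth_on A f -> smooth_on A g -> smooth_on A (fun x => f x + g x).
Proof. by move=> oA sf sg k; exact: Ck_onD. Qed.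

Lemma smooth_onN V W (A : set V) (f : V -> W) : open A ->
  smooth_on A f -> smooth_on A (fun x => - f x).
Proof. by move=> oA sf k; exact: Ck_onN. Qed.

Lemma smooth_on_cst V W (A : set V) (a : W) : smooth_on A (fun=> a).
Proof. by move=> k; exact: Ck_on_cst. Qed.

Lemma smooth_on_sum V W (A : set V) (I : Type) (r : seq I) (P : pred I)
    (f : I -> V -> W) : open A -> (forall i, P i -> smooth_on A (f i)) ->
  smooth_on A (fun x => \sum_(i <- r | P i) f i x).
Proof. by move=> oA sf k; apply: Ck_on_sum => // i Pi; exact: sf. Qed.

Lemma smooth_on_lin V W (W' : normedModType R) (A : set V) (f : V -> W)
    (L : {linear W -> W'}) : open A -> continuous L ->
  smooth_on A f -> smooth_on A (fun x => L (f x)).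
Proof. by move=> oA cL sf k; exact: Ck_on_lin. Qed.

Lemma smooth_on_comp V n m p (A : set V) (B : set 'rV[R]_n) (f : V -> 'rV[R]_n)
    (g : 'rV[R]_n -> 'M[R]_(m, p)) : open A -> open B -> (forall x, A x -> B (f x)) ->
  smooth_on A f -> smooth_on B g -> smooth_on A (fun x => g (f x)).
Proof. by move=> oA oB fAB sf sg k; exact: (Ck_on_comp oA oB fAB). Qed.

Section Matrices.
Variables (V : normedModType R) (A : set V).
Hypothesis oA : open A.

Lemma smooth_on_mx m n (f : V -> 'M[R]_(m, n)) :
  smooth_on A f <-> (forall i j, smooth_on A (fun x => f x i j)).
Proof.
split=> [sf i j k|sf k]; first by have /(Ck_on_mx k _ oA) := sf k; exact.
by apply/(Ck_on_mx _ _ oA) => i j; exact: sf.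
Qed.

Lemma smooth_on_mulmx m n p (f : V -> 'M[R]_(m, n)) (g : V -> 'M[R]_(n, p)) :
  smooth_on A f -> smooth_on A g -> smooth_on A (fun x => f x *m g x).
Proof.
move=> /smooth_on_mx sf /smooth_on_mx sg; apply/smooth_on_mx => i j.
under eq_fun do rewrite mxE.
by apply: smooth_on_sum => // l _; exact: smooth_onM.
Qed.

Lemma smooth_on_trmx m n (f : V -> 'M[R]_(m, n)) :
  smooth_on A f -> smooth_on A (fun x => (f x)^T).
Proof.
move=> /smooth_on_mx sf; apply/smooth_on_mx => i j.
by under eq_fun do rewrite mxE; exact: sf.
Qed.

Lemma smooth_on_row_mx m n p (f : V -> 'M[R]_(m, n)) (g : V -> 'M[R]_(m, p)) :
  smooth_on A f -> smooth_on A g -> smooth_on A (fun x => row_mx (f x) (g x)).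
Proof.
move=> /smooth_on_mx sf /smooth_on_mx sg; apply/smooth_on_mx => i j.
rewrite -[j]splitK; case: (fintype.split j) => l /=.
  by under eq_fun do rewrite row_mxEl; exact: sf.
by under eq_fun do rewrite row_mxEr; exact: sg.
Qed.

Lemma smooth_on_det n (f : V -> 'M[R]_n) :
  smooth_on A f -> smooth_on A (fun x => \det (f x)).
Proof.
move=> /smooth_on_mx sf; apply: smooth_on_sum => // s _.
apply: smooth_onM => //; first exact: smooth_on_cst.
by move=> k; apply: Ck_on_prod => // i _; exact: sf.
Qed.

Lemma smooth_on_invmx n (f : V -> 'M[R]_n) :
  (forall x, A x -> f x \in unitmx) ->
  smooth_on A f -> smooth_on A (fun x => invmx (f x)).
Proof.
move=> fu sf; have sd := smooth_on_det sf; move/smooth_on_mx: sf => sf.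
have sd' : smooth_on A (fun x => (\det (f x))^-1).
  move=> k; apply: Ck_onV => // x Ax.
  by have := fu _ Ax; rewrite unitmxE unitfE.
suff : smooth_on A (fun x => (\det (f x))^-1 *: \adj (f x)).
  by apply: smooth_on_eq => // x Ax; rewrite /invmx fu.
apply/smooth_on_mx => i j; under eq_fun do rewrite !mxE.
apply: smooth_onM => //; apply: smooth_onM => //; first exact: smooth_on_cst.
apply: smooth_on_det; apply/smooth_on_mx => i' j'.
by under eq_fun do rewrite !mxE; exact: sf.
Qed.

End Matrices.

(** The mean value theorem is applied to [f (y + v) - f y] in the direction u, then to ['D_u f] in
    the direction v. The left-hand side is symmetric in u and v, the right-hand side is not:
    exchanging them compares the two mixed derivatives. *)
Lemma second_difference V (A : set V) (f : V -> R) (x u v : V) :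
  smooth_on A f ->
  (forall s t, 0 <= s <= 1 -> 0 <= t <= 1 -> A (x + s *: u + t *: v)) ->
  exists st : R * R, [/\ 0 <= st.1 <= 1, 0 <= st.2 <= 1 &
    f (x + u + v) - f (x + u) - (f (x + v) - f x) =
    'D_v ('D_u f) (x + st.1 *: u + st.2 *: v)].
Proof.
move=> sf par; have le01 : 0 <= (0 : R) <= 1 by rewrite lexx ler01.
have le11 : 0 <= (1 : R) <= 1 by rewrite lexx ler01.
pose g y := f (y + v) - f y.
have parv t : 0 <= t <= 1 -> A (x + t *: u + v).
  by move=> t01; have := par _ _ t01 le11; rewrite scale1r.
have par0 t : 0 <= t <= 1 -> A (x + t *: u).
  by move=> t01; have := par _ _ t01 le01; rewrite scale0r addr0.
have dfv y : A (y + v) -> is_derive y u (fun z => f (z + v)) ('D_u f (y + v)).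
  move=> Ayv; have dy : differentiable f (y + v) by exact: smooth_on_differentiable Ayv.
  have ds : is_diff y (fun z => z + v) id.
    have := @is_diffD R V V id (cst v) id 0 y _ _.
    rewrite addr0; exact.
  have dc : differentiable (f \o (fun z => z + v)) y by exact: differentiable_comp.
  apply: DeriveDef; first exact: (diff_derivable dc).
  by rewrite [LHS](deriveE _ dc) diff_comp// deriveE//= diff_val.
have dfv' y : A (y + v) -> differentiable (fun z => f (z + v)) y.
  move=> Ayv; apply: (@differentiable_comp _ _ _ _ (fun z => z + v) f).
    exact: (@differentiableD _ _ _ id (cst v)).
  exact: smooth_on_differentiable Ayv.
have dg y : A (y + v) -> A y -> differentiable g y.
  move=> Ayv Ay; apply: differentiableB; first exact: dfv'.
  exact: smooth_on_differentiable Ay.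
have [t t01] : exists2 t, 0 < t < 1 & g (x + u) - g x = 'D_u g (x + t *: u).
  by apply: MVT_line => t t01; apply: dg; [exact: parv|exact: par0].
have {}t01 : 0 <= t <= 1 by case/andP: t01 => *; rewrite !ltW.
have -> : 'D_u g (x + t *: u) = 'D_u f (x + t *: u + v) - 'D_u f (x + t *: u).
  rewrite /g deriveB; first by rewrite (@derive_val _ _ _ _ _ _ _ (dfv _ (parv t t01))).
    by apply/diff_derivable/dfv'/parv.
  by apply: diff_derivable; apply: smooth_on_differentiable sf _; exact: par0.
have [t' t'01 ->] : exists2 t', 0 < t' < 1 &
    'D_u f (x + t *: u + v) - 'D_u f (x + t *: u)
    = 'D_v ('D_u f) (x + t *: u + t' *: v).
  apply: (@MVT_line _ _ ('D_u f)) => t' t'01; have := par _ _ t01 t'01.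
  exact/smooth_on_differentiable/smooth_on_derive.
move=> E; exists (t, t'); split=> //=.
by case/andP: t'01 => *; rewrite !ltW.
Qed.

Lemma deriveZv V W (f : V -> W) (x v : V) a : differentiable f x ->
  'D_(a *: v) f x = a *: 'D_v f x.
Proof. by move=> df; rewrite !deriveE// linearZ. Qed.

(** Schwarz's theorem: the second difference over the parallelogram spanned by h u and h v is h ^ 2
    times either mixed derivative, each at some point of the parallelogram. By continuity both are
    within e / 2 of their values at x when h is small. *)
Lemma derive_sym V (A : set V) (f : V -> R) (x u v : V) : open A ->
  smooth_on A f -> A x -> 'D_u ('D_v f) x = 'D_v ('D_u f) x.
Proof.
move=> oA sf Ax.
have cont2 a b : {for x, continuous ('D_a ('D_b f))}.
  by apply: smooth_on_continuous Ax; do 2 apply: smooth_on_derive.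
apply/eqP; rewrite -subr_eq0 -normr_le0; apply/ler_addgt0Pr => e e0; rewrite add0r.
have e20 : 0 < e / 2 by rewrite divr_gt0.
have N1 : \forall y \near x, [/\ A y,
    `|'D_u ('D_v f) x - 'D_u ('D_v f) y| < e / 2 &
    `|'D_v ('D_u f) x - 'D_v ('D_u f) y| < e / 2].
  have n1 : \forall y \near x, A y by exact: open_nbhs_nbhs.
  have /cvgrPdist_lt/(_ _ e20) n2 := cont2 u v.
  have /cvgrPdist_lt/(_ _ e20) n3 := cont2 v u.
  apply: filterS3 n1 n2 n3 => y y1 y2 y3.
  by split; [exact: y1|exact: y2|exact: y3].
have /nbhs_ballP[d /= d0 dN] := N1.
(* With this h the whole parallelogram lies in the ball of radius d about x; the summand 1 keeps M
   positive when u and v vanish. *)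
pose M := `|u| + `|v| + 1; have M0 : 0 < M by rewrite ltr_wpDl// addr_ge0.
pose h := d / (2 * M); have h0 : 0 < h by rewrite divr_gt0// mulr_gt0.
have ballh (a b : R) : 0 <= a <= 1 -> 0 <= b <= 1 ->
    ball x d (x + a *: (h *: u) + b *: (h *: v)).
  move=> /andP[a0 a1] /andP[b0 b1]; rewrite -ball_normE /= -addrA opprD addNKr normrN.
  apply: (le_lt_trans (ler_normD _ _)).
  have le1 (c : R) (w : V) : 0 <= c -> c <= 1 -> `|c *: (h *: w)| <= h * `|w|.
    move=> c0 c1; have ch : 0 <= c * h by rewrite mulr_ge0// ltW.
    by rewrite scalerA normrZ (ger0_norm ch) ler_wpM2r// ler_piMl// ltW.
  apply: (le_lt_trans (lerD (le1 _ _ a0 a1) (le1 _ _ b0 b1))).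
  have lt1 : h * (`|u| + `|v|) < h * M by rewrite ltr_pM2l// ltrDl.
  rewrite -mulrDr (lt_le_trans lt1)// /h invfM mulrA mulfVK ?gt_eqF//.
  by move: d0; clear; lra.
have par (a b : R) : 0 <= a <= 1 -> 0 <= b <= 1 ->
    A (x + a *: (h *: u) + b *: (h *: v)).
  by move=> a01 b01; have [] := dN _ (ballh _ _ a01 b01).
have dA y w : A y -> differentiable ('D_w f) y.
  by move=> Ay; apply: smooth_on_differentiable Ay; exact: smooth_on_derive.
have dhh a b y : A y -> 'D_(h *: b) ('D_(h *: a) f) y = h ^+ 2 * 'D_b ('D_a f) y.
  move=> Ay; rewrite deriveZv; last exact: dA.
  suff -> : 'D_b ('D_(h *: a) f) y = h *: 'D_b ('D_a f) y.
    by rewrite scalerA -expr2.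
  rewrite -deriveZ; last by apply: diff_derivable; exact: dA.
  apply: near_eq_derive; apply: open_near oA Ay _ => z Az.
  by rewrite deriveZv//; exact: smooth_on_differentiable Az.
have [[a b] /= [a01 b01 E1]] := second_difference sf par.
have par' (p q : R) : 0 <= p <= 1 -> 0 <= q <= 1 ->
    A (x + p *: (h *: v) + q *: (h *: u)).
  by move=> a01' b01'; rewrite addrAC; exact: par.
have [[a' b'] /= [a01' b01' E2]] := second_difference sf par'.
have {E1 E2} E : 'D_v ('D_u f) (x + a *: (h *: u) + b *: (h *: v)) =
    'D_u ('D_v f) (x + a' *: (h *: v) + b' *: (h *: u)).
  have h20 : h ^+ 2 != 0 by rewrite expf_neq0// gt_eqF.
  apply: (mulfI h20).
  apply: etrans (esym (dhh u v _ (par _ _ a01 b01))) _.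
  apply: etrans _ (dhh v u _ (par' _ _ a01' b01')).
  apply: etrans (esym E1) _; apply: etrans _ E2.
  by rewrite [x + _ + h *: u]addrAC; ring.
have [_ _ l1] := dN _ (ballh _ _ a01 b01).
have := ballh _ _ b01' a01'; rewrite addrAC => /dN[_ l2 _].
rewrite -E in l2; rewrite (splitr e).
set X := 'D_u _ _ in l2 *; set Y := 'D_v _ x in l1 *.
set Z := 'D_v _ _ in l1 l2.
clearbody X Y Z; have -> : X - Y = (X - Z) - (Y - Z) by ring.
exact: le_trans (ler_normB _ _) (lerD (ltW l2) (ltW l1)).
Qed.

End SmoothFunctions.

(** * Ordinary differential equations *)

Section NormTools.
Variable R : realType.

Lemma mx_norm_coord m n (M : 'M[R]_(m, n)) i j : `|M i j| <= `|M|.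
Proof.
rewrite [leRHS]/Num.Def.normr/= mx_normrE.
exact: (@le_bigmax _ _ _ 0 (fun ij : 'I_m * 'I_n => `|M ij.1 ij.2|) (i, j)).
Qed.

Lemma mx_norm_le m n (M : 'M[R]_(m, n)) (e : R) : 0 <= e ->
  (forall i j, `|M i j| <= e) -> `|M| <= e.
Proof.
move=> e0 Me; rewrite [leLHS]/Num.Def.normr/= mx_normrE.
by rewrite bigmax_le.
Qed.

Lemma is_derive_coord n (f : R -> 'rV[R]_n) (t : R) d i :
  is_derive t 1 f d -> is_derive t 1 (fun s => f s 0 i) (d 0 i).
Proof.
move=> fd; have df : derivable f t 1 by exact: ex_derive.
apply: DeriveDef; first by have /derivable_mxP := df; exact.
by have <- := @derive_val _ _ _ _ _ _ _ fd; rewrite derive_mx// mxE.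
Qed.

Lemma is_derive_cstD (W : normedModType R) (c : W) (g : R -> W) (t : R) d :
  is_derive t 1 g d -> is_derive t 1 (fun s => c + g s) d.
Proof.
move=> dg; have dc : is_derive t 1 (cst c) 0 by exact: is_derive_cst.
by have := @is_deriveD _ _ _ (cst c) g t 1 0 d dc dg; rewrite add0r; exact.
Qed.

Lemma is_deriveBcst (W : normedModType R) (c : W) (g : R -> W) (t : R) d :
  is_derive t 1 g d -> is_derive t 1 (fun s => g s - c) d.
Proof.
by move=> dg; under eq_fun do rewrite addrC; exact: is_derive_cstD.
Qed.

(** The functions h + g_i and h - g_i have nonnegative derivatives, hence increase, for every
    coordinate i; the maximum over i is the norm. This replaces integration of the inequality
    between norms. *)
Lemma MVT_norm n (g : R -> 'rV[R]_n) (h : R -> R) g' h' (T : R) : 0 <= T ->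
  continuous g -> continuous h ->
  (forall t, 0 < t < T -> is_derive t 1 g (g' t)) ->
  (forall t, 0 < t < T -> is_derive t 1 h (h' t)) ->
  (forall t, 0 < t < T -> `|g' t| <= h' t) ->
  `|g T - g 0| <= h T - h 0.
Proof.
move=> T0 cg ch dg dh gh.
have [->|T_neq0] := eqVneq T 0; first by rewrite !subrr normr0.
have {T_neq0}T0 : 0 < T by rewrite lt_def T_neq0.
have cgi i : continuous (fun t => g t 0 i).
  move=> t; apply: (@continuous_comp _ _ _ g (fun M : 'rV_n => M 0 i)).
    exact: cg.
  exact: coord_continuous.
have mon (k k' : R -> R) : continuous k ->
    (forall t, 0 < t < T -> is_derive t 1 k (k' t)) ->
    (forall t, 0 < t < T -> 0 <= k' t) -> 0 <= k T - k 0.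
  move=> ck dk k0.
  have dk' t : t \in `]0, T[ -> is_derive t 1 k (k' t).
    by rewrite in_itv/=; exact: dk.
  have [c] := MVT T0 dk' (continuous_subspaceT ck).
  rewrite in_itv/= => c0T ->; rewrite mulr_ge0//; first exact: k0.
  by rewrite subr0 ltW.
have bnd i t : 0 < t < T -> `|g' t 0 i| <= h' t.
  by move=> t0T; exact: le_trans (mx_norm_coord _ _ _) (gh _ t0T).
have le i : `|(g T - g 0) 0 i| <= h T - h 0.
  rewrite !mxE ler_norml.
  have := mon (fun t => h t - g t 0 i) (fun t => h' t - g' t 0 i).
  have := mon (fun t => h t + g t 0 i) (fun t => h' t + g' t 0 i).
  move=> m1 m2; apply/andP; split.
    have {m1}: 0 <= h T + g T 0 i - (h 0 + g 0 0 i).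
      apply: m1 => [t|t t0T|t t0T]; first exact: (cvgD (ch t) (cgi i t)).
        by have h1 := dh _ t0T; have h2 := is_derive_coord i (dg _ t0T); exact: is_deriveD.
      by have := bnd i t t0T; rewrite ler_norml => /andP[]; lra.
    by clear; lra.
  have {m2}: 0 <= h T - g T 0 i - (h 0 - g 0 0 i).
    apply: m2 => [t|t t0T|t t0T]; first exact: (cvgB (ch t) (cgi i t)).
      by have h1 := dh _ t0T; have h2 := is_derive_coord i (dg _ t0T); exact: is_deriveB.
    by have := bnd i t t0T; rewrite ler_norml => /andP[]; lra.
  by clear; lra.
apply: mx_norm_le => [|i j]; last by rewrite ord1; exact: le.
by apply: (mon h h') => // t t0T; exact: le_trans (normr_ge0 _) (gh _ t0T).
Qed.

Lemma is_derive_expM (K t : R) :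
  is_derive t 1 (fun s => expR (K * s)) (K * expR (K * t)).
Proof.
have dK : is_derive t 1 (fun s => K * s) K.
  have := @is_deriveZ _ _ _ id K t 1 1 (is_derive_id _ _).
  by rewrite /GRing.scale /= mulr1.
by have := is_derive1_comp (is_derive_expR (K * t)) dK; rewrite mulrC.
Qed.

Lemma continuous_expM (K : R) : continuous (fun s => expR (K * s)).
Proof.
by move=> t; apply/differentiable_continuous/derivable1_diffP; have [] := is_derive_expM K t.
Qed.

(* The maximum M of |y t| * exp (- 2 K t) satisfies M <= a + c T + M / 2. *)
Lemma gronwall n (y y' : R -> 'rV[R]_n) (K a c T : R) : 0 < K -> 0 <= c -> 0 <= T ->
  continuous y -> (forall t, 0 < t < T -> is_derive t 1 y (y' t)) ->
  (forall t, 0 < t < T -> `|y' t| <= K * `|y t| + c) -> `|y 0| <= a ->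
  forall t, 0 <= t <= T -> `|y t| <= 2 * (a + c * T) * expR (2 * K * T).
Proof.
move=> K0 c0 T0 cy dy yK ya.
pose f t := `|y t| * expR (- (2 * K) * t).
have cf : continuous f.
  move=> t; apply: cvgM; last exact: continuous_expM.
  by apply: cvg_norm; exact: cy.
have [s] := EVT_max T0 (continuous_subspaceT cf).
rewrite in_itv/= => /andP[s0 sT] maxf; set M := f s in maxf.
have yM t : 0 <= t <= T -> `|y t| <= M * expR (2 * K * t).
  move=> t0T; have := maxf t; rewrite in_itv/= => /(_ t0T).
  by rewrite /f mulNr expRN ler_pdivrMr ?expR_gt0.
have M0 : 0 <= M by rewrite mulr_ge0// ltW// expR_gt0.
(* The comparison function has derivative M K exp (2 K t) + c, which dominates K |y t| + c.
   Integrating K exp (2 K t) gains the factor 1 / 2 that allows M to be absorbed. *)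
have ys : `|y s - y 0| <= (M / 2 * expR (2 * K * s) + c * s) -
    (M / 2 * expR (2 * K * 0) + c * 0).
  apply: (@MVT_norm _ y (fun t => M / 2 * expR (2 * K * t) + c * t) y'
     (fun t => M / 2 * (2 * K * expR (2 * K * t)) + c * 1)) => //.
  - move=> t; apply: cvgD; first by apply: cvgMr; exact: continuous_expM.
    by apply: cvgMr; exact: cvg_id.
  - by move=> t /andP[t0 ts]; apply: dy; rewrite t0 (lt_le_trans ts).
  - move=> t _; apply: is_deriveD; apply: is_deriveZ; exact: is_derive_expM.
  - move=> t /andP[t0 ts]; apply: (le_trans (yK _ _)); first by rewrite t0 (lt_le_trans ts).
    rewrite mulr1 lerD2r; have := yM t; rewrite (ltW t0) (ltW (lt_le_trans ts sT)).
    move=> /(_ isT) yt; have := ler_wpM2l (ltW K0) yt.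
    by move=> /le_trans; apply; rewrite le_eqVlt; apply/orP; left; apply/eqP; field.
have {}ys : `|y s| <= a + (M / 2 * (expR (2 * K * s) - 1) + c * s).
  rewrite -[y s](subrK (y 0)) addrC; apply: (le_trans (ler_normD _ _)).
  apply: lerD => //; apply: (le_trans ys); rewrite !mulr0 expR0; lra.
have a0 : 0 <= a by exact: le_trans ya.
have M2 : M <= 2 * (a + c * T).
  have -> : M = `|y s| / expR (2 * K * s) by rewrite /M /f mulNr expRN.
  have E1 : 1 <= expR (2 * K * s) by rewrite -expR0 ler_expR// !mulr_ge0// ltW.
  have E0 := lt_le_trans ltr01 E1.
  have cs : c * s <= c * T by rewrite ler_wpM2l.
  have ME : `|y s| = M * expR (2 * K * s) by rewrite /M /f mulNr expRN mulfVK// gt_eqF.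
  rewrite ler_pdivrMr// ; rewrite ME in ys *.
  have : M * expR (2 * K * s) <= 2 * (a + c * s).
    by move: ys; set E := expR _; move: M0; clear; lra.
  move=> /le_trans; apply.
  apply: (@le_trans _ _ (2 * (a + c * T))); first by rewrite ler_wpM2l// lerD2l.
  by rewrite ler_peMr// mulr_ge0// addr_ge0// mulr_ge0.
move=> t t0T; apply: (le_trans (yM t t0T)); case/andP: t0T => t0 tT.
apply: ler_pM => //.
by rewrite ler_expR ler_wpM2l// mulr_ge0// ltW.
Qed.

Lemma continuous_mx (T : topologicalType) m n (f : T -> 'M[R]_(m, n)) :
  (forall i j, continuous (fun t => f t i j)) -> continuous f.
Proof.
move=> cf t; apply/cvgrPdist_le => e e0.
have : \forall s \near t, forall ij : 'I_m * 'I_n,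
    `|f t ij.1 ij.2 - f s ij.1 ij.2| <= e.
  by apply: filter_forall => -[i j]; have /cvgrPdist_le/(_ _ e0) := cf i j t.
apply: filterS => s Hs.
apply: mx_norm_le => [|i j]; first exact: ltW.
by rewrite !mxE; exact: (Hs (i, j)).
Qed.

(** The integral starts at -1 so that it is differentiable at 0 as well; composing it with max (t,
    0) freezes it at negative times and yields a function continuous on the whole line. *)
Lemma antiderivativeR (f : R -> R) : continuous f -> exists F : R -> R,
  [/\ continuous F, forall t : R, t <= 0 -> F t = 0 &
      forall t : R, 0 < t -> is_derive t 1 F (f t)].
Proof.
move=> cf; pose G x := (\int[lebesgue_measure]_(t in [set` `[(-1 : R), x]]) (f t))%R.
have dG (x : R) : -1 < x -> derivable G x 1 /\ derive1 G x = f x.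
  move=> x1; apply: (@continuous_FTC1_closed _ f (-1) x (x + 1)) => //.
  - by rewrite ltrDl.
  - apply: continuous_compact_integrable; first exact: segment_compact.
    exact: continuous_subspaceT.
  - exact: cf.
pose F x := G (Num.max x 0) - G 0.
exists F; split.
- move=> t; apply: cvgB; last exact: cvg_cst.
  have cm : {for t, continuous (fun s : R => Num.max s 0 : R)}.
    by apply: (@continuous_max _ _ id (cst 0)); [exact: cvg_id|exact: cvg_cst].
  apply: (@continuous_comp _ _ _ (fun s : R => Num.max s 0 : R) G) => //.
  apply/differentiable_continuous/derivable1_diffP; apply: (dG _ _).1.
  by rewrite lt_max ltrN10 orbT.
- by move=> t t0; rewrite /F max_r// subrr.
- move=> t t0; have [dGt Gt] : derivable G t 1 /\ derive1 G t = f t.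
    by apply: dG; exact: lt_trans t0.
  have d1 : is_derive t 1 G (f t) by apply: DeriveDef; rewrite -?derive1E.
  have : is_derive t 1 (fun s => G s - G 0) (f t) by exact: is_deriveBcst.
  apply: near_eq_is_derive.
  near=> s; rewrite /F max_l//; apply: ltW; near: s; exact: lt_nbhsr.
Unshelve. all: by end_near. Qed.

Lemma antiderivative n (f : R -> 'rV[R]_n) : continuous f ->
  exists F : R -> 'rV[R]_n,
  [/\ continuous F, forall t : R, t <= 0 -> F t = 0 &
      forall t : R, 0 < t -> is_derive t 1 F (f t)].
Proof.
move=> cf; have /choice[F FP] i : exists F : R -> R,
    [/\ continuous F, forall t : R, t <= 0 -> F t = 0 &
      forall t : R, 0 < t -> is_derive t 1 F (f t 0 i)].
  apply: (@antiderivativeR (fun t => f t 0 i)) => t.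
  apply: (@continuous_comp _ _ _ f (fun M : 'rV_n => M 0 i)); first exact: cf.
  exact: coord_continuous.
have FE i : (fun t => (\row_j F j t) 0 i) = F i by apply/funext => t; rewrite mxE.
exists (fun t => \row_i F i t); split.
- by apply: continuous_mx => i j; rewrite ord1 FE; have [] := FP j.
- by move=> t t0; apply/rowP => i; rewrite !mxE; have [_ ->] := FP i.
- move=> t t0; have dF : derivable (fun t => \row_i F i t) t 1.
    apply/derivable_mxP => i j; rewrite ord1 FE.
    by have [_ _ /(_ _ t0)[]] := FP j.
  apply: DeriveDef => //; rewrite derive_mx//; apply/rowP => i.
  by rewrite mxE FE; have [_ _ /(_ _ t0)[]] := FP i.
Qed.

Lemma half_expn_lt (C e : R) : 0 < e -> exists N, C * 2^-1 ^+ N < e.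
Proof.
move=> e0; have : (fun N => C * 2^-1 ^+ N) @ \oo --> (C * 0 : R).
  by apply: cvgMr; apply: cvg_expr; rewrite gtr0_norm// invf_lt1// ltr1n.
rewrite mulr0 => /cvgrPdist_lt/(_ _ e0)[N _ NP].
by exists N; have := NP N (leqnn _); rewrite sub0r normrN; exact: le_lt_trans (ler_norm _).
Qed.

Lemma geometric_cauchy n (u : nat -> 'rV[R]_n) (A : R) : 0 <= A ->
  (forall m, `|u m.+1 - u m| <= A * 2^-1 ^+ m) ->
  exists l, forall m, `|l - u m| <= 2 * A * 2^-1 ^+ m.
Proof.
move=> A0 uA.
have up m p : `|u (m + p)%N - u m| <= 2 * A * 2^-1 ^+ m.
  (* The factor 1 - 2^-p is that of the partial geometric sum; with it the induction on p closes. *)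
  suff : `|u (m + p)%N - u m| <= 2 * A * 2^-1 ^+ m * (1 - 2^-1 ^+ p).
    have e0 q : 0 <= (2^-1 : R) ^+ q by rewrite exprn_ge0// invr_ge0.
    move=> /le_trans; apply; rewrite -[leRHS]mulr1 ler_wpM2l// ?mulr_ge0//.
  elim: p => [|p IH]; first by rewrite addn0 !subrr normr0 mulr0.
  rewrite addnS -(subrKA (u (m + p)%N)); apply: (le_trans (ler_normD _ _)).
  apply: (le_trans (lerD (uA _) IH)).
  by rewrite exprD exprS le_eqVlt; apply/orP; left; apply/eqP; field.
have cvu : cvg (u @ \oo).
  apply/cauchy_cvgP/cauchy_ballP => e e0.
  have [N NP] := @half_expn_lt (2 * A) (e / 2) (divr_gt0 e0 (ltr0Sn _ _)).
  exists (u @` [set m | (N <= m)%N], u @` [set m | (N <= m)%N]).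
    by split; exists N => // m Nm; exists m.
  move=> [_ _] [/= [p Np <-] [q Nq <-]]; rewrite -ball_normE /=.
  rewrite -(subrKA (u N)) (splitr e); apply: (le_lt_trans (ler_normD _ _)).
  apply: ltrD; first by apply: le_lt_trans NP; rewrite -(subnKC Np); exact: up.
  by apply: le_lt_trans NP; rewrite distrC -(subnKC Nq); exact: up.
exists (lim (u @ \oo)) => m.
have h : (fun p => `|u (m + p)%N - u m|) @ \oo --> `|lim (u @ \oo) - u m|.
  apply: cvg_norm; apply: cvgB; last exact: cvg_cst.
  have -> : (fun p => u (m + p)%N) = [sequence u (p + m)%N]_p.
    by apply/funext => p; rewrite addnC.
  by rewrite cvg_shiftn.
by apply: (cvgr_to_le h); near=> p; exact: up.
Unshelve. all: by end_near. Qed.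

End NormTools.

(* The iterates converge geometrically in the norm weighted by exp (- 2 K t). *)
Lemma picard (R : realType) n (f : R -> 'rV[R]_n -> 'rV[R]_n) (K B : R)
    (x : 'rV[R]_n) : 0 < K ->
  (forall (t : R) y y', `|f t y - f t y'| <= K * `|y - y'|) ->
  (forall t, `|f t x| <= B) ->
  (forall y : R -> 'rV[R]_n, continuous y -> continuous (fun t => f t (y t))) ->
  exists y : R -> 'rV[R]_n,
  [/\ continuous y, y 0 = x &
      forall t : R, 0 < t -> is_derive t 1 y (f t (y t))].
Proof.
move=> K0 f_lip f_bnd f_cont.
(* [I g] is the primitive of g that vanishes up to time 0; its value is arbitrary when g is not
   continuous. *)
have /choice[I IP] g : exists F : R -> 'rV[R]_n, continuous g ->
    [/\ continuous F, forall t : R, t <= 0 -> F t = 0 &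
        forall t : R, 0 < t -> is_derive t 1 F (g t)].
  have [/antiderivative[F FP]|ncg] := pselect (continuous g); first by exists F.
  by exists 0 => cg.
pose y := fix y m : R -> 'rV[R]_n :=
  if m is m'.+1 then fun t => x + I (fun s => f s (y m' s)) t else cst x.
have cy m : continuous (y m).
  elim: m => [|m IH] /=; first by move=> t; exact: cvg_cst.
  have [cI _ _] := IP _ (f_cont _ IH); move=> t.
  exact: (cvgD (cvg_cst _) (cI t)).
have I0 m : I (fun s => f s (y m s)) 0 = 0.
  by have [_ -> //] := IP _ (f_cont _ (cy m)).
have dy m (t : R) : 0 < t -> is_derive t 1 (y m.+1) (f t (y m t)).
  move=> t0; have [_ _ /(_ _ t0) dI] := IP _ (f_cont _ (cy m)).
  exact: is_derive_cstD.
have y0 m (t : R) : t <= 0 -> y m t = x.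
  move=> t0; case: m => [//|m] /=.
  by have [_ -> //] := IP _ (f_cont _ (cy m)); rewrite addr0.
pose E (t : R) : R := expR (2 * K * `|t|).
have E0 t : 0 <= E t by exact: expR_ge0.
have B0 : 0 <= B by exact: le_trans (normr_ge0 _) (f_bnd 0).
have BK0 : 0 <= B / K by rewrite divr_ge0// ltW.
have half0 m : 0 <= (2^-1 : R) ^+ m by rewrite exprn_ge0// invr_ge0.
(* A derivative bounded by 2 K C E integrates to at most C E. Against the Lipschitz constant K of f,
   each Picard iteration therefore gains a factor 1 / 2 in the norm weighted by E. *)
have int_bnd (z z' : R -> 'rV[R]_n) (C : R) (t : R) : 0 <= t -> 0 <= C ->
    continuous z -> z 0 = 0 ->
    (forall s : R, 0 < s -> is_derive s 1 z (z' s)) ->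
    (forall s : R, 0 < s -> `|z' s| <= 2 * K * C * E s) ->
    `|z t| <= C * E t.
  move=> t0 C0 cz z0 dz z'E.
  have := @MVT_norm _ _ z (fun s => C * expR (2 * K * s)) z'
    (fun s => C * (2 * K * expR (2 * K * s))) t t0 cz.
  rewrite z0 subr0 => /(_ _ _ _ _)/le_trans; apply.
  - by move=> s; apply: cvgMr; exact: continuous_expM.
  - by move=> s /andP[s0 _]; exact: dz.
  - by move=> s _; apply: is_deriveZ; exact: is_derive_expM.
  - move=> s /andP[s0 _]; have := z'E s s0; rewrite /E (gtr0_norm s0) => /le_trans; apply.
    by rewrite le_eqVlt; apply/orP; left; apply/eqP; ring.
  - rewrite /E (ger0_norm t0) mulr0 expR0 mulr1; move: C0; clear; lra.
have ydiff m (t : R) : `|y m.+1 t - y m t| <= B / K * E t * 2^-1 ^+ m.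
  have [t0|/ltW t0] := leP t 0.
    by rewrite !y0// subrr normr0; do 2 apply: mulr_ge0 => //.
  elim: m t t0 => [|m IH] t t0.
    rewrite expr0 mulr1; apply: (int_bnd (fun s => y 1%N s - y 0%N s) (fun s => f s x)) => //.
    + by move=> s; exact: (cvgB (cy 1%N s) (cy 0%N s)).
    + by rewrite !y0// subrr.
    + move=> s s0; exact: (is_deriveBcst x (dy 0%N s s0)).
    + move=> s s0; apply: (le_trans (f_bnd s)).
      have -> : 2 * K * (B / K) * E s = 2 * B * E s by field; rewrite gt_eqF.
      have E1 : 1 <= E s by rewrite -expR0 ler_expR !mulr_ge0// ltW.
      apply: (@le_trans _ _ (2 * B)); first by move: B0; clear; lra.
      by rewrite -[leLHS]mulr1 ler_wpM2l// mulr_ge0.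
  have -> : B / K * E t * 2^-1 ^+ m.+1 = (B / K * 2^-1 ^+ m.+1) * E t by rewrite mulrAC.
  apply: (int_bnd (fun s => y m.+2 s - y m.+1 s)
    (fun s => f s (y m.+1 s) - f s (y m s))) => //.
  + by rewrite mulr_ge0.
  + by move=> s; exact: (cvgB (cy m.+2 s) (cy m.+1 s)).
  + by rewrite !y0// subrr.
  + move=> s s0; have d1 := dy m.+1 s s0; have d2 := dy m s s0.
    exact: is_deriveB.
  + move=> s s0; apply: (le_trans (f_lip _ _ _)).
    have := ler_wpM2l (ltW K0) (IH s (ltW s0)) => /le_trans; apply.
    by rewrite exprS le_eqVlt; apply/orP; left; apply/eqP; field; rewrite gt_eqF.
have /choice[l lP] (t : R) : exists l, forall m, `|l - y m t| <= 2 * (B / K * E t) * 2^-1 ^+ m.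
  apply: (@geometric_cauchy _ _ (fun m => y m t)); first by apply: mulr_ge0.
  by move=> m; exact: ydiff.
have cl : continuous l.
  move=> t; apply/cvgrPdist_le => /= e e0.
  have e3 : 0 < e / 3 by rewrite divr_gt0.
  have [m mP] := half_expn_lt (2 * (B / K * expR (2 * K * (`|t| + 1)))) e3.
  have n1 : \forall s \near t, `|y m t - y m s| <= e / 3.
    by have /cvgrPdist_le/(_ _ e3) := cy m t.
  have n2 : \forall s \near t, `|t - s| < 1.
    by have /cvgrPdist_lt/(_ _ ltr01) := @cvg_id _ (nbhs t).
  have lm (s : R) : `|s| <= `|t| + 1 -> `|l s - y m s| <= e / 3.
    move=> st; apply: (le_trans (lP s m)); apply/ltW/(le_lt_trans _ mP).
    rewrite ler_wpM2r// ler_wpM2l// ler_wpM2l// /E ler_expR ler_wpM2l//.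
    by rewrite mulr_ge0// ltW.
  apply: filterS2 n1 n2 => s y1 /ltW s1.
  have {}s1 : `|s| <= `|t| + 1.
    rewrite -[s](subrK t) addrC (le_trans (ler_normD _ _))// lerD2l.
    by rewrite distrC.
  have lt := lm t; have {lm}ls := lm s s1.
  have {}lt : `|l t - y m t| <= e / 3 by apply: lt; rewrite lerDl.
  have -> : l t - l s = (l t - y m t) + (y m t - y m s) - (l s - y m s).
    by rewrite opprB !addrA !subrK.
  apply: (le_trans (ler_normB _ _)); apply: (le_trans (lerD (ler_normD _ _) (lexx _))).
  by move: y1 lt ls; clear; lra.
have [cI I00 dI] := IP _ (f_cont _ cl).
have lE : l = (fun t => x + I (fun s => f s (l s)) t).
  apply/funext => t.
  apply/eqP; rewrite -subr_eq0 -normr_le0; apply/ler_addgt0Pr => e e0; rewrite add0r.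
  (* The distance from l to its image under the integral operator is split at [y m.+1]: the first
     part contributes 1 to the factor 3, the integral of f (y_m) - f (l) contributes 2. *)
  have [m mP] := half_expn_lt (3 * (B / K * E t)) e0.
  rewrite -[l t](subrK (y m.+1 t)) -addrA.
  apply: (le_trans (ler_normD _ _)); apply/ltW/(le_lt_trans _ mP).
  have -> : y m.+1 t - (x + I (fun s => f s (l s)) t) =
      I (fun s => f s (y m s)) t - I (fun s => f s (l s)) t.
    by rewrite /= opprD addrACA subrr add0r.
  have l1 : `|l t - y m.+1 t| <= (B / K * E t) * 2^-1 ^+ m.
    apply: (le_trans (lP t m.+1)); rewrite exprS le_eqVlt; apply/orP; left.
    by apply/eqP; field; rewrite gt_eqF.
  have l2 : `|I (fun s => f s (y m s)) t - I (fun s => f s (l s)) t| <=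
      2 * (B / K * E t) * 2^-1 ^+ m.
    have [t0|/ltW t0] := leP t 0.
      have [_ -> // _] := IP _ (f_cont _ (cy m)); rewrite I00// subrr normr0.
      by do 3 apply: mulr_ge0 => //.
    have -> : 2 * (B / K * E t) * 2^-1 ^+ m = (2 * (B / K) * 2^-1 ^+ m) * E t by ring.
    have [cIm Im0 dIm] := IP _ (f_cont _ (cy m)).
    apply: (int_bnd (fun t => I (fun s => f s (y m s)) t - I (fun s => f s (l s)) t)
      (fun s => f s (y m s) - f s (l s))) => //.
    + by do 2 apply: mulr_ge0 => //.
    + by move=> s; exact: (cvgB (cIm s) (cI s)).
    + by rewrite Im0// I00// subrr.
    + by move=> s s0; have d1 := dI s s0; have d2 := dIm s s0; exact: is_deriveB.
    + move=> s s0; apply: (le_trans (f_lip _ _ _)); rewrite distrC.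
      have := ler_wpM2l (ltW K0) (lP s m) => /le_trans; apply.
      rewrite -subr_ge0; have -> : 2 * K * (2 * (B / K) * 2^-1 ^+ m) * E s -
        K * (2 * (B / K * E s) * 2^-1 ^+ m) = 2 * K * (B / K * E s * 2^-1 ^+ m) by ring.
      exact: mulr_ge0 (mulr_ge0 (ler0n _ 2) (ltW K0)) (mulr_ge0 (mulr_ge0 BK0 (E0 s)) (half0 m)).
  apply: (le_trans (lerD l1 l2)).
  by rewrite le_eqVlt; apply/orP; left; apply/eqP; ring.
exists l; split=> //; first by rewrite lE I00// addr0.
move=> t t0; rewrite {1}lE; exact: (is_derive_cstD x (dI t t0)).
Qed.

(** * Uniform estimates on compact cubes *)

Section Bounds.
Variable R : realType.

(** As the norm is the maximum of the entries, this is a closed cube: convex, compact, and the image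
    of the whole space under coordinatewise truncation. *)
Definition cball n (c : 'rV[R]_n) (r : R) : set 'rV[R]_n :=
  [set x | `|c - x| <= r].

Lemma cball_compact n (c : 'rV[R]_n) r : compact (cball c r).
Proof.
apply: bounded_closed_compact; last exact: closed_closed_ball_.
exists (`|c| + r); split; first exact: num_real.
move=> M Mr x xc; apply/ltW/(le_lt_trans _ Mr).
rewrite -[x](subKr c) (le_trans (ler_normB _ _))// lerD2l.
exact: xc.
Qed.

Lemma cball_segment n (c : 'rV[R]_n) r a v (t : R) : 0 <= t <= 1 ->
  cball c r a -> cball c r (a + v) -> cball c r (a + t *: v).
Proof.
move=> /andP[t0 t1] ca cv; rewrite /cball /=.
have -> : c - (a + t *: v) = (1 - t) *: (c - a) + t *: (c - (a + v)).
  apply/rowP => i; rewrite !mxE; ring.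
apply: (le_trans (ler_normD _ _)); rewrite !normrZ (ger0_norm t0) ger0_norm ?subr_ge0//.
have -> : r = (1 - t) * r + t * r by ring.
by apply: lerD; apply: ler_wpM2l => //; rewrite subr_ge0.
Qed.

Lemma bounded_on_cball n (W : normedModType R) (c : 'rV[R]_n) r (f : 'rV[R]_n -> W) :
  (forall x, cball c r x -> {for x, continuous f}) ->
  exists2 K, 0 < K & forall x, cball c r x -> `|f x| <= K.
Proof.
move=> cf; have cfw : {within cball c r, continuous f}.
  by apply: continuous_in_subspaceT => x; rewrite inE; exact: cf.
have [M [_ HM]] := compact_bounded (continuous_compact cfw (@cball_compact _ c r)).
exists (`|M| + 1) => [|x xc]; first by rewrite ltr_wpDl.
apply: (HM (`|M| + 1)); last by exists x.
by rewrite (le_lt_trans (ler_norm M))// ltrDl.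
Qed.

Section Field.
Variables (n m : nat) (A : set 'rV[R]_n) (f : 'rV[R]_n -> 'rV[R]_m).
Variables (c : 'rV[R]_n) (r : R).
Hypotheses (sf : smooth_on A f) (cA : cball c r `<=` A).

(** The mean value theorem is used in each coordinate, at a point depending on the coordinate. K
    bounds the derivative in the direction [b - a] itself, so no factor |b - a| appears. *)
Lemma mean_value K a b : (forall x, cball c r x -> `|'D_(b - a) f x| <= K) ->
  cball c r a -> cball c r b -> `|f b - f a| <= K.
Proof.
move=> fK ca cb; have K0 : 0 <= K := le_trans (normr_ge0 _) (fK a ca).
apply: mx_norm_le => // i j; rewrite !mxE.
have cab : cball c r (a + (b - a)) by rewrite addrC subrK.
have df (t : R) : 0 <= t <= 1 -> differentiable f (a + t *: (b - a)).
  by move=> t01; apply: (smooth_on_differentiable sf); apply: cA; exact: cball_segment.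
have [t t01] : exists2 t : R, 0 < t < 1 & f (a + (b - a)) i j - f a i j =
    'D_(b - a) (fun y => f y i j) (a + t *: (b - a)).
  apply: (@MVT_line _ _ (fun y => f y i j)) => t t01.
  by apply: differentiable_mxcoord; exact: df.
have {}t01 : 0 <= t <= 1 by case/andP: t01 => *; rewrite !ltW.
rewrite [a + (b - a)]addrC subrK derive_coord; last exact: df.
move=> ->; apply: (le_trans (mx_norm_coord _ _ _)); apply: fK.
exact: cball_segment.
Qed.

Lemma norm_derive_le (C : 'I_n -> R) (x v : 'rV[R]_n) :
  differentiable f x -> (forall i, `|'D_(delta_mx 0 i) f x| <= C i) ->
  `|'D_v f x| <= (\sum_i C i) * `|v|.
Proof.
move=> df fC; rewrite derive_delta// mulr_suml.
apply: (le_trans (ler_norm_sum _ _ _)); apply: ler_sum => i _.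
rewrite normrZ mulrC; apply: ler_pM => //; exact: mx_norm_coord.
Qed.

Lemma derive_bounded : exists2 K, 0 < K &
  forall x v, cball c r x -> `|'D_v f x| <= K * `|v|.
Proof.
have /choice[C CP] (i : 'I_n) : exists C, 0 < C /\
    forall x, cball c r x -> `|'D_(delta_mx 0 i) f x| <= C.
  have [x cx|C C0 CP] := @bounded_on_cball _ _ c r ('D_(delta_mx 0 i) f).
    apply: (smooth_on_continuous (smooth_on_derive _ sf)); exact: cA.
  by exists C.
have sC : 0 <= \sum_i C i by apply: sumr_ge0 => i _; exact/ltW/(CP i).1.
exists (\sum_i C i + 1) => [|x v cx]; first exact: ltr_wpDl.
have df : differentiable f x by apply: (smooth_on_differentiable sf); exact: cA.
apply: (le_trans (norm_derive_le (C := C) v df _)).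
  by move=> i; exact: (CP i).2.
by apply: ler_wpM2r => //; rewrite lerDl.
Qed.

Lemma lipschitz_on_cball : exists2 K, 0 < K &
  forall a b, cball c r a -> cball c r b -> `|f a - f b| <= K * `|a - b|.
Proof.
have [K K0 fK] := derive_bounded; exists K => // a b ca cb.
by apply: mean_value => // x; exact: fK.
Qed.

End Field.

Lemma derive_lipschitz n m (A : set 'rV[R]_n) (f : 'rV[R]_n -> 'rV[R]_m) c r :
  smooth_on A f -> cball c r `<=` A -> exists2 K, 0 < K &
  forall a b v, cball c r a -> cball c r b ->
    `|'D_v f a - 'D_v f b| <= K * `|a - b| * `|v|.
Proof.
move=> sf cA; have /choice[C CP] (i : 'I_n) : exists C, 0 < C /\
    forall a b, cball c r a -> cball c r b ->
      `|'D_(delta_mx 0 i) f a - 'D_(delta_mx 0 i) f b| <= C * `|a - b|.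
  have [K K0 KP] := lipschitz_on_cball (smooth_on_derive (delta_mx 0 i) sf) cA.
  by exists K.
have sC : 0 <= \sum_i C i by apply: sumr_ge0 => i _; exact/ltW/(CP i).1.
exists (\sum_i C i + 1) => [|a b v ca cb]; first exact: ltr_wpDl.
have df x : cball c r x -> differentiable f x.
  by move=> cx; apply: (smooth_on_differentiable sf); exact: cA.
rewrite (derive_delta _ (df _ ca)) (derive_delta _ (df _ cb)) -sumrB.
apply: (@le_trans _ _ ((\sum_i C i) * `|a - b| * `|v|)); last first.
  by apply: ler_wpM2r => //; apply: ler_wpM2r => //; rewrite lerDl.
rewrite -mulrA mulr_suml; apply: (le_trans (ler_norm_sum _ _ _)).
apply: ler_sum => i _; rewrite -scalerBr normrZ mulrA mulrC.
by apply: ler_pM => //; [exact: (CP i).2|exact: mx_norm_coord].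
Qed.

(** In each coordinate the increment is the derivative at an intermediate point, which differs from
    the one at a by the Lipschitz bound for derivatives: one factor |b - a| from the distance of the
    points, one from the direction. *)
Lemma taylor1 n m (A : set 'rV[R]_n) (f : 'rV[R]_n -> 'rV[R]_m) c r :
  smooth_on A f -> cball c r `<=` A -> exists2 K, 0 < K &
  forall a b, cball c r a -> cball c r b ->
    `|f b - f a - 'D_(b - a) f a| <= K * `|b - a| ^+ 2.
Proof.
move=> sf cA; have [K K0 KP] := derive_lipschitz sf cA.
exists K => // a b ca cb; apply: mx_norm_le => [|i j].
  by rewrite mulr_ge0 ?exprn_ge0// ltW.
have cab : cball c r (a + (b - a)) by rewrite addrC subrK.
have df (t : R) : 0 <= t <= 1 -> differentiable f (a + t *: (b - a)).
  by move=> t01; apply: (smooth_on_differentiable sf); apply: cA; exact: cball_segment.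
have [t t01] : exists2 t : R, 0 < t < 1 & f (a + (b - a)) i j - f a i j =
    'D_(b - a) (fun y => f y i j) (a + t *: (b - a)).
  apply: (@MVT_line _ _ (fun y => f y i j)) => t t01.
  by apply: differentiable_mxcoord; exact: df.
have {}t01 : 0 <= t <= 1 by case/andP: t01 => *; rewrite !ltW.
rewrite [a + (b - a)]addrC subrK derive_coord; last exact: df.
move=> E; rewrite !mxE.
have := KP (a + t *: (b - a)) a (b - a) (cball_segment t01 ca cab) ca.
set u := 'D__ f _ in E *; set w := 'D__ f a; move=> uw.
have -> : f b i j - f a i j - w i j = (u - w) i j by rewrite !mxE -E.
apply: (le_trans (mx_norm_coord _ _ _)); apply: (le_trans uw).
rewrite [a + _]addrC addrK expr2 mulrA; apply: ler_wpM2r => //.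
apply: ler_wpM2l; first exact: ltW.
case/andP: t01 => t0 t1; rewrite normrZ (ger0_norm t0).
by rewrite ler_piMl.
Qed.

End Bounds.

(** * Local flows and the variational equation *)

Section Flow.
Variable R : realType.

(** Trajectories are functions on the whole time line, continuous and confined to Q at every time,
    but they solve the equation only for 0 < t < T. Outside this interval they may, for instance, be
    frozen. *)
Definition local_flow n (Z : 'rV[R]_n -> 'rV[R]_n) (Q U : set 'rV[R]_n) (T : R)
    (phi : R -> 'rV[R]_n -> 'rV[R]_n) : Prop :=
  forall x, U x -> [/\ continuous (phi^~ x), phi 0 x = x,
    forall t, Q (phi t x) &
    forall t : R, 0 < t < T -> is_derive t 1 (phi^~ x) (Z (phi t x))].

Section Variation.
Variables (n : nat) (A : set 'rV[R]_n) (Z : 'rV[R]_n -> 'rV[R]_n).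
Variables (c : 'rV[R]_n) (r : R) (U : set 'rV[R]_n) (T : R).
Variable phi : R -> 'rV[R]_n -> 'rV[R]_n.
Hypotheses (sZ : smooth_on A Z) (cA : cball c r `<=` A).
Hypotheses (T0 : 0 < T) (phiP : local_flow Z (cball c r) U T phi).

Lemma flow_lipschitz : exists2 L, 0 < L & forall x y t, U x -> U y ->
  0 <= t <= T -> `|phi t x - phi t y| <= L * `|x - y|.
Proof.
have [K K0 KP] := lipschitz_on_cball sZ cA.
exists (2 * expR (2 * K * T)) => [|x y t Ux Uy t0T].
  by rewrite mulr_gt0// expR_gt0.
have [cx x0 Qx dx] := phiP Ux; have [cy y0 Qy dy] := phiP Uy.
have := @gronwall R n (fun t => phi t x - phi t y)
  (fun t => Z (phi t x) - Z (phi t y)) K `|x - y| 0 T K0 (lexx _) (ltW T0).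
rewrite mul0r addr0 x0 y0 mulrAC => /(_ _ _ _ _ t t0T); apply => //.
- by move=> s; exact: (cvgB (cx s) (cy s)).
- by move=> s s0T; have d1 := dx s s0T; have d2 := dy s s0T; exact: is_deriveB.
- by move=> s _; rewrite addr0; exact: KP.
Qed.

(** The equation is linear in [psi], with coefficients continuous in time and bounded because the
    trajectory stays in the compact cube. It is thus globally Lipschitz, and [picard] solves it for
    all positive times. *)
Lemma variation_exists x v : U x -> exists psi : R -> 'rV[R]_n,
  [/\ continuous psi, psi 0 = v &
    forall t : R, 0 < t -> is_derive t 1 psi ('D_(psi t) Z (phi t x))].
Proof.
move=> Ux; have [K K0 KP] := derive_bounded sZ cA.
have [cx x0 Qx dx] := phiP Ux.
have dZ t : differentiable Z (phi t x).
  by apply: (smooth_on_differentiable sZ); exact: cA.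
apply: (@picard R n (fun t y => 'D_y Z (phi t x)) K (K * `|v|)) => //.
- move=> t y y'; rewrite (deriveE _ (dZ t)) (deriveE _ (dZ t)) -linearB -deriveE//.
  exact: KP.
- by move=> t; exact: KP.
- move=> y cy; have -> : (fun t => 'D_(y t) Z (phi t x)) =
      (fun t => \sum_i y t 0 i *: 'D_(delta_mx 0 i) Z (phi t x)).
    by apply/funext => t; rewrite derive_delta.
  move=> t; apply: cvg_big => [|i _]; first exact: add_continuous.
    apply: cvgZ.
    apply: (@continuous_comp _ _ _ y (fun M : 'rV_n => M 0 i)); first exact: cy.
    exact: coord_continuous.
  apply: (@continuous_comp _ _ _ (phi^~ x) ('D_(delta_mx 0 i) Z)); first exact: cx.
  apply: smooth_on_continuous (smooth_on_derive _ sZ) _; exact: cA.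
Qed.

Lemma variation_unique x psi psi' : U x ->
  continuous psi -> continuous psi' -> psi 0 = psi' 0 ->
  (forall t : R, 0 < t < T -> is_derive t 1 psi ('D_(psi t) Z (phi t x))) ->
  (forall t : R, 0 < t < T -> is_derive t 1 psi' ('D_(psi' t) Z (phi t x))) ->
  forall t, 0 <= t <= T -> psi t = psi' t.
Proof.
move=> Ux cp cp' p0 dp dp' t t0T; have [K K0 KP] := derive_bounded sZ cA.
have [cx x0 Qx dx] := phiP Ux.
have dZ s : differentiable Z (phi s x).
  by apply: (smooth_on_differentiable sZ); exact: cA.
have := @gronwall R n (fun t => psi t - psi' t)
  (fun t => 'D_(psi t - psi' t) Z (phi t x)) K 0 0 T K0 (lexx _) (ltW T0).
rewrite mul0r addr0 mulr0 mul0r p0 subrr normr0 => /(_ _ _ _ (lexx _) t t0T) H.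
apply/eqP; rewrite -subr_eq0 -normr_le0; apply: H.
- by move=> s; exact: (cvgB (cp s) (cp' s)).
- move=> s s0T; have d1 := dp s s0T; have d2 := dp' s s0T.
  by rewrite (deriveE _ (dZ s)) linearB -!(deriveE _ (dZ s)); exact: is_deriveB.
- by move=> s _; rewrite addr0; exact: KP.
Qed.

Lemma variation_bound : exists2 L, 0 < L & forall x psi, U x ->
  continuous psi ->
  (forall t : R, 0 < t < T -> is_derive t 1 psi ('D_(psi t) Z (phi t x))) ->
  forall t, 0 <= t <= T -> `|psi t| <= L * `|psi 0|.
Proof.
have [K K0 KP] := derive_bounded sZ cA.
exists (2 * expR (2 * K * T)) => [|x psi Ux cp dp t t0T].
  by rewrite mulr_gt0// expR_gt0.
have [cx x0 Qx dx] := phiP Ux.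
have := @gronwall R n psi (fun t => 'D_(psi t) Z (phi t x)) K `|psi 0| 0 T K0
  (lexx _) (ltW T0).
rewrite mul0r addr0 mulrAC => /(_ _ _ _ _ t t0T); apply => //.
by move=> s _; rewrite addr0; exact: KP.
Qed.

Hypothesis oU : open U.

(** The remainder phi (v + x) - phi (x) - psi v vanishes at time 0, and its derivative is
    ['D_(remainder) Z] plus a Taylor error of order |v| ^ 2. Gronwall's inequality makes the
    remainder itself of order |v| ^ 2. Linearity of [psi] in v comes from uniqueness for the
    variational equation. *)
Lemma flow_differentiable x t (psi : 'rV[R]_n -> R -> 'rV[R]_n) :
  U x -> 0 <= t <= T ->
  (forall v, [/\ continuous (psi v), psi v 0 = v & forall t : R, 0 < t ->
    is_derive t 1 (psi v) ('D_(psi v t) Z (phi t x))]) ->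
  differentiable (phi t) x /\ forall v, 'D_v (phi t) x = psi v t.
Proof.
move=> Ux t0T psiP.
have [K K0 KP] := derive_bounded sZ cA.
have [C C0 CP] := taylor1 sZ cA.
have [L L0 LP] := flow_lipschitz.
have [M M0 MP] := variation_bound.
have [cx x0 Qx dx] := phiP Ux.
have dZ s : differentiable Z (phi s x).
  by apply: (smooth_on_differentiable sZ); exact: cA.
have psi_lin : linear (psi^~ t).
  move=> a u v; have [cu u0 du] := psiP u; have [cv v0 dv] := psiP v.
  have [cw w0 dw] := psiP (a *: u + v).
  apply: (@variation_unique x (psi (a *: u + v)) (fun t => a *: psi u t + psi v t) Ux)
    => //.
  - by move=> s; apply: (cvgD _ (cv s)); apply: cvgZr; exact: cu.
  - by rewrite u0 v0 w0.
  - by move=> s /andP[s0 _]; exact: dw.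
  - move=> s /andP[s0 _]; have d1 := du _ s0; have d2 := dv _ s0.
    rewrite (deriveE _ (dZ s)) linearP -!(deriveE _ (dZ s)).
    have d3 : is_derive s 1 (fun s => a *: psi u s) (a *: 'D_(psi u s) Z (phi s x)).
      exact: is_deriveZ.
    exact: is_deriveD.
pose dphi : {linear 'rV[R]_n -> 'rV[R]_n} :=
  HB.pack (psi^~ t) (GRing.isLinear.Build R 'rV[R]_n 'rV[R]_n _ _ psi_lin).
have cdphi : continuous dphi.
  apply/linear_bounded_continuous/linear_boundedP.
  exists M; split; first exact: num_real.
  move=> B MB v; have [cv v0 dv] := psiP v.
  have := MP x (psi v) Ux cv _ t t0T; rewrite v0 => H.
  apply: (le_trans (H _)); first by move=> s /andP[s0 _]; exact: dv.
  by apply: ler_wpM2r => //; exact: ltW.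
pose D := 2 * (C * L ^+ 2 * T) * expR (2 * K * T) + 1.
have D0 : 0 < D.
  rewrite ltr_wpDl// !mulr_ge0 ?expR_ge0 ?exprn_ge0//; exact: ltW.
have quad v : U (v + x) -> `|phi t (v + x) - phi t x - dphi v| <= D * `|v| ^+ 2.
  move=> Uv; have [cv v0 dv] := psiP v; have [cy y0 Qy dy] := phiP Uv.
  have := @gronwall R n (fun s => phi s (v + x) - phi s x - psi v s)
    (fun s => Z (phi s (v + x)) - Z (phi s x) - 'D_(psi v s) Z (phi s x))
    K 0 (C * L ^+ 2 * `|v| ^+ 2) T K0 _ (ltW T0).
  rewrite y0 x0 v0 addrK subrr normr0 => /(_ _ _ _ _ (lexx _) t t0T) H.
  apply: (le_trans (H _ _ _ _)).
  - by rewrite !mulr_ge0 ?exprn_ge0// ltW.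
  - by move=> s; exact: (cvgB (cvgB (cy s) (cx s)) (cv s)).
  - move=> s /[dup] s0T /andP[s0 _]; have d1 := dy s s0T; have d2 := dx s s0T.
    have d3 := dv s s0.
    have d4 : is_derive s 1 (fun s => phi s (v + x) - phi s x)
      (Z (phi s (v + x)) - Z (phi s x)) by exact: is_deriveB.
    exact: is_deriveB.
  - move=> s /andP[s0 sT]; set a := phi s x; set b := phi s (v + x).
    have -> : Z b - Z a - 'D_(psi v s) Z a =
        'D_(b - a - psi v s) Z a + (Z b - Z a - 'D_(b - a) Z a).
      rewrite (deriveE (b - a - psi v s) (dZ s)) linearB -!(deriveE _ (dZ s)).
      by rewrite [RHS]addrAC [_ + (_ - _)]addrC subrK.
    apply: (le_trans (ler_normD _ _)); apply: lerD; first exact: KP _ _ (Qx s).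
    apply: (le_trans (CP _ _ (Qx s) (Qy s))).
    rewrite -mulrA ler_wpM2l ?(ltW C0)// -exprMn ler_pXn2r ?nnegrE ?mulr_ge0 ?(ltW L0)//.
    have := LP (v + x) x s Uv Ux; rewrite addrK; apply.
    by rewrite (ltW s0) (ltW sT).
  have -> : D * `|v| ^+ 2 =
      2 * (0 + C * L ^+ 2 * `|v| ^+ 2 * T) * expR (2 * K * T) + `|v| ^+ 2.
    by rewrite /D; ring.
  by rewrite lerDl exprn_ge0.
have [dphit dE] : differentiable (phi t) x /\ 'd (phi t) x = dphi :> (_ -> _).
  apply: diff_epsP => // e e0.
  have n1 : \forall h \near (0 : 'rV[R]_n), U (h + x).
    have : \forall y \near x, U y by exact: open_nbhs_nbhs.
    by rewrite (near_shift 0) subr0.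
  have n2 : \forall h \near (0 : 'rV[R]_n), `|0 - h| < e / D.
    have /cvgrPdist_lt := @cvg_id _ (nbhs (0 : 'rV[R]_n)).
    by apply; rewrite divr_gt0.
  apply: filterS2 n1 n2 => h Uh; rewrite sub0r normrN => hD.
  apply: (le_trans (quad h Uh)); rewrite expr2 mulrA; apply: ler_wpM2r => //.
  by rewrite mulrC -ler_pdivlMr// ltW.
by split=> // v; rewrite deriveE// dE.
Qed.

End Variation.

End Flow.

(** * Existence and smoothness of flows *)

Section SmoothFlow.
Variable R : realType.

Lemma continuous_lsubmx m n p : continuous (@lsubmx R m n p).
Proof. by apply: continuous_mx => i j; under eq_fun do rewrite mxE; exact: coord_continuous. Qed.

Lemma continuous_rsubmx m n p : continuous (@rsubmx R m n p).
Proof. by apply: continuous_mx => i j; under eq_fun do rewrite mxE; exact: coord_continuous. Qed.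

Lemma smooth_on_lsubmx (V : normedModType R) m n p (A : set V)
    (f : V -> 'M[R]_(m, n + p)) : open A ->
  smooth_on A f -> smooth_on A (fun x => lsubmx (f x)).
Proof. by move=> oA; apply: (smooth_on_lin oA); exact: continuous_lsubmx. Qed.

Lemma smooth_on_rsubmx (V : normedModType R) m n p (A : set V)
    (f : V -> 'M[R]_(m, n + p)) : open A ->
  smooth_on A f -> smooth_on A (fun x => rsubmx (f x)).
Proof. by move=> oA; apply: (smooth_on_lin oA); exact: continuous_rsubmx. Qed.

Lemma open_lsubmx n p (A : set 'rV[R]_n) : open A ->
  open [set y : 'rV[R]_(n + p) | A (lsubmx y)].
Proof. by move=> oA; apply: open_comp => // y _; exact: continuous_lsubmx. Qed.

Lemma continuous_row_mx (S : topologicalType) m n p (f : S -> 'M[R]_(m, n))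
    (g : S -> 'M[R]_(m, p)) : continuous f -> continuous g ->
  continuous (fun x => row_mx (f x) (g x)).
Proof.
move=> cf cg; apply: continuous_mx => i j.
rewrite -[j]splitK; case: (fintype.split j) => l /=.
  under eq_fun do rewrite row_mxEl; move=> x.
  by apply: (@continuous_comp _ _ _ f (fun M : 'M[R]_(m, n) => M i l)); [exact: cf|exact: coord_continuous].
under eq_fun do rewrite row_mxEr; move=> x.
by apply: (@continuous_comp _ _ _ g (fun M : 'M[R]_(m, p) => M i l)); [exact: cg|exact: coord_continuous].
Qed.

Lemma is_derive_row_mx n p (f : R -> 'rV[R]_n) (g : R -> 'rV[R]_p) (t : R) d e :
  is_derive t 1 f d -> is_derive t 1 g e ->
  is_derive t 1 (fun s => row_mx (f s) (g s)) (row_mx d e).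
Proof.
move=> fd ge.
have H j : is_derive t 1 (fun s => row_mx (f s) (g s) 0 j) (row_mx d e 0 j).
  rewrite -[j]splitK; case: (fintype.split j) => l /=.
    by under eq_fun do rewrite row_mxEl; rewrite row_mxEl; exact: is_derive_coord.
  by under eq_fun do rewrite row_mxEr; rewrite row_mxEr; exact: is_derive_coord.
have dd : derivable (fun s => row_mx (f s) (g s)) t 1.
  by apply/derivable_mxP => i j; rewrite ord1; exact: ex_derive.
apply: DeriveDef => //; rewrite derive_mx//; apply/rowP => j.
by rewrite mxE; exact: derive_val.
Qed.

Lemma norm_row_mx_le m n p (a : 'M[R]_(m, n)) (b : 'M[R]_(m, p)) (e : R) :
  `|a| <= e -> `|b| <= e -> `|row_mx a b| <= e.
Proof.
move=> ae be; apply: mx_norm_le => [|i j]; first exact: le_trans ae.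
rewrite -[j]splitK; case: (fintype.split j) => l /=.
  by rewrite row_mxEl; exact: le_trans (mx_norm_coord _ _ _) ae.
by rewrite row_mxEr; exact: le_trans (mx_norm_coord _ _ _) be.
Qed.

Lemma norm_lsubmx_le m n p (a : 'M[R]_(m, n + p)) : `|lsubmx a| <= `|a|.
Proof. by apply: mx_norm_le => // i j; rewrite mxE; exact: mx_norm_coord. Qed.

Lemma smooth_on_derive_along n m p (V : normedModType R) (B : set V)
    (A : set 'rV[R]_n) (f : 'rV[R]_n -> 'M[R]_(m, p)) (v g : V -> 'rV[R]_n) :
  open B -> open A -> (forall x, B x -> A (g x)) ->
  smooth_on A f -> smooth_on B v -> smooth_on B g ->
  smooth_on B (fun x => 'D_(v x) f (g x)).
Proof.
move=> oB oA BA sf sv sg.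
have H : smooth_on B
    (fun x => \sum_i v x 0 i *: 'D_(delta_mx 0 i) f (g x)).
  apply: smooth_on_sum => // i _; apply/(smooth_on_mx oB) => k l.
  under eq_fun do rewrite mxE.
  apply: smooth_onM => //; first by have /(smooth_on_mx oB) := sv; exact.
  have /(smooth_on_mx oB) := smooth_on_comp oB oA BA sg (smooth_on_derive (delta_mx 0 i) sf).
  exact.
apply: (smooth_on_eq oB _ H) => x Bx.
rewrite [RHS]derive_delta//; apply: (smooth_on_differentiable sf); exact: BA.
Qed.

(** The tangent lift of Z: the second component of an integral curve solves the variational equation
    along the first. *)
Definition lift_field n (Z : 'rV[R]_n -> 'rV[R]_n) (y : 'rV[R]_(n + n)) :=
  row_mx (Z (lsubmx y)) ('D_(rsubmx y) Z (lsubmx y)).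

Lemma smooth_on_lift_field n (A : set 'rV[R]_n) (Z : 'rV[R]_n -> 'rV[R]_n) :
  open A -> smooth_on A Z ->
  smooth_on [set y : 'rV[R]_(n + n) | A (lsubmx y)] (lift_field Z).
Proof.
move=> oA sZ; have oA2 := open_lsubmx (p := n) oA.
have sl : smooth_on [set y : 'rV[R]_(n + n) | A (lsubmx y)] (@lsubmx R 1 n n).
  by apply: (smooth_on_lsubmx (f := id)) => //; exact: smooth_on_id.
have sr : smooth_on [set y : 'rV[R]_(n + n) | A (lsubmx y)] (@rsubmx R 1 n n).
  by apply: (smooth_on_rsubmx (f := id)) => //; exact: smooth_on_id.
apply: smooth_on_row_mx => //; first exact: (smooth_on_comp oA2 oA _ sl sZ).
exact: (smooth_on_derive_along oA2 oA).
Qed.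

(** Freezing time outside [0, T] turns a trajectory on that interval into a continuous function on
    the whole line, as [local_flow] demands. *)
Definition clip (T s : R) : R := Num.max 0 (Num.min s T).

Lemma clip_itv (T s : R) : 0 <= T -> 0 <= clip T s <= T.
Proof. by move=> T0; rewrite le_max lexx/= ge_max T0 ge_min lexx orbT. Qed.

Lemma clipE (T s : R) : 0 <= s <= T -> clip T s = s.
Proof. by move=> /andP[s0 sT]; rewrite /clip (min_l sT) max_r. Qed.

Lemma continuous_clip (T : R) : continuous (clip T).
Proof.
move=> s; apply: (@continuous_max _ _ (cst 0) (fun s => Num.min s T)).
  exact: cvg_cst.
by apply: (@continuous_min _ _ id (cst T)); [exact: cvg_id|exact: cvg_cst].
Qed.

(* The flow of the lifted field (Z, DZ) is the pair made of the flow of Z and of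
   its differential, so that the order of smoothness goes up by one. *)
Lemma flow_Ck k : forall n (A : set 'rV[R]_n) (Z : 'rV[R]_n -> 'rV[R]_n) c (r : R) U (T : R) phi,
  open A -> smooth_on A Z -> 0 < r -> cball c r `<=` A -> open U -> 0 < T ->
  local_flow Z (cball c r) U T phi ->
  forall t : R, 0 <= t <= T -> Ck_on k U (phi t).
Proof.
(* The dimension, the field and its flow all vary in the induction, since the lift doubles the
   dimension. *)
elim: k => [|k IH] n A Z c r U T phi oA sZ r0 cA oU T0 phiP t t0T.
  have ex x : exists psi : 'rV[R]_n -> R -> 'rV[R]_n, U x -> forall v,
      [/\ continuous (psi v), psi v 0 = v & forall t : R, 0 < t ->
    is_derive t 1 (psi v) ('D_(psi v t) Z (phi t x))].
    have [Ux|nUx] := pselect (U x); last by exists (fun _ _ => 0).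
    have /choice[psi psiP] := (fun v => variation_exists sZ cA phiP v Ux).
    by exists psi.
  move=> x Ux; have [psi /(_ Ux) psiP] := ex x.
  have [dphi _] := flow_differentiable sZ cA T0 phiP oU Ux t0T psiP.
  exact: differentiable_continuous.
have /choice[psi psiP] : forall xv : 'rV[R]_n * 'rV[R]_n,
    exists psi : R -> 'rV[R]_n, U xv.1 -> [/\ continuous psi, psi 0 = xv.2 &
      forall t : R, 0 < t -> is_derive t 1 psi ('D_(psi t) Z (phi t xv.1))].
  move=> [x v]; have [Ux|nUx] := pselect (U x); last by exists 0.
  by have [psi psiP] := variation_exists sZ cA phiP v Ux; exists psi.
have dphi x v s : U x -> 0 <= s <= T ->
    differentiable (phi s) x /\ 'D_v (phi s) x = psi (x, v) s.
  move=> Ux s0T.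
  have [d E] := flow_differentiable sZ cA T0 phiP oU Ux s0T
    (psi := fun v => psi (x, v)) (fun v => psiP (x, v) Ux).
  by split=> //; exact: E.
split=> [x Ux|v]; first exact: (dphi x 0 t Ux t0T).1.
have [L L0 LP] := variation_bound sZ cA T0 phiP.
have clipP s : 0 <= clip T s <= T by exact: clip_itv (ltW T0).
(* Solutions of the variational equation grow at most by the factor L up to time T, so that vectors
   shorter than [rho] stay shorter than r and the lifted trajectories stay in the cube of radius r
   about (c, 0). *)
pose rho := r / L; have rho0 : 0 < rho by rewrite divr_gt0.
pose U2 := [set y : 'rV[R]_(n + n) | U (lsubmx y) /\ ball 0 rho (rsubmx y)].
have oU2 : open U2.
  have -> : U2 = [set y | U (lsubmx y)] `&` [set y | ball 0 rho (rsubmx y)] by [].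
  apply: openI; first exact: open_lsubmx.
  apply: open_comp => [y _|]; first exact: continuous_rsubmx.
  exact: ball_open.
pose phi2 s (y : 'rV[R]_(n + n)) :=
  row_mx (phi s (lsubmx y)) (psi (lsubmx y, rsubmx y) (clip T s)).
have phi2P : local_flow (lift_field Z) (cball (row_mx c 0) r) U2 T phi2.
  move=> y [Ul]; set x := lsubmx y in Ul *; set w := rsubmx y => wrho.
  have [cx x0 Qx dx] := phiP x Ul; have [cp p0 dp] := psiP (x, w) Ul.
  split.
  - apply: continuous_row_mx; first exact: cx.
    by move=> s; apply: continuous_comp; [exact: continuous_clip|exact: cp].
  - by rewrite /phi2 -/x -/w x0 clipE ?lexx ?ltW// p0 hsubmxK.
  - move=> s; rewrite /cball /= /phi2 opp_row_mx add_row_mx sub0r.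
    apply: norm_row_mx_le; first exact: Qx.
    rewrite normrN; apply: (le_trans (LP x (psi (x, w)) Ul cp _ _ (clipP s))).
      by move=> s' /andP[s'0 _]; exact: dp.
    rewrite p0 mulrC -ler_pdivlMr//; apply: ltW.
    by move: wrho; rewrite -ball_normE /= sub0r normrN.
  - move=> s s0T; case/andP: (s0T) => s0 sT.
    have -> : lift_field Z (phi2 s y) =
        row_mx (Z (phi s x)) ('D_(psi (x, w) s) Z (phi s x)).
      by rewrite /lift_field row_mxKl row_mxKr clipE// !ltW.
    have := is_derive_row_mx (dx s s0T) (dp s s0).
    apply: near_eq_is_derive.
    near=> s'; rewrite /phi2 -/x -/w clipE//; apply/andP; split; apply: ltW; near: s'.
      exact: lt_nbhsr.
    exact: lt_nbhsl.
have C2 : Ck_on k U2 (phi2 t).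
  apply: (IH _ _ _ _ _ _ _ _ (open_lsubmx oA) (smooth_on_lift_field oA sZ) r0 _ oU2 T0
    phi2P t t0T).
  move=> y; rewrite /cball /= => cy; apply: cA; apply: le_trans cy.
  have -> : c - lsubmx y = lsubmx (row_mx c 0 - y) by rewrite linearB /= row_mxKl.
  exact: norm_lsubmx_le.
have Cw w : ball 0 rho w -> Ck_on k U (fun x => psi (x, w) t).
  move=> wrho.
  have sj : smooth_on U (fun x => row_mx x w).
    by apply: smooth_on_row_mx => //; [exact: smooth_on_id|exact: smooth_on_cst].
  have Cj : Ck_on k U (phi2 t \o (fun x => row_mx x w)).
    apply: (Ck_on_comp oU oU2 _ (sj k) C2) => x Ux.
    by rewrite /U2 /= row_mxKl row_mxKr.
  have := Ck_on_lin (L := rsubmx) oU (@continuous_rsubmx _ _ _) Cj.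
  apply: (Ck_on_eq oU) => x Ux /=.
  by rewrite /phi2 !row_mxKl !row_mxKr clipE.
(* The lifted flow is only considered on short vectors; the derivative along v is recovered from the
   one along the short multiple a v. *)
pose a := rho / (2 * (`|v| + 1)).
have v1 : 0 < `|v| + 1 by rewrite ltr_wpDl.
have a0 : 0 < a by rewrite divr_gt0// mulr_gt0.
have wv : ball 0 rho (a *: v).
  rewrite -ball_normE /= sub0r normrN normrZ gtr0_norm//.
  have lt1 : a * `|v| < a * (`|v| + 1) by rewrite ltr_pM2l// ltrDl.
  apply: (lt_le_trans lt1); rewrite /a invfM mulrA mulfVK ?gt_eqF//.
  by move: rho0; lra.
have := Ck_on_lin (L := *:%R a^-1) oU (@scaler_continuous _ _ a^-1) (Cw _ wv).
apply: (Ck_on_eq oU) => x Ux /=.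
have [d <-] := dphi x (a *: v) t Ux t0T.
by rewrite deriveZv// scalerK// gt_eqF.
Unshelve. all: by end_near. Qed.

(** By uniqueness, any explicit solution w of the variational equation is the derivative of the flow
    in the direction [w 0]. This is how derivatives of flows are computed below. *)
Lemma flow_derive n (A : set 'rV[R]_n) (Z : 'rV[R]_n -> 'rV[R]_n) c r U T phi
    x (w : R -> 'rV[R]_n) :
  smooth_on A Z -> cball c r `<=` A -> open U -> 0 < T ->
  local_flow Z (cball c r) U T phi -> U x -> continuous w ->
  (forall t : R, 0 < t < T -> is_derive t 1 w ('D_(w t) Z (phi t x))) ->
  forall t, 0 <= t <= T -> 'D_(w 0) (phi t) x = w t.
Proof.
move=> sZ cA oU T0 phiP Ux cw dw t t0T.
have /choice[psi psiP] := (fun v => variation_exists sZ cA phiP v Ux).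
have [_ ->] := flow_differentiable sZ cA T0 phiP oU Ux t0T psiP.
have [cp p0 dp] := psiP (w 0).
apply: (variation_unique sZ cA T0 phiP Ux) => // s /andP[s0 _]; exact: dp.
Qed.

Lemma clamp_lip (l u a b : R) :
  `|Num.max l (Num.min a u) - Num.max l (Num.min b u)| <= `|a - b|.
Proof.
wlog ab : a b / a <= b => [H|].
  have [|/ltW] := leP a b; first exact: H.
  by move=> /H; rewrite distrC [leRHS]distrC.
rewrite distrC [leRHS]distrC [leRHS]ger0_norm ?subr_ge0// ler_norml; apply/andP.
by split; case: (leP a u) => ?; case: (leP b u) => ?; case: (leP l a) => ?;
  case: (leP l b) => ?; case: (leP l u) => ?; lra.
Qed.

(** Precomposed with the truncation onto the cube of radius r, the field becomes globally Lipschitz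
    and bounded by B. A solution starting within r / 2 of m moves by at most B T = r / 2 up to time
    T, hence stays in the cube, where the truncation is the identity. *)
Lemma local_flow_exists n (A : set 'rV[R]_n) (Z : 'rV[R]_n -> 'rV[R]_n) m :
  open A -> smooth_on A Z -> A m -> exists r T phi,
  [/\ 0 < r, 0 < T, cball m r `<=` A & local_flow Z (cball m r) (ball m (r / 2)) T phi].
Proof.
move=> oA sZ Am.
have [r r0 rA] : exists2 r, 0 < r & cball m r `<=` A.
  have /nbhs_closedballP[r rA] : nbhs m A by exact: open_nbhs_nbhs.
  by exists r%:num => //; move: rA; rewrite closed_ballE.
pose clamp (y : 'rV[R]_n) : 'rV[R]_n :=
  \row_i Num.max (m 0 i - r) (Num.min (y 0 i) (m 0 i + r)).
have clampQ y : cball m r (clamp y).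
  apply: mx_norm_le => [|i j]; first exact: ltW.
  rewrite !mxE (ord1 i) distrC ler_distl le_max lexx /= ge_max ge_min lexx orbT andbT.
  by have := r0; lra.
have clampE y : cball m r y -> clamp y = y.
  move=> my; apply/rowP => i; rewrite mxE.
  have : `|(m - y) 0 i| <= r := le_trans (mx_norm_coord _ _ _) my.
  by rewrite !mxE distrC ler_distl => /andP[y1 y2]; rewrite min_l// max_r.
have clamp1 y y' : `|clamp y - clamp y'| <= `|y - y'|.
  apply: mx_norm_le => // i j; apply: le_trans (mx_norm_coord _ i j); rewrite !mxE (ord1 i).
  exact: clamp_lip.
have [K K0 KP] := lipschitz_on_cball sZ rA.
have [B B0 BP] : exists2 B, 0 < B & forall x, cball m r x -> `|Z x| <= B.
  by apply: bounded_on_cball => x xm; apply: (smooth_on_continuous sZ); exact: rA.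
have clip_lip y y' : `|Z (clamp y) - Z (clamp y')| <= K * `|y - y'|.
  apply: (le_trans (KP _ _ (clampQ y) (clampQ y'))).
  by rewrite ler_wpM2l// ltW.
have cclamp : continuous clamp.
  apply: continuous_mx => i j; under eq_fun do rewrite mxE; move=> y.
  apply: (@continuous_max _ _ (cst (m 0 j - r)) (fun y : 'rV[R]_n => Num.min (y 0 j) (m 0 j + r))).
    exact: cst_continuous.
  apply: (@continuous_min _ _ (fun y : 'rV[R]_n => y 0 j) (cst (m 0 j + r))).
    exact: coord_continuous.
  exact: cst_continuous.
have /choice[psi psiP] x := @picard R n (fun=> Z \o clamp) K B x K0 (fun=> clip_lip)
  (fun=> BP _ (clampQ x)) (fun y cy t => continuous_comp (continuous_comp (cy t) (cclamp _))
    (smooth_on_continuous sZ (rA _ (clampQ _)))).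
pose T := r / (2 * B).
have T0 : 0 < T by rewrite divr_gt0// mulr_gt0.
have clipP s : 0 <= clip T s <= T by exact: clip_itv (ltW T0).
exists r, T, (fun s x => psi x (clip T s)); split=> // x xm.
have [cp p0 dp] := psiP x.
have pQ s : cball m r (psi x (clip T s)).
  have := clipP s; set t := clip T s => /andP[t0 tT].
  have : `|psi x t - psi x 0| <= B * t - B * 0.
    apply: (@MVT_norm _ _ (psi x) (fun t => B * t) (fun t => Z (clamp (psi x t))) (fun=> B * 1))
      => //.
    - by move=> u; apply: cvgMr; exact: cvg_id.
    - by move=> u /andP[u0 _]; exact: dp.
    - by move=> u _; rewrite mulr1; exact: BP.
  rewrite p0 mulr0 subr0 => pB; rewrite /cball /=.
  rewrite -(subrKA x) (le_trans (ler_normD _ _))//.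
  have -> : r = r / 2 + r / 2 by field.
  apply: lerD; first by move: xm; rewrite -ball_normE /= => /ltW.
  rewrite distrC (le_trans pB)//.
  apply: (@le_trans _ _ (B * T)); first by rewrite ler_wpM2l// ltW.
  by rewrite /T le_eqVlt; apply/orP; left; apply/eqP; field; rewrite gt_eqF.
split=> //.
- by move=> s; apply: continuous_comp; [exact: continuous_clip|exact: cp].
- by rewrite clipE ?lexx ?ltW.
- move=> s /andP[s0 sT]; rewrite -[psi x (clip T s)]clampE// clipE ?(ltW s0) ?(ltW sT)//.
  have := dp s s0; apply: near_eq_is_derive.
  near=> s'; rewrite clipE//; apply/andP; split; apply: ltW; near: s'.
    exact: lt_nbhsr.
  exact: lt_nbhsl.
Unshelve. all: by end_near. Qed.

End SmoothFlow.

(** * Commuting vector fields *)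

Section CommutingFields.
Variable R : realType.

Lemma differentiable_mulmx (V : normedModType R) m n p (f : V -> 'M[R]_(m, n))
    (g : V -> 'M[R]_(n, p)) x :
  differentiable f x -> differentiable g x ->
  differentiable (fun y => f y *m g y) x.
Proof.
move=> df dg; apply: differentiable_mx => i j.
have -> : (fun y => (f y *m g y) i j) = \sum_l (fun y => f y i l * g y l j).
  by apply/funext => y; rewrite mxE fct_sumE.
apply: differentiable_sum => l.
by apply: differentiableM; exact: differentiable_mxcoord.
Qed.

Lemma derive_mulmx (V : normedModType R) m n p (f : V -> 'M[R]_(m, n))
    (g : V -> 'M[R]_(n, p)) x v :
  differentiable f x -> differentiable g x ->
  'D_v (fun y => f y *m g y) x = 'D_v f x *m g x + f x *m 'D_v g x.
Proof.
move=> df dg; apply/matrixP => i j.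
rewrite -(derive_coord v i j (differentiable_mulmx df dg)).
have -> : (fun y => (f y *m g y) i j) = \sum_l (fun y => f y i l * g y l j).
  by apply/funext => y; rewrite mxE fct_sumE.
have dfl l : derivable (fun y => f y i l) x v.
  by apply: diff_derivable; exact: differentiable_mxcoord.
have dgl l : derivable (fun y => g y l j) x v.
  by apply: diff_derivable; exact: differentiable_mxcoord.
rewrite derive_sum; last by move=> l; exact: derivableM.
rewrite !mxE -big_split; apply: eq_bigr => l _ /=.
rewrite (deriveM (dfl l) (dgl l)) !derive_coord// addrC; congr (_ + _).
exact: mulrC.
Qed.

Lemma derive_lin (V W : normedModType R) (L : {linear V -> W}) x v :
  continuous L -> differentiable L x /\ 'D_v L x = L v.
Proof.
move=> cL; have dL : differentiable L x by exact: linear_differentiable.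
by split=> //; rewrite deriveE// (diff_lin _ cL).
Qed.

Lemma derive_linD (V W W' : normedModType R) (L : {linear W -> W'}) (f : V -> W) x v :
  continuous L -> differentiable f x ->
  differentiable (fun y => L (f y)) x /\ 'D_v (fun y => L (f y)) x = L ('D_v f x).
Proof.
move=> cL df; have dL : differentiable L (f x) by exact: linear_differentiable.
have dc : differentiable (L \o f) x by exact: differentiable_comp.
split=> //; rewrite (deriveE _ df).
by rewrite -[LHS]/('D_v (L \o f) x) (deriveE _ dc) (diff_comp df dL) /= (diff_lin _ cL).
Qed.

Lemma differentiable_row_mx (V : normedModType R) m n p (f : V -> 'M[R]_(m, n))
    (g : V -> 'M[R]_(m, p)) x : differentiable f x -> differentiable g x ->
  differentiable (fun y => row_mx (f y) (g y)) x.
Proof.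
move=> df dg; apply: differentiable_mx => i j.
rewrite -[j]splitK; case: (fintype.split j) => l /=.
  by under eq_fun do rewrite row_mxEl; exact: differentiable_mxcoord.
by under eq_fun do rewrite row_mxEr; exact: differentiable_mxcoord.
Qed.

Lemma derive_row_mx (V : normedModType R) m n p (f : V -> 'M[R]_(m, n))
    (g : V -> 'M[R]_(m, p)) x v : differentiable f x -> differentiable g x ->
  'D_v (fun y => row_mx (f y) (g y)) x = row_mx ('D_v f x) ('D_v g x).
Proof.
move=> df dg; have d := differentiable_row_mx df dg.
apply/matrixP => i j; rewrite -derive_coord//.
rewrite -[j]splitK; case: (fintype.split j) => l /=.
  by under eq_fun do rewrite row_mxEl; rewrite row_mxEl derive_coord.
by under eq_fun do rewrite row_mxEr; rewrite row_mxEr derive_coord.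
Qed.

Lemma continuous_mulmx (S : topologicalType) m n p (f : S -> 'M[R]_(m, n))
    (g : S -> 'M[R]_(n, p)) : continuous f -> continuous g ->
  continuous (fun x => f x *m g x).
Proof.
move=> cf cg; apply: continuous_mx => i j; under eq_fun do rewrite mxE.
move=> x; apply: cvg_big => [|l _]; first exact: add_continuous.
apply: cvgM.
  by apply: (@continuous_comp _ _ _ f (fun M : 'M[R]_(m, n) => M i l)); [exact: cf|exact: coord_continuous].
by apply: (@continuous_comp _ _ _ g (fun M : 'M[R]_(n, p) => M l j)); [exact: cg|exact: coord_continuous].
Qed.

(** The Lie brackets of all combinations [a *m Y] and [b *m Y] with constant coefficients vanish:
    [b *m 'D_(a *m Y p) Y p] is the derivative of the second field along the first. *)
Definition commuting n k (A : set 'rV[R]_n) (Y : 'rV[R]_n -> 'M[R]_(k, n)) :=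
  forall p, A p -> forall a b : 'rV[R]_k,
    b *m 'D_(a *m Y p) Y p = a *m 'D_(b *m Y p) Y p.

Section Combination.
Variables (n k : nat) (A : set 'rV[R]_n) (Y : 'rV[R]_n -> 'M[R]_(k, n)).
Hypotheses (oA : open A) (sY : smooth_on A Y) (cY : commuting A Y).

(* The field sum_i u_i Y_i in p, for y = (p, u), with a constant parameter u. *)
Definition combination (y : 'rV[R]_(n + k)) : 'rV[R]_(n + k) :=
  row_mx (rsubmx y *m Y (lsubmx y)) 0.

Let A2 := [set y : 'rV[R]_(n + k) | A (lsubmx y)].

Lemma smooth_on_combination : smooth_on A2 combination.
Proof.
have oA2 : open A2 by exact: open_lsubmx.
have sl : smooth_on A2 (@lsubmx R 1 n k).
  by apply: (smooth_on_lsubmx (f := id)) => //; exact: smooth_on_id.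
have sr : smooth_on A2 (@rsubmx R 1 n k).
  by apply: (smooth_on_rsubmx (f := id)) => //; exact: smooth_on_id.
apply: smooth_on_row_mx => //; last exact: smooth_on_cst.
apply: smooth_on_mulmx => //.
exact: (smooth_on_comp oA2 oA _ sl sY).
Qed.

Lemma derive_combination y w : A2 y -> 'D_w combination y =
  row_mx (rsubmx w *m Y (lsubmx y) + rsubmx y *m 'D_(lsubmx w) Y (lsubmx y)) 0.
Proof.
move=> Ay; have dY : differentiable Y (lsubmx y) by exact: (smooth_on_differentiable sY).
have [dl lE] := @derive_lin _ _ (@lsubmx R 1 n k) y w (@continuous_lsubmx _ _ _ _).
have [dr rE] := @derive_lin _ _ (@rsubmx R 1 n k) y w (@continuous_rsubmx _ _ _ _).
have dYl : differentiable (Y \o lsubmx) y by exact: differentiable_comp.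
rewrite derive_row_mx; first last.
- exact: differentiable_cst.
- exact: differentiable_mulmx.
congr row_mx; last exact: derive_cst.
apply: (etrans (derive_mulmx w dr dYl)); rewrite rE; congr (_ + _ *m _).
by rewrite (derive_comp _ dl dY) lE.
Qed.

Variables (c : 'rV[R]_(n + k)) (r : R) (U : set 'rV[R]_(n + k)) (T : R).
Variable phi : R -> 'rV[R]_(n + k) -> 'rV[R]_(n + k).
Hypotheses (cA : cball c r `<=` A2) (oU : open U) (T0 : 0 < T).
Hypothesis phiP : local_flow combination (cball c r) U T phi.

Lemma combination_param y t : U y -> 0 <= t <= T -> rsubmx (phi t y) = rsubmx y.
Proof.
move=> Uy /andP[t0 tT]; have [cy y0 Qy dy] := phiP Uy.
have : `|rsubmx (phi t y) - rsubmx (phi 0 y)| <= 0 - 0.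
  apply: (@MVT_norm _ _ (fun s => rsubmx (phi s y)) (cst 0) (fun=> 0) (fun=> 0)) => //.
  - move=> s; apply: (@continuous_comp _ _ _ (phi^~ y)); first exact: cy.
    exact: continuous_rsubmx.
  - by move=> s; exact: cvg_cst.
  - move=> s /andP[s0 st]; have d : is_derive s 1 (phi^~ y) (combination (phi s y)).
      by apply: dy; rewrite s0 (lt_le_trans st).
    have dd : differentiable (phi^~ y) s by apply/derivable1_diffP; exact: ex_derive.
    have [d1 d2] := @derive_linD _ _ _ (@rsubmx R 1 n k) _ s 1 (@continuous_rsubmx _ _ _ _) dd.
    apply: DeriveDef; first exact: diff_derivable.
    by rewrite d2 (@derive_val _ _ _ _ _ _ _ d); exact: row_mxKr.
  - by move=> s _; rewrite normr0.
by rewrite subrr normr_le0 subr_eq0 y0 => /eqP.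
Qed.

Lemma combination_fixed p t : U (row_mx p 0) -> 0 <= t <= T ->
  phi t (row_mx p 0) = row_mx p 0.
Proof.
move=> Uy /andP[t0 tT]; set y := row_mx p 0 in Uy *.
have [cy y0 Qy dy] := phiP Uy.
have : `|phi t y - phi 0 y| <= 0 - 0.
  apply: (@MVT_norm _ _ (phi^~ y) (cst 0) (fun=> 0) (fun=> 0)) => //.
  - by move=> s; exact: cvg_cst.
  - move=> s /andP[s0 st]; have sT := lt_le_trans st tT.
    have -> : 0 = combination (phi s y).
      rewrite /combination combination_param//; last by rewrite !ltW.
      by rewrite row_mxKr mul0mx row_mx0.
    by apply: dy; rewrite s0.
  - by move=> s _; rewrite normr0.
by rewrite subrr normr_le0 subr_eq0 y0 => /eqP.
Qed.

(** The path w (s) = ((a + s b) Y, b) along the trajectory solves the variational equation. Its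
    derivative contains (a + s b) D_{u Y} Y where the linearized field has u D_{(a + s b) Y} Y, and
    commutation of the frame is exactly the equality of these two terms. *)
Lemma combination_derive y t a b : U y -> 0 <= t <= T ->
  'D_(row_mx (a *m Y (lsubmx y)) b) (phi t) y =
  row_mx ((a + t *: b) *m Y (lsubmx (phi t y))) b.
Proof.
move=> Uy t0T; have [cy y0 Qy dy] := phiP Uy.
pose w s := row_mx ((a + s *: b) *m Y (lsubmx (phi s y))) b.
have -> : row_mx (a *m Y (lsubmx y)) b = w 0 by rewrite /w y0 scale0r addr0.
have AQ s : A (lsubmx (phi s y)) by exact: cA (Qy s).
have dY s : differentiable Y (lsubmx (phi s y)) by exact: (smooth_on_differentiable sY).
apply: (flow_derive smooth_on_combination cA oU T0 phiP Uy _ _ t0T).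
  apply: continuous_row_mx; last by move=> s; exact: cvg_cst.
  apply: continuous_mulmx => [s|s].
    apply: cvgD; first exact: cvg_cst.
    by apply: (@cvgZl _ _ _ _ _ id s b); exact: cvg_id.
  apply: (@continuous_comp _ _ _ (fun s => lsubmx (phi s y)) Y); last first.
    by apply: (smooth_on_continuous sY); exact: AQ.
  apply: (@continuous_comp _ _ _ (phi^~ y)); first exact: cy.
  exact: continuous_lsubmx.
move=> s s0T; case/andP: (s0T) => s0 sT.
have d := dy s s0T.
have dphi : differentiable (phi^~ y) s by apply/derivable1_diffP; exact: ex_derive.
have [d1 d2] := @derive_linD _ _ _ (@lsubmx R 1 n k) _ s 1 (@continuous_lsubmx _ _ _ _) dphi.
rewrite (@derive_val _ _ _ _ _ _ _ d) /= row_mxKl in d2.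
have dYl : differentiable (Y \o (fun s => lsubmx (phi s y))) s by exact: differentiable_comp.
have dab := differentiable_line a b s.
have dab' : differentiable (fun s : R => a + s *: b) s by [].
have E1 : 'D_1 (fun s : R => a + s *: b) s = b.
  by rewrite deriveE// diff_val scale1r.
have dm := differentiable_mulmx dab' dYl.
rewrite derive_combination; last exact: AQ.
rewrite row_mxKl row_mxKr combination_param//; last by rewrite !ltW.
have -> : b *m Y (lsubmx (phi s y)) + rsubmx y *m 'D_((a + s *: b) *m Y (lsubmx (phi s y))) Y
    (lsubmx (phi s y)) = 'D_1 (fun s : R => (a + s *: b) *m (Y \o (fun s => lsubmx (phi s y))) s) s.
  have E2 := derive_mulmx (1 : R) dab' dYl; apply: etrans _ (esym E2); rewrite E1; congr (_ + _).
  rewrite (derive_comp _ d1 (dY s)) d2 (cY (AQ s)); congr (_ *m _).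
  by rewrite combination_param// !ltW.
apply: is_derive_row_mx.
by apply: derivableP; exact: diff_derivable.
Qed.

End Combination.

(** The flow is available only up to a small time T. The field being linear in the parameter,
    flowing for the time e = T / 2 with parameter u / e amounts to flowing for time one with
    parameter u. *)
Lemma commuting_exp n k (A : set 'rV[R]_n) (Y : 'rV[R]_n -> 'M[R]_(k, n)) m :
  open A -> smooth_on A Y -> commuting A Y -> A m ->
  exists (G : set 'rV[R]_(n + k)) (E : 'rV[R]_(n + k) -> 'rV[R]_n),
    [/\ open G, G (row_mx m 0), smooth_on G E /\ (forall y, G y -> A (lsubmx y) /\ A (E y)),
      forall p, G (row_mx p 0) -> E (row_mx p 0) = p &
      forall y a b, G y ->
        'D_(row_mx (a *m Y (lsubmx y)) b) E y = (a + b) *m Y (E y)].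
Proof.
move=> oA sY cY Am; have oA2 := open_lsubmx (p := k) oA.
have sZ := smooth_on_combination oA sY.
have [|r [T [phi [r0 T0 rA phiP]]]] := local_flow_exists (m := row_mx m 0) oA2 sZ.
  by rewrite /= row_mxKl.
set U := ball _ _ in phiP; have oU : open U by exact: ball_open.
pose e := T / 2; have e0 : 0 < e by rewrite divr_gt0.
have e0T : 0 <= e <= T by rewrite ltW//= /e; move: T0; lra.
pose sigma (y : 'rV[R]_(n + k)) : 'rV[R]_(n + k) :=
  row_mx (lsubmx y) (e^-1 *: rsubmx y).
have lsigma : linear sigma.
  move=> a x y; rewrite /sigma !linearP /=.
  by rewrite scale_row_mx add_row_mx.
pose L : {linear _ -> _} := HB.pack sigma
  (GRing.isLinear.Build R 'rV[R]_(n + k) 'rV[R]_(n + k) _ _ lsigma).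
have csigma : continuous L.
  apply: continuous_row_mx; first exact: continuous_lsubmx.
  move=> y; apply: (@continuous_comp _ _ _ (@rsubmx R 1 n k) ( *:%R e^-1)).
    exact: continuous_rsubmx.
  exact: scaler_continuous.
pose G := [set y | U (sigma y)].
have oG : open G by apply: open_comp => // y _; exact: csigma.
have sphi : smooth_on U (phi e).
  move=> k'; have := flow_Ck k' oA2 sZ r0 rA oU T0 phiP; apply; exact: e0T.
exists G, (fun y => lsubmx (phi e (sigma y))); split.
- exact: oG.
- rewrite /G /= /sigma row_mxKl row_mxKr scaler0; apply: ballxx.
  by rewrite divr_gt0.
- split.
    apply: smooth_on_lsubmx => //.
    apply: (smooth_on_comp oG oU _ _ sphi) => //.
    by apply: (smooth_on_lin (L := L) (f := id)) => //; exact: smooth_on_id.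
  move=> y Gy; have [cy y0 Qy dy] := phiP _ Gy.
  split; last exact: rA (Qy e).
  by have := rA _ (Qy 0); rewrite y0 /= /sigma row_mxKl.
- move=> p; rewrite /G /= /sigma row_mxKl row_mxKr scaler0 => Up.
  by rewrite (combination_fixed phiP Up e0T) row_mxKl.
- move=> y a b Gy.
  have dphi : differentiable (phi e) (sigma y) by exact: (smooth_on_differentiable sphi Gy).
  have [dL LE] := @derive_lin _ _ L y (row_mx (a *m Y (lsubmx y)) b) csigma.
  have dphiL : differentiable (phi e \o L) y by exact: differentiable_comp.
  have [_ ->] := derive_linD (row_mx (a *m Y (lsubmx y)) b)
    (@continuous_lsubmx _ _ _ _) dphiL.
  rewrite (derive_comp _ dL dphi) LE.
  have -> : L (row_mx (a *m Y (lsubmx y)) b) =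
      row_mx (a *m Y (lsubmx (sigma y))) (e^-1 *: b).
    by rewrite /L /= /sigma !row_mxKl !row_mxKr.
  rewrite (combination_derive oA sY cY rA oU T0 phiP _ _ Gy e0T) /= row_mxKl.
  by rewrite scalerA divff ?gt_eqF// scale1r.
Qed.

End CommutingFields.

(** * First integrals, integral manifolds and brackets *)

Section Frames.
Variable R : realType.

(** Along [a *m Y p] the argument (p, (m - p) S) of E moves by (a Y, - a), because Y S = 1, and the
    derivative of E in this direction is (a - a) Y = 0. At m the direction (v, - v S) splits into
    (v, 0), along which E is the identity, and (0, - v S), which contributes - v S Y. *)
Lemma first_integrals_exist n k (A : set 'rV[R]_n) (Y : 'rV[R]_n -> 'M[R]_(k, n))
    (S : 'M[R]_(n, k)) m :
  open A -> smooth_on A Y -> commuting A Y -> A m ->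
  (forall p, A p -> Y p *m S = 1%:M) ->
  exists (U : set 'rV[R]_n) (g : 'rV[R]_n -> 'rV[R]_n),
    [/\ open U, U m /\ U `<=` A, smooth_on U g,
      forall p a, U p -> 'D_(a *m Y p) g p = 0 &
      forall v, 'D_v g m = v - v *m S *m Y m].
Proof.
move=> oA sY cY Am YS.
have [G [E [oG Gm [sE GA] E0 DE]]] := commuting_exp oA sY cY Am.
pose J (p : 'rV[R]_n) : 'rV[R]_(n + k) := row_mx p ((m - p) *m S).
have lJ : linear (fun v : 'rV[R]_n => row_mx v (- (v *m S))).
  move=> a u v; rewrite mulmxDl -scalemxAl opprD -scalerN.
  by rewrite scale_row_mx add_row_mx.
pose L : {linear _ -> _} := HB.pack (fun v : 'rV[R]_n => row_mx v (- (v *m S)))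
  (GRing.isLinear.Build R 'rV[R]_n 'rV[R]_(n + k) _ _ lJ).
have sJ : smooth_on setT J.
  apply: smooth_on_row_mx; [exact: openT|exact: smooth_on_id|].
  apply: smooth_on_mulmx; [exact: openT| |exact: smooth_on_cst].
  apply: smooth_onD; [exact: openT|exact: smooth_on_cst|].
  by apply: smooth_onN; [exact: openT|exact: smooth_on_id].
have dJ p : differentiable J p by exact: (smooth_on_differentiable sJ).
have DJ p v : 'D_v J p = row_mx v (- (v *m S)).
  have dm : differentiable (fun p : 'rV[R]_n => m - p) p.
    by apply: differentiableB.
  rewrite derive_row_mx//; last exact: differentiable_mulmx.
  rewrite derive_id derive_mulmx// derive_cst mulmx0 addr0.
  by rewrite deriveB// derive_cst derive_id sub0r mulNmx.
pose U := [set p | G (J p)].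
have oU : open U.
  by apply: open_comp => // p _; exact: differentiable_continuous.
have JE p : lsubmx (J p) = p by rewrite row_mxKl.
have Jm : J m = row_mx m 0 by rewrite /J subrr mul0mx.
have Um : U m by rewrite /U /= Jm.
have UA p : U p -> A p by move=> /GA[]; rewrite JE.
have dE y : G y -> differentiable E y by exact: smooth_on_differentiable.
exists U, (E \o J); split=> //.
- apply: (smooth_on_comp oU oG _ _ sE) => //.
  exact: smooth_on_sub sJ.
- move=> p a Up; rewrite (derive_comp _ (dJ p) (dE _ Up)) DJ -mulmxA YS; last exact: UA.
  have := DE (J p) a (- a) Up; rewrite JE mulmx1 => ->.
  by rewrite subrr mul0mx.
- move=> v; rewrite (derive_comp _ (dJ m) (dE _ Um)) DJ Jm.
  have dEm := dE _ Gm.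
  have -> : row_mx v (- (v *m S)) = row_mx v 0 + row_mx (0 *m Y m) (- (v *m S)).
    by rewrite mul0mx add_row_mx addr0 add0r.
  rewrite (deriveE _ dEm) linearD -!(deriveE _ dEm).
  have := DE (row_mx m 0) 0 (- (v *m S)) Gm; rewrite row_mxKl => ->.
  rewrite E0// add0r mulNmx; congr (_ + _).
  have lj : linear (fun v : 'rV[R]_n => row_mx v (0 : 'rV[R]_k)).
    by move=> a x y; rewrite scale_row_mx add_row_mx scaler0 addr0.
  pose j : {linear _ -> _} := HB.pack (fun v : 'rV[R]_n => row_mx v (0 : 'rV[R]_k))
    (GRing.isLinear.Build R 'rV[R]_n 'rV[R]_(n + k) _ _ lj).
  have cj : continuous j.
    by apply: continuous_row_mx; [move=> x; exact: cvg_id|exact: cst_continuous].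
  have [dj jE] := derive_lin m v cj.
  rewrite -[row_mx v 0]/(j v) -jE -[row_mx m 0]/(j m) -derive_comp//.
  have oGj : open [set p | G (j p)] by apply: open_comp => // p _; exact: cj.
  have Ej : \forall p \near m, E (j p) = p by apply: (open_near oGj) => // p; exact: E0.
  by rewrite (near_eq_derive v (g := id)) ?derive_id//.
Qed.

(** With f (u) = E (q, u), the derivative in the direction b is (0 + b) Y. For injectivity, f (u) S
    - u has derivative b Y S - b = 0, hence is constant on a ball, and u is determined by f (u). *)
Lemma integral_manifold_exists n k (A U : set 'rV[R]_n)
    (Y : 'rV[R]_n -> 'M[R]_(k, n)) (S : 'M[R]_(n, k)) q :
  open A -> smooth_on A Y -> commuting A Y -> U `<=` A -> open U -> U q ->
  (forall p, A p -> Y p *m S = 1%:M) ->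
  exists (V : set 'rV[R]_k) (f : 'rV[R]_k -> 'rV[R]_n),
    [/\ open V, V 0 /\ f 0 = q, smooth_on V f /\ (forall u, V u -> U (f u)),
      forall u b, V u -> 'D_b f u = b *m Y (f u) &
      forall u u', V u -> V u' -> f u = f u' -> u = u'].
Proof.
move=> oA sY cY UA oU Uq YS; have Aq := UA _ Uq.
have [G [E [oG Gq [sE GA] E0 DE]]] := commuting_exp oA sY cY Aq.
pose J (u : 'rV[R]_k) : 'rV[R]_(n + k) := row_mx q u.
have sJ : smooth_on setT J.
  apply: smooth_on_row_mx; [exact: openT|exact: smooth_on_cst|exact: smooth_on_id].
have dJ u : differentiable J u by exact: (smooth_on_differentiable sJ).
have DJ u b : 'D_b J u = row_mx 0 b.
  by rewrite derive_row_mx// derive_cst derive_id.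
pose f := E \o J.
have oV0 : open [set u | G (J u)].
  by apply: open_comp => // u _; exact: differentiable_continuous.
have sf0 : smooth_on [set u | G (J u)] f.
  by apply: (smooth_on_comp oV0 oG _ _ sE) => //; exact: smooth_on_sub sJ.
have V00 : [set u | G (J u)] 0 by [].
have f0 : f 0 = q by exact: E0.
have nV : \forall u \near (0 : 'rV[R]_k), G (J u) /\ U (f u).
  have n1 : \forall u \near (0 : 'rV[R]_k), G (J u) by exact: open_nbhs_nbhs.
  have n2 : \forall u \near (0 : 'rV[R]_k), U (f u).
    apply: (smooth_on_continuous sf0 V00).
    by rewrite f0; exact: open_nbhs_nbhs.
  by apply: filterS2 n1 n2.
have /nbhs_closedballP[d dV] := nV; rewrite closed_ballE// in dV.
have Df u b : G (J u) -> 'D_b f u = b *m Y (f u).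
  move=> Gu; have dE : differentiable E (J u) by exact: smooth_on_differentiable Gu.
  rewrite (derive_comp _ (dJ u) dE) DJ.
  by have := DE (J u) 0 b Gu; rewrite mul0mx add0r.
have cV u : ball (0 : 'rV[R]_k) d%:num u -> cball 0 d%:num u.
  by rewrite -ball_normE /= => /ltW.
exists (ball 0 d%:num), f; split.
- exact: ball_open.
- by split=> //; exact: ballxx.
- split; first by apply: smooth_on_sub sf0 => u /cV/dV[].
  by move=> u /cV/dV[].
- by move=> u b /cV/dV[Gu _]; exact: Df.
- move=> u u' /cV cu /cV cu' ff.
  pose F u := f u *m S - u.
  have sF : smooth_on [set u | G (J u)] F.
    apply: smooth_onD => //.
      by apply: smooth_on_mulmx => //; exact: smooth_on_cst.
    by apply: smooth_onN => //; exact: smooth_on_id.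
  have cG : cball 0 d%:num `<=` [set u | G (J u)] by move=> w /dV[].
  have F0 : `|F u - F u'| <= 0.
    apply: (mean_value sF cG) => // w cw; have [Gw Uw] := dV w cw.
    have dfw : differentiable f w by exact: (smooth_on_differentiable sf0).
    have dS : differentiable (fun u => f u *m S) w by exact: differentiable_mulmx.
    have dS' v : 'D_v (fun u => f u *m S) w = v.
      rewrite (derive_mulmx v dfw (@differentiable_cst _ _ _ S w)) derive_cst.
      by rewrite mulmx0 addr0 Df// -mulmxA YS ?mulmx1//; exact: UA.
    have -> : 'D_(u - u') F w = 0; last by rewrite normr0.
    have di : derivable id w (u - u') by exact: derivable_id.
    have := deriveB (diff_derivable (v := u - u') dS) di.
    by rewrite dS' derive_id subrr.
  by move: F0; rewrite normr_le0 subr_eq0 /F ff => /eqP/addrI/oppr_inj.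
Qed.

Lemma open_unitmx n k (A : set 'rV[R]_n) (C : 'rV[R]_n -> 'M[R]_k) :
  open A -> smooth_on A C -> open (A `&` [set p | C p \in unitmx]).
Proof.
move=> oA /(smooth_on_det oA) sd; rewrite openE => p [Ap].
rewrite /= unitmxE unitfE => dp.
have n1 : \forall q \near p, A q by exact: open_nbhs_nbhs.
have n2 : \forall q \near p, \det (C q) != 0.
  exact: (cvgr_neq0 _ (smooth_on_continuous sd Ap) dp).
by apply: filterS2 n1 n2 => q Aq dq; split; rewrite /= ?unitmxE ?unitfE.
Qed.

(** A right inverse S of [X m], kept constant, leaves X S invertible near m; multiplying X by the
    inverse of X S changes the frame but not its span. *)
Lemma normalize_frame n k (A : set 'rV[R]_n) (X : 'rV[R]_n -> 'M[R]_(k, n)) m :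
  open A -> smooth_on A X -> A m -> row_free (X m) ->
  exists (U : set 'rV[R]_n) (S : 'M[R]_(n, k)) (Y : 'rV[R]_n -> 'M[R]_(k, n)),
    [/\ open U, U m /\ U `<=` A, smooth_on U Y,
      forall p, U p -> Y p *m S = 1%:M & forall p, U p -> (Y p :=: X p)%MS].
Proof.
move=> oA sX Am /row_freeP[S XS].
pose C p := X p *m S; have sC : smooth_on A C.
  by apply: smooth_on_mulmx => //; exact: smooth_on_cst.
pose U := A `&` [set p | C p \in unitmx].
have oU : open U by exact: open_unitmx.
have UC p : U p -> C p \in unitmx by move=> [].
have UA : U `<=` A by move=> p [].
exists U, S, (fun p => invmx (C p) *m X p); split=> //.
- by split=> //; split=> //=; rewrite /C XS unitmx1.
- apply: smooth_on_mulmx => //; last exact: smooth_on_sub sX.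
  by apply: smooth_on_invmx => //; exact: smooth_on_sub sC.
- by move=> p Up; rewrite -mulmxA mulVmx// UC.
- by move=> p Up; apply: eqmxMfull; rewrite row_full_unit unitmx_inv UC.
Qed.

(** A bracket in the span of Y has the form c Y. Differentiating Y S = 1 shows that every derivative
    of Y is killed by S, so that the bracket times S is 0; but c Y S = c. *)
Lemma commuting_of_bracket n k (A : set 'rV[R]_n) (Y : 'rV[R]_n -> 'M[R]_(k, n))
    (S : 'M[R]_(n, k)) : open A -> smooth_on A Y ->
  (forall p, A p -> Y p *m S = 1%:M) ->
  (forall p a b, A p ->
    (b *m 'D_(a *m Y p) Y p - a *m 'D_(b *m Y p) Y p <= Y p)%MS) ->
  commuting A Y.
Proof.
move=> oA sY YS br p Ap a b; apply/eqP; rewrite -subr_eq0.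
have /submxP[c cE] := br p a b Ap; rewrite cE.
have dY : differentiable Y p by exact: (smooth_on_differentiable sY).
have YS0 v : 'D_v Y p *m S = 0.
  have := derive_mulmx v dY (@differentiable_cst _ _ _ S p).
  rewrite derive_cst mulmx0 addr0 => <-.
  rewrite (near_eq_derive v (g := cst 1%:M)) ?derive_cst//.
  exact: (open_near oA).
have zYS (z : 'rV_k) v : z *m 'D_v Y p *m S = 0 by rewrite -mulmxA YS0 mulmx0.
have : c *m Y p *m S = 0.
  move: cE (zYS b (a *m Y p)) (zYS a (b *m Y p)).
  move: (b *m _) (a *m 'D__ _ _) => X X' <- XS X'S.
  by rewrite mulmxBl XS X'S subrr.
by rewrite -mulmxA YS// mulmx1 => ->; rewrite mul0mx.
Qed.

Lemma smooth_on_jacobian n k (A : set 'rV[R]_n) (P : 'rV[R]_n -> 'rV[R]_k) :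
  open A -> smooth_on A P -> smooth_on A (jacobian P).
Proof.
move=> oA sP; apply/(smooth_on_mx oA) => i j.
have /(smooth_on_mx oA)/(_ 0 j) := smooth_on_derive (delta_mx 0 i) sP.
apply: smooth_on_eq => // x Ax; rewrite !mxE deriveE//.
exact: smooth_on_differentiable Ax.
Qed.

(** Since [v *m jacobian P x] is the derivative of P along v, each entry of either side is a second
    derivative of a component of P. *)
Lemma hessian_sym n k (A : set 'rV[R]_n) (P : 'rV[R]_n -> 'rV[R]_k) x u v :
  open A -> smooth_on A P -> A x ->
  u *m 'D_v (jacobian P) x = v *m 'D_u (jacobian P) x.
Proof.
move=> oA sP Ax.
have H (a b : 'rV[R]_n) j : (a *m 'D_b (jacobian P) x) 0 j =
    'D_b ('D_a (fun y => P y 0 j)) x.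
  have dJ : differentiable (jacobian P) x.
    by apply: smooth_on_differentiable Ax; exact: smooth_on_jacobian.
  have := derive_mulmx b (@differentiable_cst _ _ _ a x) dJ.
  rewrite derive_cst mul0mx add0r => <-.
  have dm : differentiable (fun y => cst a y *m jacobian P y) x by exact: differentiable_mulmx.
  rewrite -(derive_coord b 0 j dm); apply: near_eq_derive.
  apply: (open_near oA Ax) => y Ay; have dP : differentiable P y by exact: smooth_on_differentiable Ay.
  by rewrite derive_coord// deriveEjacobian.
apply/rowP => j; have /(smooth_on_mx oA)/(_ 0 j) sPj := sP.
exact: etrans (H u v j) (etrans (derive_sym v u oA sPj Ax) (esym (H v u j))).
Qed.

Definition bracket n (y z : 'rV[R]_n -> 'rV[R]_n) x := 'D_(y x) z x - 'D_(z x) y x.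

(** Differentiating [y x *m jacobian P x = 0] moves the derivative from y onto the jacobian; the
    bracket times the jacobian becomes a difference of two values of the Hessian with its arguments
    exchanged. *)
Lemma bracket_ker n k (A : set 'rV[R]_n) (P : 'rV[R]_n -> 'rV[R]_k) y z x :
  open A -> smooth_on A P -> smooth_on A y -> smooth_on A z -> A x ->
  (forall x, A x -> y x *m jacobian P x = 0) ->
  (forall x, A x -> z x *m jacobian P x = 0) ->
  bracket y z x *m jacobian P x = 0.
Proof.
move=> oA sP sy sz Ax yJ zJ.
have sJ := smooth_on_jacobian oA sP.
have dJ : differentiable (jacobian P) x by exact: smooth_on_differentiable Ax.
have H (y' : 'rV[R]_n -> 'rV[R]_n) v : smooth_on A y' ->
    (forall x, A x -> y' x *m jacobian P x = 0) ->
    'D_v y' x *m jacobian P x = - (y' x *m 'D_v (jacobian P) x).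
  move=> sy' y'J; have dy' : differentiable y' x by exact: smooth_on_differentiable Ax.
  apply/eqP; rewrite -addr_eq0; apply/eqP.
  rewrite -(derive_mulmx v dy' dJ) (near_eq_derive v (g := cst 0)) ?derive_cst//.
  exact: (open_near oA).
rewrite /bracket mulmxBl !H// opprK addrC.
by rewrite (hessian_sym _ _ oA sP Ax) subrr.
Qed.

Lemma skew_mxC n (W : 'M[R]_n) (u v : 'rV[R]_n) : W^T = - W ->
  v *m W *m u^T = - (u *m W *m v^T).
Proof.
move=> Ws; have -> : v *m W *m u^T = (v *m W *m u^T)^T.
  by apply/matrixP => i j; rewrite !ord1 [RHS]mxE.
by rewrite trmx_mul trmxK trmx_mul Ws mulNmx mulmxN mulmxA.
Qed.

(** * Closed forms in matrix notation *)

Section Cartan.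
Variables (n : nat) (A : set 'rV[R]_n) (W : 'rV[R]_n -> 'M[R]_n).
Hypotheses (oA : open A) (sW : smooth_on A W).
Hypothesis W_skew : forall x, A x -> (W x)^T = - W x.
Hypothesis W_closed : forall x i j k, A x ->
  'D_(delta_mx 0 i) (fun y => W y j k) x + 'D_(delta_mx 0 j) (fun y => W y k i) x
  + 'D_(delta_mx 0 k) (fun y => W y i j) x = 0.

Lemma form_mxE (u v : 'rV[R]_n) (M : 'M[R]_n) :
  (u *m M *m v^T) 0 0 = \sum_i \sum_j u 0 i * v 0 j * M i j.
Proof.
rewrite mxE exchange_big /=; apply: eq_bigr => j _; rewrite !mxE mulr_suml.
by apply: eq_bigr => i _; rewrite mulrAC.
Qed.

Lemma closed_form_mx x (u v w : 'rV[R]_n) : A x ->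
  v *m 'D_u W x *m w^T + w *m 'D_v W x *m u^T + u *m 'D_w W x *m v^T = 0.
Proof.
move=> Ax; have dW : differentiable W x by exact: smooth_on_differentiable Ax.
pose D i j k := 'D_(delta_mx 0 i) (fun y => W y j k) x.
have H (a b c : 'rV[R]_n) : (b *m 'D_a W x *m c^T) 0 0 =
    \sum_i \sum_j \sum_k a 0 i * b 0 j * c 0 k * D i j k.
  rewrite form_mxE [RHS]exchange_big /=; apply: eq_bigr => j _.
  rewrite [RHS]exchange_big /=; apply: eq_bigr => k _.
  rewrite (derive_delta _ dW) summxE mulr_sumr; apply: eq_bigr => i _.
  by rewrite mxE -derive_coord// /D; ring.
apply/matrixP => i j; rewrite !ord1 2!mxE !H [RHS]mxE.
(* The sums are reordered cyclically so that all three run over the coordinates of u, v, w in the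
   same order; the closedness identity then applies termwise. *)
have -> : \sum_i \sum_j \sum_k v 0 i * w 0 j * u 0 k * D i j k =
    \sum_k \sum_i \sum_j v 0 i * w 0 j * u 0 k * D i j k.
  by rewrite [RHS]exchange_big; apply: eq_bigr => a _; rewrite [RHS]exchange_big.
have -> : \sum_i \sum_j \sum_k w 0 i * u 0 j * v 0 k * D i j k =
    \sum_j \sum_k \sum_i w 0 i * u 0 j * v 0 k * D i j k.
  by rewrite exchange_big; apply: eq_bigr => a _; rewrite exchange_big.
rewrite -!big_split big1// => a _; rewrite -!big_split big1// => b _.
rewrite -!big_split big1// => c _ /=.
transitivity (u 0 a * v 0 b * w 0 c * (D a b c + D b c a + D c a b)).
  by ring.
by rewrite W_closed// mulr0.
Qed.

(** In Cartan's formula for the exterior derivative of the form, the terms that differentiate the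
    pairings of the fields vanish, since these pairings are zero on A; only the brackets remain.
    Concretely, the three pairings are differentiated, each along the third field, and closedness
    removes the derivatives of W. *)
Lemma cartan y1 y2 y3 x : smooth_on A y1 -> smooth_on A y2 -> smooth_on A y3 -> A x ->
  (forall x, A x -> y1 x *m W x *m (y2 x)^T = 0) ->
  (forall x, A x -> y2 x *m W x *m (y3 x)^T = 0) ->
  (forall x, A x -> y3 x *m W x *m (y1 x)^T = 0) ->
  bracket y1 y2 x *m W x *m (y3 x)^T + bracket y2 y3 x *m W x *m (y1 x)^T
  + bracket y3 y1 x *m W x *m (y2 x)^T = 0.
Proof.
move=> s1 s2 s3 Ax h12 h23 h31.
have dW : differentiable W x by exact: smooth_on_differentiable Ax.
have H (y z : 'rV[R]_n -> 'rV[R]_n) v : smooth_on A y -> smooth_on A z ->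
    (forall x, A x -> y x *m W x *m (z x)^T = 0) ->
    'D_v y x *m W x *m (z x)^T + y x *m 'D_v W x *m (z x)^T
    - 'D_v z x *m W x *m (y x)^T = 0.
  move=> sy sz yz.
  have dy : differentiable y x by exact: smooth_on_differentiable Ax.
  have dz : differentiable z x by exact: smooth_on_differentiable Ax.
  have dzt : differentiable (fun x => (z x)^T) x.
    by apply: smooth_on_differentiable Ax; exact: smooth_on_trmx.
  have dyW := differentiable_mulmx dy dW.
  have := derive_mulmx v dyW dzt; rewrite (derive_mulmx v dy dW) mulmxDl.
  rewrite (near_eq_derive v (g := cst 0)); last exact: (open_near oA).
  rewrite derive_cst.
  have -> : 'D_v (fun x => (z x)^T) x = ('D_v z x)^T.
    apply/matrixP => i j; rewrite mxE -!derive_coord//.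
    by congr ('D_v _ x); apply/funext => p; rewrite mxE.
  by rewrite [in X in _ + X](skew_mxC _ _ (W_skew Ax)) => <-.
have e1 := H y2 y3 (y1 x) s2 s3 h23.
have e2 := H y3 y1 (y2 x) s3 s1 h31.
have e3 := H y1 y2 (y3 x) s1 s2 h12.
have c := closed_form_mx (y1 x) (y2 x) (y3 x) Ax.
have arith (a1 a2 a3 b1 b2 b3 c1 c2 c3 : 'M[R]_1) : a1 + b1 - c1 = 0 ->
    a2 + b2 - c2 = 0 -> a3 + b3 - c3 = 0 -> b1 + b2 + b3 = 0 ->
    a1 - c2 + (a2 - c3) + (a3 - c1) = 0.
  move=> /subr0_eq <- /subr0_eq <- /subr0_eq <- bs; apply/matrixP => i j.
  by move/matrixP/(_ i j): bs; rewrite !mxE; lra.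
have brE (y z t : 'rV[R]_n -> 'rV[R]_n) : bracket y z x *m W x *m (t x)^T =
    'D_(y x) z x *m W x *m (t x)^T - 'D_(z x) y x *m W x *m (t x)^T.
  by rewrite /bracket !mulmxBl.
apply: etrans (arith _ _ _ _ _ _ _ _ _ e1 e2 e3 c).
congr (_ + _ + _); exact: brE.
Qed.

End Cartan.
End Frames.

(** * Functions in involution *)

Section LinearAlgebra.
Variable R : realType.

Lemma eqmx_of_rank k l n (A : 'M[R]_(k, n)) (B : 'M[R]_(l, n)) :
  (A <= B)%MS -> (\rank B <= \rank A)%N -> (A :=: B)%MS.
Proof.
move=> AB BA; apply/eqmxP; rewrite -(mxrank_leqif_eq AB).
by rewrite eqn_leq BA mxrankS.
Qed.

(** Duality: the columns of [cokermx M] are annihilated by M and suffice to test membership in its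
    row space. *)
Lemma submx_ann k n (u : 'rV[R]_n) (M : 'M[R]_(k, n)) :
  (forall w : 'rV[R]_n, M *m w^T = 0 -> u *m w^T = 0) -> (u <= M)%MS.
Proof.
move=> H; rewrite submxE; apply/eqP/rowP => j; rewrite [RHS]mxE.
have Mj : M *m ((col j (cokermx M))^T)^T = 0.
  by rewrite trmxK colE mulmxA mulmx_coker mul0mx.
have /matrixP/(_ 0 0) := H _ Mj; rewrite trmxK colE mulmxA -colE.
by rewrite [X in X = _ -> _]mxE [X in _ = X -> _]mxE.
Qed.

Section Perp.
Variables (n k : nat) (W : 'M[R]_n) (J : 'M[R]_(n, k)).
Hypotheses (Wu : W \in unitmx) (Ws : W^T = - W).

Lemma invmx_skew : (invmx W)^T = - invmx W.
Proof.
apply: (can_inj (mulmxK Wu)); rewrite mulNmx mulVmx//.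
have -> : (invmx W)^T *m W = - ((invmx W)^T *m W^T) by rewrite Ws mulmxN opprK.
by rewrite -trmx_mul mulmxV// trmx1.
Qed.

(** Multiplication by W turns the span of J^T W^-1 into the span of J^T, which is the annihilator of
    the kernel of J: K is the symplectic orthogonal of ker dP. *)
Lemma sub_hamP (u : 'rV[R]_n) : (u <= J^T *m invmx W)%MS <->
  (forall w : 'rV[R]_n, w *m J = 0 -> u *m W *m w^T = 0).
Proof.
split=> [/submxP[c ->] w wJ|uw].
  rewrite -!mulmxA (mulmxA (invmx W)) mulVmx// mul1mx.
  by rewrite -trmx_mul wJ trmx0 mulmx0.
have /submxP[c uc] : (u *m W <= J^T)%MS.
  apply: submx_ann => w Jw; apply: uw.
  by apply: trmx_inj; rewrite trmx_mul Jw trmx0.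
by apply/submxP; exists c; rewrite mulmxA -uc mulmxK.
Qed.

Lemma rank_ham : \rank (J^T *m invmx W) = \rank J.
Proof. by rewrite mxrankMfree ?mxrank_tr// row_free_unit unitmx_inv. Qed.

(** The converse orthogonality, that ker dP is the orthogonal of K: pairing u with the rows of J^T
    W^-1 gives the entries of u J up to sign. *)
Lemma ker_hamP (u : 'rV[R]_n) : u *m J = 0 <->
  (forall w : 'rV[R]_n, (w <= J^T *m invmx W)%MS -> u *m W *m w^T = 0).
Proof.
split=> [uJ w /sub_hamP wP|H].
  by rewrite (skew_mxC _ _ Ws) wP ?oppr0.
apply: trmx_inj; rewrite trmx0 trmx_mul; apply/row_matrixP => i; rewrite row0 row_mul.
have := H (row i (J^T *m invmx W)) (row_sub _ _).
rewrite (skew_mxC _ _ Ws) row_mul -!mulmxA (mulmxA (invmx W)) mulVmx// mul1mx.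
by move=> /eqP; rewrite oppr_eq0 => /eqP.
Qed.

(** The hypothesis on J says that K lies in ker dP, the orthogonal of K. *)
Lemma ham_isotropic (u v : 'rV[R]_n) : J^T *m invmx W *m J = 0 ->
  (u <= J^T *m invmx W)%MS -> (v <= J^T *m invmx W)%MS -> u *m W *m v^T = 0.
Proof.
move=> XJ uX /submxP[c ->]; move/sub_hamP: uX; apply.
by rewrite -mulmxA XJ mulmx0.
Qed.

End Perp.
End LinearAlgebra.

(** * Commuting frames of K and of ker dP *)

Section Local.
Variable R : realType.
Variables (n : nat) (A0 : set 'rV[R]_n) (W : 'rV[R]_n -> 'M[R]_n).
Variables (h : 'rV[R]_n -> R) (m : 'rV[R]_n).
Hypothesis sW : smooth_on A0 W.
Hypothesis W_unit : forall x, A0 x -> W x \in unitmx.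
Hypothesis W_skew : forall x, A0 x -> (W x)^T = - W x.
Hypothesis W_closed : forall x i j k, A0 x ->
  'D_(delta_mx 0 i) (fun y => W y j k) x + 'D_(delta_mx 0 j) (fun y => W y k i) x
  + 'D_(delta_mx 0 k) (fun y => W y i j) x = 0.

(* The rows are the Hamiltonian vector fields of the components of P. *)
Definition ham k (P : 'rV[R]_n -> 'rV[R]_k) x := (jacobian P x)^T *m invmx (W x).

(** The entries of [ham P x *m jacobian P x] are, up to sign, the Poisson brackets of the components
    of P. Independence is required at m only, because the domain is shrunk when it is used. The last
    clause, dh in the span of dP, is all that is remembered of h being a component. *)
Definition in_involution k (A : set 'rV[R]_n) (P : 'rV[R]_n -> 'rV[R]_k) :=
  [/\ open A /\ (A m /\ A `<=` A0), smooth_on A P, row_free (jacobian P m)^T,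
    forall x, A x -> ham P x *m jacobian P x = 0 &
    forall x v, A x -> v *m jacobian P x = 0 -> 'D_v h x = 0].

Lemma smooth_on_ham k A (P : 'rV[R]_n -> 'rV[R]_k) : open A -> A `<=` A0 ->
  smooth_on A P -> smooth_on A (ham P).
Proof.
move=> oA AA0 sP; apply: smooth_on_mulmx => //.
  by apply: smooth_on_trmx => //; exact: smooth_on_jacobian.
apply: smooth_on_invmx => //; first by move=> x /AA0; exact: W_unit.
exact: smooth_on_sub sW.
Qed.

Lemma field_bracket k (B : set 'rV[R]_n) (Y : 'rV[R]_n -> 'M[R]_(k, n)) a b x :
  smooth_on B Y -> B x ->
  b *m 'D_(a *m Y x) Y x - a *m 'D_(b *m Y x) Y x =
  bracket (fun x => a *m Y x) (fun x => b *m Y x) x.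
Proof.
move=> sY Bx; have dY : differentiable Y x by exact: (smooth_on_differentiable sY).
have H (c : 'rV[R]_k) v : 'D_v (fun x => c *m Y x) x = c *m 'D_v Y x.
  have := derive_mulmx v (@differentiable_cst _ _ _ c x) dY.
  by rewrite derive_cst mul0mx add0r.
by rewrite /bracket; congr (_ - _); rewrite H.
Qed.

Lemma rank_of_right_inverse k (M : 'M[R]_(k, n)) S : M *m S = 1%:M -> \rank M = k.
Proof. by move=> MS; apply/eqP; apply/row_freeP; exists S. Qed.

Lemma kernel_frame k l A (P : 'rV[R]_n -> 'rV[R]_k) : (k + l)%N = n ->
  open A -> A m -> smooth_on A P -> row_free (jacobian P m)^T ->
  exists (B : set 'rV[R]_n) (S : 'M[R]_(n, l)) (Z : 'rV[R]_n -> 'M[R]_(l, n)),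
    [/\ open B /\ (B m /\ B `<=` A), smooth_on B Z, commuting B Z,
      forall x, B x -> Z x *m S = 1%:M &
      forall x, B x -> (Z x :=: kermx (jacobian P x))%MS].
Proof.
move=> kln oA Am sP; set J := jacobian P => Jm.
have /row_freeP[Q JQ] := Jm.
have QJm : Q^T *m J m = 1%:M by apply: trmx_inj; rewrite trmx_mul trmxK JQ trmx1.
have sJ : smooth_on A J by exact: smooth_on_jacobian.
have sQJ : smooth_on A (fun x => Q^T *m J x).
  by apply: smooth_on_mulmx => //; exact: smooth_on_cst.
pose A1 := A `&` [set x | Q^T *m J x \in unitmx].
have oA1 : open A1 by exact: open_unitmx.
have A1A : A1 `<=` A by move=> x [].
have A1m : A1 m by split=> //=; rewrite QJm unitmx1.
have rJ x : A1 x -> \rank (J x) = k.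
  move=> [_ /= u]; apply/eqP; rewrite eqn_leq rank_leq_col /=.
  by have := mxrankM_maxr Q^T (J x); rewrite (mxrank_unit u).
have rK x : A1 x -> \rank (kermx (J x)) = l.
  by move=> A1x; rewrite mxrank_ker rJ// -kln addKn.
have [B0 [B0f B0k]] : exists B0 : 'M[R]_(l, n), row_free B0 /\ B0 *m J m = 0.
  rewrite -(rK m A1m); exists (row_base (kermx (J m))); split.
    exact: row_base_free.
  by apply/sub_kermxP; rewrite eq_row_base.
(* The matrix 1 - J (Q^T J)^-1 Q^T is a smooth projection onto the left kernel of J; it extends the
   basis [B0] of the kernel at m to nearby points. *)
pose X x := B0 *m (1%:M - J x *m invmx (Q^T *m J x) *m Q^T).
have XJ x : A1 x -> X x *m J x = 0.
  move=> [_ /= u]; rewrite /X -mulmxA mulmxBl mul1mx -!mulmxA mulVmx// mulmx1.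
  by rewrite subrr mulmx0.
have Xm : X m = B0.
  by rewrite /X mulmxBr mulmx1 !mulmxA B0k !mul0mx subr0.
have sX : smooth_on A1 X.
  have sJ1 : smooth_on A1 J := smooth_on_sub A1A sJ.
  apply: smooth_on_mulmx => //; first exact: smooth_on_cst.
  apply: smooth_onD => //; first exact: smooth_on_cst.
  apply: smooth_onN => //; apply: smooth_on_mulmx => //; last exact: smooth_on_cst.
  apply: smooth_on_mulmx => //; apply: smooth_on_invmx => //.
    by move=> x [].
  exact: smooth_on_sub sQJ.
have fX : row_free (X m) by rewrite Xm.
have [B [S [Z [oB [Bm BA1] sZ ZS ZX]]]] := normalize_frame oA1 sX A1m fX.
have BA : B `<=` A by move=> x /BA1/A1A.
have ZJ x : B x -> Z x *m J x = 0.
  move=> Bx; apply/sub_kermxP; rewrite (ZX x Bx); apply/sub_kermxP.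
  exact: XJ (BA1 x Bx).
have ZK x : B x -> (Z x :=: kermx (J x))%MS.
  move=> Bx; apply: eqmx_of_rank; first by apply/sub_kermxP; exact: ZJ.
  by rewrite (rank_of_right_inverse (ZS x Bx)) (rK x (BA1 x Bx)).
exists B, S, Z; split; [by split|exact: sZ| |exact: ZS|exact: ZK].
apply: (commuting_of_bracket oB sZ ZS) => x a b Bx.
rewrite (field_bracket _ _ sZ Bx) (ZK x Bx); apply/sub_kermxP.
have sc (c : 'rV[R]_l) : smooth_on B (fun x => c *m Z x).
  by apply: smooth_on_mulmx => //; exact: smooth_on_cst.
apply: (bracket_ker oB (smooth_on_sub BA sP) (sc a) (sc b) Bx).
  by move=> y By; rewrite -mulmxA (ZJ y By) mulmx0.
by move=> y By; rewrite -mulmxA (ZJ y By) mulmx0.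
Qed.

(** The involutivity of K is tested, by [sub_hamP], by pairing the bracket of two of its fields with
    a vector of ker dP, extended to a field c Z. In Cartan's identity for these three fields, the
    other two brackets involve c Z and a field of K; both arguments lie in ker dP, which is
    involutive, so these brackets are orthogonal to K and drop out. *)
Lemma frames k l A (P : 'rV[R]_n -> 'rV[R]_k) : (k + l)%N = n -> in_involution A P ->
  exists (B : set 'rV[R]_n) (S : 'M[R]_(n, k)) (Y : 'rV[R]_n -> 'M[R]_(k, n))
    (S' : 'M[R]_(n, l)) (Z : 'rV[R]_n -> 'M[R]_(l, n)),
  [/\ open B /\ (B m /\ B `<=` A), smooth_on B Y /\ smooth_on B Z,
    commuting B Y /\ commuting B Z,
    forall x, B x -> Y x *m S = 1%:M /\ Z x *m S' = 1%:M &
    forall x, B x -> (Y x :=: ham P x)%MS /\ (Z x :=: kermx (jacobian P x))%MS].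
Proof.
move=> kln [[oA [Am AA0]] sP Jm XJ _].
have [B1 [S' [Z [[oB1 [B1m B1A]] sZ cZ ZS ZK]]]] := kernel_frame kln oA Am sP Jm.
have B1A0 : B1 `<=` A0 by move=> x /B1A/AA0.
have sX : smooth_on B1 (ham P).
  by apply: smooth_on_ham => //; exact: smooth_on_sub sP.
have fX : row_free (ham P m).
  by rewrite /row_free (rank_ham _ (W_unit (AA0 _ Am))) -mxrank_tr.
have [B [S [Y [oB [Bm BB1] sY YS YX]]]] := normalize_frame oB1 sX B1m fX.
have sZB : smooth_on B Z by exact: smooth_on_sub sZ.
exists B, S, Y, S', Z; split.
- by split=> //; split=> // x /BB1/B1A.
- by [].
- split; last by move=> x /BB1; exact: cZ.
  apply: (commuting_of_bracket oB sY YS) => x a b Bx.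
  rewrite (field_bracket _ _ sY Bx).
  have BA0 : B `<=` A0 by move=> y /BB1/B1A0.
  have BA : B `<=` A by move=> y /BB1/B1A.
  rewrite (YX x Bx); apply/sub_hamP; first by apply: W_unit; exact: BA0.
  move=> w wJ; have /submxP[c wc] : (w <= Z x)%MS by rewrite ZK; [apply/sub_kermxP|exact: BB1].
  have sc (c' : 'rV[R]_k) : smooth_on B (fun x => c' *m Y x).
    by apply: smooth_on_mulmx => //; exact: smooth_on_cst.
  have sz : smooth_on B (fun x => c *m Z x).
    by apply: smooth_on_mulmx => //; exact: smooth_on_cst.
  have Yh y (c' : 'rV[R]_k) : B y -> (c' *m Y y <= ham P y)%MS.
    by move=> By; rewrite (submx_trans (submxMl _ _))// YX.
  have ZJ y : B y -> c *m Z y *m jacobian P y = 0.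
    by move=> /BB1 By; apply/sub_kermxP; rewrite (submx_trans (submxMl _ _))// ZK.
  have YJ y (c' : 'rV[R]_k) : B y -> c' *m Y y *m jacobian P y = 0.
    move=> By; have /submxP[d ->] := Yh y c' By.
    by rewrite -mulmxA XJ ?mulmx0//; exact: BA.
  have YY y (a' b' : 'rV[R]_k) : B y -> a' *m Y y *m W y *m (b' *m Y y)^T = 0.
    move=> By; apply: (ham_isotropic (J := jacobian P y)); [|exact: XJ (BA _ By)|exact: Yh|exact: Yh].
    exact/W_unit/BA0.
  have YZ y (a' : 'rV[R]_k) : B y -> a' *m Y y *m W y *m (c *m Z y)^T = 0.
    by move=> By; have /sub_hamP := Yh y a' By; apply; [exact/W_unit/BA0|exact: ZJ].
  have ZY y (a' : 'rV[R]_k) : B y -> c *m Z y *m W y *m (a' *m Y y)^T = 0.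
    by move=> By; rewrite skew_mxC ?YZ ?oppr0//; exact/W_skew/BA0.
  have YZb (a' : 'rV[R]_k) : bracket (fun x => a' *m Y x) (fun x => c *m Z x) x *m jacobian P x = 0.
    by apply: (bracket_ker oB (smooth_on_sub BA sP) (sc a') sz Bx) => y; [exact: YJ|exact: ZJ].
  have ZYb (a' : 'rV[R]_k) : bracket (fun x => c *m Z x) (fun x => a' *m Y x) x *m jacobian P x = 0.
    by apply: (bracket_ker oB (smooth_on_sub BA sP) sz (sc a') Bx) => y; [exact: ZJ|exact: YJ].
  have kW (u : 'rV[R]_n) (a' : 'rV[R]_k) : u *m jacobian P x = 0 -> u *m W x *m (a' *m Y x)^T = 0.
    move=> uJ; have /ker_hamP := uJ; apply; [exact/W_unit/BA0|exact/W_skew/BA0|exact: Yh].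
  have arith (x1 x2 x3 : 'M[R]_1) : x1 + x2 + x3 = 0 -> x2 = 0 -> x3 = 0 -> x1 = 0.
    by move=> + x20 x30; rewrite x20 x30 !addr0.
  have C := cartan oB (smooth_on_sub BA0 sW) (fun x Bx => W_skew (BA0 x Bx))
    (fun x i j k Bx => W_closed i j k (BA0 x Bx)) (sc a) (sc b) sz Bx
    (fun y => YY y a b) (fun y => YZ y b) (fun y => ZY y a).
  by rewrite wc; exact: arith C (kW _ a (YZb b)) (kW _ b (ZYb a)).
- by move=> x Bx; split; [exact: YS|exact/ZS/BB1].
- by move=> x Bx; split; [exact: YX|exact/ZK/BB1].
Qed.

End Local.

(** * Completing H to functions in involution *)

Section LocalSystem.
Variable R : realType.
Variables (n : nat) (A0 : set 'rV[R]_n) (W : 'rV[R]_n -> 'M[R]_n).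
Variables (h : 'rV[R]_n -> R) (m : 'rV[R]_n).
Hypotheses (oA0 : open A0) (sW : smooth_on A0 W).
Hypothesis W_unit : forall x, A0 x -> W x \in unitmx.
Hypothesis W_skew : forall x, A0 x -> (W x)^T = - W x.
Hypothesis W_closed : forall x i j k, A0 x ->
  'D_(delta_mx 0 i) (fun y => W y j k) x + 'D_(delta_mx 0 j) (fun y => W y k i) x
  + 'D_(delta_mx 0 k) (fun y => W y i j) x = 0.
Hypotheses (A0m : A0 m) (sh : smooth_on A0 h) (v0 : 'rV[R]_n) (dh : 'D_v0 h m != 0).

Local Notation hamW := (ham W).
Local Notation in_involutionW := (in_involution A0 W h m).

Definition snoc k (P : 'rV[R]_n -> 'rV[R]_k) (g : 'rV[R]_n -> R) x : 'rV[R]_(k + 1) :=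
  row_mx (P x) (const_mx (g x) : 'rV[R]_1).

Lemma differentiable_const_mx (g : 'rV[R]_n -> R) x : differentiable g x ->
  differentiable (fun y => const_mx (g y) : 'rV[R]_1) x.
Proof.
by move=> dg; apply: differentiable_mx => i j; under eq_fun do rewrite mxE.
Qed.

Lemma jacobian_const_mx (g : 'rV[R]_n -> R) x v : differentiable g x ->
  v *m jacobian (fun y => const_mx (g y) : 'rV[R]_1) x = const_mx ('D_v g x).
Proof.
move=> dg; have dc := differentiable_const_mx dg.
rewrite -deriveEjacobian//; apply/rowP => j; rewrite -derive_coord// [RHS]mxE.
by congr ('D_v _ x); apply/funext => y; rewrite mxE.
Qed.

Lemma jacobian_snoc k (P : 'rV[R]_n -> 'rV[R]_k) (g : 'rV[R]_n -> R) x :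
  differentiable P x -> differentiable g x -> jacobian (snoc P g) x =
  row_mx (jacobian P x) (jacobian (fun y => const_mx (g y) : 'rV[R]_1) x).
Proof.
move=> dP dg; have dc := differentiable_const_mx dg.
have ds : differentiable (snoc P g) x by exact: differentiable_row_mx.
apply/row_matrixP => i; rewrite !rowE mul_mx_row -!deriveEjacobian//.
exact: derive_row_mx.
Qed.

Section Extend.
Variables (k : nat) (A : set 'rV[R]_n) (P : 'rV[R]_n -> 'rV[R]_k).
Variables (g : 'rV[R]_n -> R) (v : 'rV[R]_n).
Hypotheses (oA : open A) (Am : A m) (AA0 : A `<=` A0).
Hypotheses (sP : smooth_on A P) (sg : smooth_on A g).
Hypotheses (Pm : row_free (jacobian P m)^T).
Hypotheses (XJ : forall x, A x -> hamW P x *m jacobian P x = 0).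
Hypotheses (Xg : forall x a, A x -> 'D_(a *m hamW P x) g x = 0).
Hypotheses (vP : v *m jacobian P m = 0) (vg : 'D_v g m != 0).

Let dP x : A x -> differentiable P x.
Proof. exact: smooth_on_differentiable. Qed.

Let dg x : A x -> differentiable g x.
Proof. exact: smooth_on_differentiable. Qed.

Lemma snoc_smooth : smooth_on A (snoc P g).
Proof.
apply: smooth_on_row_mx => //; apply/(smooth_on_mx oA) => i j.
by under eq_fun do rewrite mxE.
Qed.

(** The vector v is killed by dP but not by dg at m, so that dg is independent of dP there. *)
Lemma snoc_row_free : row_free (jacobian (snoc P g) m)^T.
Proof.
rewrite (jacobian_snoc (dP Am) (dg Am)) tr_row_mx.
rewrite -kermx_eq0; apply/eqP/eqP/rowV0P => w /sub_kermxP.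
rewrite -[w]hsubmxK mul_row_col; set a := lsubmx w; set b := rsubmx w => ab.
have b0 : b = 0.
  have := congr1 (mulmx^~ v^T) ab; rewrite mulmxDl -!mulmxA -!trmx_mul vP.
  rewrite jacobian_const_mx; last exact: dg.
  rewrite trmx0 mulmx0 add0r mul0mx => /matrixP/(_ 0 0).
  rewrite mxE big_ord1 [X in _ * X]mxE [X in _ * X]mxE [RHS]mxE => /eqP.
  rewrite mulf_eq0 (negbTE vg) orbF => /eqP bb.
  by apply/matrixP => i j; rewrite !ord1 bb mxE.
have a0 : a = 0.
  move: ab; rewrite b0 mul0mx addr0 => aJ.
  by apply: (row_free_inj Pm); rewrite aJ mul0mx.
by rewrite a0 b0 row_mx0.
Qed.

(** Of the four blocks of Poisson brackets, those of P with itself and of P with g vanish by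
    hypothesis; those of g with P and of g with itself vanish because W^-1 is skew. *)
Lemma snoc_involution x : A x -> hamW (snoc P g) x *m jacobian (snoc P g) x = 0.
Proof.
move=> Ax; have Wu := W_unit (AA0 Ax); have Ws := W_skew (AA0 Ax).
rewrite /ham (jacobian_snoc (dP Ax) (dg Ax)) tr_row_mx.
set J := jacobian P x; set j := jacobian _ x.
have XJx : J^T *m invmx (W x) *m J = 0 := XJ Ax.
have Xj : J^T *m invmx (W x) *m j = 0.
  apply/row_matrixP => i; rewrite row0 rowE mulmxA /j jacobian_const_mx; last exact: dg.
  by have := Xg (delta_mx 0 i) Ax; rewrite /ham => ->; apply/matrixP => a b; rewrite !mxE.
have jX : j^T *m invmx (W x) *m J = 0.
  apply: trmx_inj; rewrite trmx0 !trmx_mul trmxK (invmx_skew Wu Ws) mulNmx mulmxN mulmxA.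
  by rewrite Xj oppr0.
have jj : j^T *m invmx (W x) *m j = 0.
  apply/matrixP => i i'; rewrite !ord1 [RHS]mxE.
  have e : (j^T *m invmx (W x) *m j)^T = - (j^T *m invmx (W x) *m j).
    by rewrite !trmx_mul trmxK (invmx_skew Wu Ws) mulNmx mulmxN mulmxA.
  move/matrixP/(_ 0 0): e; rewrite [LHS]mxE [RHS]mxE => /eqP.
  by rewrite eq_sym eqNr => /eqP.
by rewrite mul_col_mx mul_mx_row !mul_col_mx XJx Xj jX jj !col_mx0 row_mx0.
Qed.

Lemma snoc_ker x (w : 'rV[R]_n) : A x -> w *m jacobian (snoc P g) x = 0 ->
  w *m jacobian P x = 0 /\ 'D_w g x = 0.
Proof.
move=> Ax; rewrite (jacobian_snoc (dP Ax) (dg Ax)) mul_mx_row.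
rewrite jacobian_const_mx; last exact: dg.
rewrite -(@row_mx0 R 1 k 1) => /eq_row_mx[-> /matrixP/(_ 0 0)].
by rewrite !mxE.
Qed.

End Extend.

(** The function h alone is treated as an extension of the empty family, so that the results on
    [snoc] also provide the base of the induction. *)
Lemma in_involution_base : exists (A : set 'rV[R]_n) (P : 'rV[R]_n -> 'rV[R]_1),
  in_involutionW A P.
Proof.
pose P0 (x : 'rV[R]_n) : 'rV[R]_0 := 0.
have sP0 : smooth_on A0 P0 by exact: smooth_on_cst.
have J0 (B : 'M[R]_(n, 0)) : B = 0 by apply/matrixP => i [].
have X0 (B : 'M[R]_(0, n)) : B = 0 by apply/matrixP => -[].
have f0 : row_free (jacobian P0 m)^T.
  by rewrite /row_free -leqn0 rank_leq_row.
have v00 : v0 *m jacobian P0 m = 0 by rewrite (J0 (jacobian P0 m)) mulmx0.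
have X00 x : A0 x -> hamW P0 x *m jacobian P0 x = 0.
  by rewrite (J0 (jacobian P0 x)) mulmx0.
have Xg x (a : 'rV[R]_0) : A0 x -> 'D_(a *m hamW P0 x) h x = 0.
  by rewrite (X0 (hamW P0 x)) mulmx0 derive0.
exists A0, (snoc P0 h); split.
- by split; [exact: oA0|split].
- exact: snoc_smooth.
- exact: (snoc_row_free A0m sP0 sh f0 v00 dh).
- by move=> x; exact: (snoc_involution (@subset_refl _ _) sP0 sh X00 Xg).
- by move=> x v Ax /(snoc_ker sP0 sh Ax)[].
Qed.

Lemma in_involution_step k l A (P : 'rV[R]_n -> 'rV[R]_k) : (k + l)%N = n -> (k < l)%N ->
  in_involutionW A P ->
  exists (B : set 'rV[R]_n) (P' : 'rV[R]_n -> 'rV[R]_(k + 1)), in_involutionW B P'.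
Proof.
move=> kln kl iP; have [[oA [Am AA0]] sP Jm XJ hP] := iP.
have [B [S [Y [S' [Z [[oB [Bm BA]] [sY sZ] [cY cZ] YZS YZ]]]]]] :=
  frames sW W_unit W_skew W_closed kln iP.
have YS x : B x -> Y x *m S = 1%:M by move=> /YZS[].
have [U [g [oU [Um UB] sg Yg Dg]]] := first_integrals_exist oB sY cY Bm YS.
have [Ym Zm] := YZ m Bm; have [YSm ZSm] := YZS m Bm.
have [v vK vY] : exists2 v : 'rV[R]_n, v *m jacobian P m = 0 & ~~ (v <= Y m)%MS.
  have : ~~ (Z m <= Y m)%MS.
    apply/negP => /mxrankS; rewrite (rank_of_right_inverse ZSm) (rank_of_right_inverse YSm).
    by rewrite leqNgt kl.
  move=> /row_subPn[i iY]; exists (row i (Z m)) => //.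
  by apply/sub_kermxP; rewrite -Zm; exact: row_sub.
(* The derivative v - v S Y vanishes only if v lies in the span of [Y m]. A nonzero coordinate of it
   singles out the scalar first integral to be added. *)
have gv : 'D_v g m != 0.
  apply: contra vY; rewrite Dg subr_eq0 => /eqP ->; exact: submxMl.
have [j gvj] : exists j, 'D_v g m 0 j != 0.
  apply/existsP; apply: contraNT gv; rewrite negb_exists => /forallP H.
  by apply/eqP/rowP => j; rewrite [RHS]mxE; apply/eqP; move: (H j); rewrite negbK.
pose gj x := g x 0 j.
have UA : U `<=` A by move=> x /UB/BA.
have UA0 : U `<=` A0 by move=> x /UA/AA0.
have sgj : smooth_on U gj by have /(smooth_on_mx oU) := sg; exact.
have dg x : U x -> differentiable g x by exact: smooth_on_differentiable.
have sPU : smooth_on U P by exact: smooth_on_sub sP.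
have XJU x : U x -> hamW P x *m jacobian P x = 0 by move=> /UA; exact: XJ.
have Xgj x a : U x -> 'D_(a *m hamW P x) gj x = 0.
  move=> Ux; have dgx := dg x Ux; rewrite /gj derive_coord//.
  have /submxP[d ->] : (a *m hamW P x <= Y x)%MS.
    by have [-> _] := YZ x (UB x Ux); exact: submxMl.
  by rewrite Yg// mxE.
have gjv : 'D_v gj m != 0 by rewrite /gj derive_coord//; exact: dg.
exists U, (snoc P gj); split.
- by split; [exact: oU|split].
- exact: snoc_smooth.
- exact: (snoc_row_free Um sPU sgj Jm vK gjv).
- by move=> x; exact: (snoc_involution UA0 sPU sgj XJU Xgj).
- by move=> x w Ux /(snoc_ker sPU sgj Ux)[/(hP _ _ (UA x Ux))].
Qed.

(** Passing from k to k + 1 functions requires k < n - k, which 2 (k + 1) <= n guarantees. *)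
Lemma in_involution_exists k : (0 < k)%N -> (k.*2 <= n)%N ->
  exists (A : set 'rV[R]_n) (P : 'rV[R]_n -> 'rV[R]_k), in_involutionW A P.
Proof.
case: k => // k _; elim: k => [_|k IH kn]; first exact: in_involution_base.
have k1n : (k.+1.*2 <= n)%N by rewrite (leq_trans _ kn)// leq_double.
have [A [P iP]] := IH k1n.
have kln : (k.+1 + (n - k.+1))%N = n.
  by rewrite subnKC// (leq_trans _ k1n)// -addnn leq_addr.
have lt : (k.+1 < n - k.+1)%N.
  rewrite ltn_subRL addnS -addSn; apply: leq_trans kn.
  by rewrite -addnn addSn addnS addnS addSn.
have := in_involution_step kln lt iP; rewrite addn1.
exact.
Qed.

End LocalSystem.

(** * The integrable system in coordinates *)

Section LocalTheorem.
Variable R : realType.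
Variables (n : nat) (A0 : set 'rV[R]_n) (W : 'rV[R]_n -> 'M[R]_n).
Variables (h : 'rV[R]_n -> R) (m : 'rV[R]_n).
Hypotheses (oA0 : open A0) (sW : smooth_on A0 W).
Hypothesis W_unit : forall x, A0 x -> W x \in unitmx.
Hypothesis W_skew : forall x, A0 x -> (W x)^T = - W x.
Hypothesis W_closed : forall x i j k, A0 x ->
  'D_(delta_mx 0 i) (fun y => W y j k) x + 'D_(delta_mx 0 j) (fun y => W y k i) x
  + 'D_(delta_mx 0 k) (fun y => W y i j) x = 0.
Hypotheses (A0m : A0 m) (sh : smooth_on A0 h) (v0 : 'rV[R]_n) (dh : 'D_v0 h m != 0).

(** The matrix 1 - S Y, the differential at m of the n first integrals, has rank l = n - k. A
    full-rank factorization of it yields Q, which selects l independent combinations of them, and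
    Q', which certifies their independence. *)
Lemma projection_factor k l (S : 'M[R]_(n, k)) (Y : 'M[R]_(k, n)) :
  (k + l)%N = n -> Y *m S = 1%:M ->
  exists (Q : 'M[R]_(n, l)) (Q' : 'M[R]_(l, n)), Q' *m (1%:M - S *m Y) *m Q = 1%:M.
Proof.
move=> kln YS; pose G : 'M[R]_n := 1%:M - S *m Y.
have YG : Y *m G = 0 by rewrite /G mulmxBr mulmx1 mulmxA YS mul1mx subrr.
have rY : \rank Y = k by apply: rank_of_right_inverse YS.
have rG : \rank G = l.
  have le1 : (\rank Y + \rank G <= n)%N by exact: mulmx0_rank_max.
  have le2 : (n <= \rank G + \rank (S *m Y))%N.
    by rewrite -{1}(mxrank1 R n) -{1}(subrK (S *m Y) 1%:M) mxrank_add.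
  have le3 : (\rank (S *m Y) <= k)%N by rewrite -{2}rY mxrankM_maxr.
  move: le1 le2 le3; rewrite rY; move: kln; clear; lia.
have [Q GQ] := row_freeP (row_base_free G).
have [Q' QG] := row_fullP (col_base_full G).
rewrite -/G -rG; exists Q, Q'.
have -> : Q' *m G = Q' *m col_base G *m row_base G by rewrite -mulmxA mulmx_base.
by rewrite QG mul1mx.
Qed.

(** The whole result in matrix terms, so that only the passage from a chart to the manifold remains.
    It all follows from ker dF = K, proved by an inclusion and a count of ranks, together with the
    mutual orthogonality of K and ker dP. *)
Lemma local_system k l : (k + l)%N = n -> (0 < k <= l)%N ->
  exists (U : set 'rV[R]_n) (F : 'rV[R]_n -> 'rV[R]_l),
  [/\ open U /\ (U m /\ U `<=` A0), smooth_on U F,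
    forall x, U x -> forall z, exists v, 'D_v F x = z,
    forall x, U x -> [/\
      forall u, (forall v, (u *m W x *m v^T) 0 0 = 'D_v h x) -> 'D_u F x = 0,
      forall u v, 'D_u F x = 0 -> 'D_v F x = 0 -> u *m W x *m v^T = 0 &
      k = l -> forall u, (forall v, 'D_v F x = 0 -> u *m W x *m v^T = 0) ->
        'D_u F x = 0] &
    forall q, U q -> exists (V : set 'rV[R]_l) (f : 'rV[R]_l -> 'rV[R]_n),
    [/\ open V, V 0 /\ f 0 = q, smooth_on V f /\ (forall y, V y -> U (f y)),
      forall y y', V y -> V y' -> f y = f y' -> y = y' &
      forall y, V y -> (forall b, 'D_b f y = 0 -> b = 0) /\
        forall v, (exists b, 'D_b f y = v) <->
          (forall w, 'D_w F (f y) = 0 -> v *m W (f y) *m w^T = 0)]].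
Proof.
move=> kln /andP[k0 kl].
have k2n : (k.*2 <= n)%N by rewrite -kln -addnn leq_add2l.
have [A [P iP]] := in_involution_exists oA0 sW W_unit W_skew W_closed A0m sh dh k0 k2n.
have [[oA [Am AA0]] sP Jm XJ hP] := iP.
have [B [S [Y [S' [Z [[oB [Bm BA]] [sY sZ] [cY cZ] YZS YZ]]]]]] :=
  frames sW W_unit W_skew W_closed kln iP.
have YS x : B x -> Y x *m S = 1%:M by move=> /YZS[].
have ZS x : B x -> Z x *m S' = 1%:M by move=> /YZS[].
have YX x : B x -> (Y x :=: ham W P x)%MS by move=> /YZ[].
have ZK x : B x -> (Z x :=: kermx (jacobian P x))%MS by move=> /YZ[].
have [U0 [g [oU0 [U0m U0B] sg Yg Dg]]] := first_integrals_exist oB sY cY Bm YS.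
have [Q [Q' QQ]] := projection_factor kln (YS m Bm).
pose F x := g x *m Q.
have sF : smooth_on U0 F by apply: smooth_on_mulmx => //; exact: smooth_on_cst.
have dF x : U0 x -> differentiable F x by exact: smooth_on_differentiable.
have dg x : U0 x -> differentiable g x by exact: smooth_on_differentiable.
have DF x v : U0 x -> 'D_v F x = 'D_v g x *m Q.
  move=> Ux; have := derive_mulmx v (dg x Ux) (@differentiable_cst _ _ _ Q x).
  by rewrite derive_cst mulmx0 addr0.
have sJ : smooth_on U0 (fun x => Q' *m jacobian F x).
  by apply: smooth_on_mulmx; [|exact: smooth_on_cst|exact: smooth_on_jacobian].
(* At m the product Q' dF is Q' (1 - S Y) Q = 1; where it remains invertible, dF has rank l. *)
pose U := U0 `&` [set x | Q' *m jacobian F x \in unitmx].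
have oU : open U by exact: open_unitmx.
have UU0 x : U x -> U0 x by case.
have UB x : U x -> B x by move=> /UU0/U0B.
have UA x : U x -> A x by move=> /UB/BA.
have UA0 x : U x -> A0 x by move=> /UA/AA0.
have Um : U m.
  split=> //=; have -> : jacobian F m = (1%:M - S *m Y m) *m Q.
    apply/row_matrixP => i; rewrite !rowE -deriveEjacobian; last exact: dF.
    by rewrite (DF _ _ U0m) Dg mulmxA mulmxBr mulmx1 mulmxA.
  by rewrite mulmxA QQ unitmx1.
have Ju x : U x -> Q' *m jacobian F x \in unitmx by case.
have DFJ x v : U x -> 'D_v F x = v *m jacobian F x.
  by move=> /UU0/dF; exact: deriveEjacobian.
have rJF x : U x -> \rank (jacobian F x) = l.
  move=> /Ju u; apply/eqP; rewrite eqn_leq rank_leq_col /=.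
  by have := mxrankM_maxr Q' (jacobian F x); rewrite (mxrank_unit u).
have rY x : U x -> \rank (Y x) = k.
  by move=> /UB/YS; exact: rank_of_right_inverse.
(* The rows of Y are killed by dF, whose kernel has dimension n - l = k, the rank of Y. *)
have KY x : U x -> (Y x :=: kermx (jacobian F x))%MS.
  move=> Ux; apply: eqmx_of_rank.
    apply/sub_kermxP/row_matrixP => i; rewrite row0 rowE mulmxA -(DFJ x _ Ux).
    by rewrite (DF _ _ (UU0 x Ux)) (Yg _ _ (UU0 x Ux)) mul0mx.
  by rewrite mxrank_ker (rJF x Ux) (rY x Ux) -kln addnK.
have K x v : U x -> 'D_v F x = 0 <-> (v <= ham W P x)%MS.
  move=> Ux; rewrite (DFJ x v Ux) -(YX x (UB x Ux)) (KY x Ux).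
  by split=> /sub_kermxP.
exists U, F; split.
- by split; [exact: oU|split].
- by apply: smooth_on_sub sF.
- move=> x Ux z; exists (z *m invmx (Q' *m jacobian F x) *m Q').
  by rewrite (DFJ x _ Ux) -!mulmxA (mulVmx (Ju x Ux)) mulmx1.
- move=> x Ux; have Wu := W_unit (UA0 x Ux); have Ws := W_skew (UA0 x Ux); split.
  (* As dh vanishes on ker dP, the Hamiltonian vector u is orthogonal to ker dP, hence lies in K. *)
  + move=> u uh; apply/(K x _ Ux)/(sub_hamP _ Wu) => w wJ.
    by apply/matrixP => i j; rewrite !ord1 uh (hP x w (UA x Ux) wJ) mxE.
  + move=> u v /(K x _ Ux) uX /(K x _ Ux) vX.
    exact: (ham_isotropic Wu (XJ x (UA x Ux))).
  + move=> kl' u uW; apply/(K x _ Ux).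
    have uJ : u *m jacobian P x = 0.
      by apply/(ker_hamP _ Wu Ws) => w wX; apply: uW; exact/(K x _ Ux).
    (* Involution puts K inside ker dP, and for k = l both have the same rank. *)
    have -> : (ham W P x :=: kermx (jacobian P x))%MS.
      apply: eqmx_of_rank; first by apply/sub_kermxP; exact: XJ (UA x Ux).
      rewrite -(ZK x (UB x Ux)) -(YX x (UB x Ux)) (rY x Ux).
      by rewrite (rank_of_right_inverse (ZS x (UB x Ux))) kl'.
    exact/sub_kermxP.
- move=> q Uq.
  have UB' : U `<=` B := UB.
  have [V [f [oV [V0 f0] [sf fU] Df fi]]] := integral_manifold_exists oB sZ cZ UB' oU Uq ZS.
  exists V, f; split=> //.
  move=> y Vy; have Uf := fU y Vy; split=> [b|v].
    rewrite (Df y b Vy) => bZ; have := congr1 (mulmx^~ S') bZ.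
    by rewrite -mulmxA (ZS _ (UB _ Uf)) mulmx1 mul0mx.
  have Wu := W_unit (UA0 _ Uf); have Ws := W_skew (UA0 _ Uf).
  have E : (v <= Z (f y))%MS <-> (forall w, 'D_w F (f y) = 0 -> v *m W (f y) *m w^T = 0).
    rewrite (ZK _ (UB _ Uf)); split.
      move=> /sub_kermxP/(ker_hamP _ Wu Ws) H w /(K _ _ Uf); exact: H.
    move=> H; apply/sub_kermxP/(ker_hamP _ Wu Ws) => w wX.
    by apply: H; exact/(K _ _ Uf).
  split=> [[b bv]|/E/submxP[b ->]]; last by exists b; exact: Df.
  by apply/E; rewrite -bv (Df y b Vy); exact: submxMl.
Qed.

End LocalTheorem.

(** * Transfer to manifolds *)

Section Charts.
Variables (R : realType) (n : nat) (M : manifold R n).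
Implicit Types c : chart R n M.

Lemma cinv_dom c x : (c @` cdom c) x -> cdom c (cinv c x) /\ c (cinv c x) = x.
Proof. by move=> [p cp <-]; rewrite cmapK. Qed.

Lemma open_chart_image c (U : set M) : open U -> open (c @` (cdom c `&` U)).
Proof.
move=> oU; rewrite openE => _ [p [cp Up] <-]; rewrite /interior.
have cpi : (c @` cdom c) (c p) by exists p.
have n1 : \forall y \near c p, (c @` cdom c) y.
  by apply: open_nbhs_nbhs; split=> //; exact: cimg_open.
have n2 : \forall y \near c p, U (cinv c y).
  apply: (cinv_continuous cpi); rewrite cmapK//; exact: open_nbhs_nbhs.
apply: filterS2 n1 n2 => y /[dup] /cinv_dom[cy yE] _ Uy.
by exists (cinv c y).
Qed.

Lemma open_chart_preimage c (A : set 'rV[R]_n) : open A -> open (cdom c `&` c @^-1` A).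
Proof.
move=> oA; rewrite openE => p [cp Ap]; rewrite /interior.
have n1 : \forall q \near p, cdom c q.
  by apply: open_nbhs_nbhs; split=> //; exact: cdom_open.
have n2 : \forall q \near p, A (c q).
  by apply: (cmap_continuous cp); exact: open_nbhs_nbhs.
by apply: filterS2 n1 n2.
Qed.

Lemma transition_differentiable c c' p : atlas c -> atlas c' ->
  cdom c p -> cdom c' p -> differentiable (c' \o cinv c) (c p).
Proof.
move=> ac ac' cp c'p.
by apply: (smooth_on_differentiable (atlas_compatible ac ac')); exists p.
Qed.

(** The chain rule applies to the composite of the two transition maps, which is the identity near
    [c p]. *)
Lemma transitionK c c' p v : atlas c -> atlas c' -> cdom c p -> cdom c' p ->
  'd (c \o cinv c') (c' p) ('d (c' \o cinv c) (c p) v) = v.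
Proof.
move=> ac ac' cp c'p.
have d1 := transition_differentiable ac ac' cp c'p.
have d2 := transition_differentiable ac' ac c'p cp.
have E : (c' \o cinv c) (c p) = c' p by rewrite /= cmapK.
have d2' : differentiable (c \o cinv c') ((c' \o cinv c) (c p)) by rewrite E.
have := derive_comp v d1 d2'; rewrite (deriveE _ d1) (deriveE _ d2') E => <-.
rewrite (near_eq_derive v (g := id)) ?derive_id//.
have o := open_chart_image (c := c) (cdom_open c').
have Ap : (c @` (cdom c `&` cdom c')) (c p) by exists p.
by apply: (open_near o Ap) => _ [q [cq c'q] <-] /=; rewrite cmapK// cmapK.
Qed.

End Charts.

(** * Passage between a fixed chart and the frames of tangent vectors *)

Section Transfer.
Variables (R : realType) (n : nat) (M : manifold R n) (w : two_form M).
Hypothesis w_sympl : symplectic w.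
Variable c : chart R n M.
Hypothesis ac : atlas c.

(** The frame [chart_at p] in which tangent vectors are expressed may change abruptly with p. T and
    its inverse S convert between this frame and the fixed chart c, in which the local result is
    stated. *)
Let T (p : M) (v : 'rV[R]_n) : tangent p := 'd (chart_at p \o cinv c) (c p) v.
Let S (p : M) (v : tangent p) : 'rV[R]_n := 'd (c \o cinv (chart_at p)) (chart_at p p) v.

Lemma frameK p v : cdom c p -> S (T p v) = v.
Proof. by move=> cp; apply: transitionK => //; [exact: chart_at_atlas|exact: chart_at_dom]. Qed.

Lemma frameVK p (v : tangent p) : cdom c p -> T p (S v) = v.
Proof. by move=> cp; apply: transitionK => //; [exact: chart_at_atlas|exact: chart_at_dom]. Qed.

Definition form_mx (x : 'rV[R]_n) : 'M[R]_n := \matrix_(i, j) form_coef w c i j x.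

Lemma form_mx_T p (u v : 'rV[R]_n) : cdom c p ->
  (u *m form_mx (c p) *m v^T) 0 0 = w (T p u) (T p v).
Proof.
move=> cp; rewrite form_mxE.
have l2 (t : tangent p) : scalar (fun v => w t (T p v) : R).
  by move=> a x y; rewrite /T linearP; exact: (form_linear w_sympl).
have l1 (t : tangent p) : scalar (fun v => w (T p v) t : R).
  move=> a x y; rewrite !(form_skew w_sympl (T p _) t) /T linearP.
  by rewrite (form_linear w_sympl) opprD mulrN.
rewrite (scalar_sum_delta u (l1 (T p v))); apply: eq_bigr => i _.
rewrite (scalar_sum_delta v (l2 _)) mulr_sumr; apply: eq_bigr => j _.
by rewrite mulrA mxE /form_coef /coord_vf (cmapK cp).
Qed.

Lemma form_S p (u v : tangent p) : cdom c p ->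
  w u v = (S u *m form_mx (c p) *m (S v)^T) 0 0.
Proof. by move=> cp; rewrite form_mx_T// !frameVK. Qed.

Let A0 := c @` cdom c.

Lemma form_mx_smooth : smooth_on A0 form_mx.
Proof.
have o : open A0 by exact: cimg_open.
apply/(smooth_on_mx o) => i j; under eq_fun do rewrite mxE.
exact: (form_smooth w_sympl).
Qed.

Lemma form_mx_skew x : A0 x -> (form_mx x)^T = - form_mx x.
Proof. by move=> _; apply/matrixP => i j; rewrite !mxE; exact: (form_skew w_sympl). Qed.

Lemma form_mx_unit x : A0 x -> form_mx x \in unitmx.
Proof.
move=> [p cp <-]; rewrite -row_free_unit -kermx_eq0; apply/eqP/eqP/rowV0P => v.
move=> /sub_kermxP vW.
have Tv : T p v = 0 :> 'rV[R]_n.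
  apply: (form_nondegenerate w_sympl) => u; rewrite -[u](frameVK _ cp) -form_mx_T//.
  by rewrite vW mul0mx mxE.
by rewrite -(frameK v cp) Tv /S linear0.
Qed.

Lemma form_mx_closed x i j k : A0 x ->
  'D_(delta_mx 0 i) (fun y => form_mx y j k) x
  + 'D_(delta_mx 0 j) (fun y => form_mx y k i) x
  + 'D_(delta_mx 0 k) (fun y => form_mx y i j) x = 0.
Proof.
move=> Ax; rewrite -(form_closed w_sympl i j k ac Ax).
by congr (_ + _ + _); congr ('D__ _ x); apply/funext => y; rewrite mxE.
Qed.

Lemma differential_S (H : M -> R) p (v : tangent p) : smooth_fun H -> cdom c p ->
  differential H p v = 'D_(S v) (H \o cinv c) (c p).
Proof.
move=> sH cp; set d := chart_at p.
have ad : atlas d by exact: chart_at_atlas.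
have dp : cdom d p by exact: chart_at_dom.
have d1 := transition_differentiable ad ac dp cp.
have dH c' : atlas c' -> cdom c' p -> differentiable (H \o cinv c') (c' p).
  by move=> ac' c'p; apply: (smooth_on_differentiable (sH c' ac')); exists p.
have E : (c \o cinv d) (d p) = c p by rewrite /= cmapK.
have d2 : differentiable (H \o cinv c) ((c \o cinv d) (d p)) by rewrite E; exact: dH.
have := derive_comp v d1 d2; rewrite (deriveE _ d1) E => <-.
rewrite /differential -deriveE; last exact: dH.
have o := open_chart_image (c := d) (cdom_open c).
have Ap : (d @` (cdom d `&` cdom c)) (d p) by exists p.
apply: near_eq_derive; apply: (open_near o Ap) => _ [q [dq cq] <-] /=.
by rewrite (cmapK dq) cmapK.
Qed.

Section Push.
Variables (l : nat) (U0 : set 'rV[R]_n) (F0 : 'rV[R]_n -> 'rV[R]_l).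
Hypotheses (oU0 : open U0) (U0A : U0 `<=` A0) (sF : smooth_on U0 F0).

Let U := cdom c `&` c @^-1` U0.
Let F : M -> euclidean R l := F0 \o c.

(** The identity is the only chart of the target, so that the chain rule involves just the
    transition from [chart_at p] to c. *)
Lemma pushforward_S p (v : tangent p) : U p -> Defs.pushforward F p v = 'D_(S v) F0 (c p).
Proof.
move=> [cp Up]; set d := chart_at p.
have ad : atlas d by exact: chart_at_atlas.
have dp : cdom d p by exact: chart_at_dom.
have d1 := transition_differentiable ad ac dp cp.
have E : (c \o cinv d) (d p) = c p by rewrite /= cmapK.
have d2 : differentiable F0 ((c \o cinv d) (d p)).
  by rewrite E; exact: smooth_on_differentiable Up.
have dc : differentiable (F0 \o (c \o cinv d)) (d p) by exact: differentiable_comp.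
have := derive_comp v d1 d2; rewrite (deriveE _ d1) E => <-.
by rewrite (deriveE _ dc).
Qed.

Lemma smooth_map_F : smooth_map U F.
Proof.
split=> [p [cp Up]|c1 c2 ac1 ->].
  by apply: continuous_comp; [exact: cmap_continuous|exact: smooth_on_continuous Up].
have oU : open U by exact: open_chart_preimage.
have o1 := open_chart_image (c := c1) oU.
have s1 : smooth_on (c1 @` (cdom c1 `&` U)) (c \o cinv c1).
  apply: smooth_on_sub (atlas_compatible ac1 ac) => _ [p [c1p [cp _]] <-].
  by exists p.
have s2 : smooth_on (c1 @` (cdom c1 `&` U)) (F0 \o (c \o cinv c1)).
  apply: (smooth_on_comp o1 oU0 _ s1 sF) => _ [p [c1p [cp Up]] <-].
  by rewrite /= cmapK.
by apply: smooth_on_sub s2 => _ [p [[c1p Up] _] <-]; exists p.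
Qed.

Lemma ker_push_S p (v : tangent p) : U p -> ker_push F p v <-> 'D_(S v) F0 (c p) = 0.
Proof. by move=> Up; rewrite -(pushforward_S v Up). Qed.

Lemma submersion_F : (forall x, U0 x -> forall z, exists v, 'D_v F0 x = z) ->
  submersion U F.
Proof.
move=> F0s; split; first exact: smooth_map_F.
move=> p /[dup] Up [cp U0p] z; have [v vz] := F0s _ U0p z.
by exists (T p v); rewrite (pushforward_S _ Up) frameK.
Qed.

Lemma sorth_S p (u : tangent p) : U p -> sorth w (ker_push F) p u <->
  (forall v, 'D_v F0 (c p) = 0 -> S u *m form_mx (c p) *m v^T = 0).
Proof.
move=> /[dup] Up [cp _]; split=> [uK v Fv|uF v /(ker_push_S _ Up) Fv].
  have : w u (T p v) = 0 by apply: uK; apply/(ker_push_S _ Up); rewrite frameK.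
  rewrite form_S// frameK// => E.
  by apply/matrixP => i j; rewrite !ord1 E mxE.
by rewrite form_S// uF// mxE.
Qed.

(** The orthogonal of ker dF has the rank l of dF, so its integral manifolds are parametrized by
    open subsets of R^l; the immersion is the local parametrization followed by [cinv c]. *)
Lemma integrable_F :
  (forall q, U0 q -> exists (V : set 'rV[R]_l) (f : 'rV[R]_l -> 'rV[R]_n),
    [/\ open V, V 0 /\ f 0 = q, smooth_on V f /\ (forall y, V y -> U0 (f y)),
      forall y y', V y -> V y' -> f y = f y' -> y = y' &
      forall y, V y -> (forall b, 'D_b f y = 0 -> b = 0) /\
        forall v, (exists b, 'D_b f y = v) <->
          (forall w, 'D_w F0 (f y) = 0 -> v *m form_mx (f y) *m w^T = 0)]) ->
  integrable_on U (sorth w (ker_push F)).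
Proof.
move=> F0i q [cq U0q].
have [V [f0 [oV [V0 f00] [sf fU] fi fD]]] := F0i _ U0q.
pose f : euclidean R l -> M := cinv c \o f0.
have fA y : V y -> A0 (f0 y) by move=> /fU/U0A.
have fc y : V y -> cdom c (f y) /\ c (f y) = f0 y by move=> /fA/cinv_dom.
have fUU y : V y -> U (f y).
  by move=> Vy; have [cy cE] := fc y Vy; split=> //=; rewrite cE; exact: fU.
have cf y : V y -> {for y, continuous f}.
  move=> Vy; apply: continuous_comp; first exact: smooth_on_continuous Vy.
  by apply: cinv_continuous; exact: fA.
have push y b : V y -> Defs.pushforward f y b = T (f y) ('D_b f0 y) :> 'rV[R]_n.
  move=> Vy; have [cy cE] := fc y Vy.
  have df0 : differentiable f0 y by exact: smooth_on_differentiable Vy.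
  have dc : differentiable (chart_at (f y) \o cinv c) (f0 y).
    by rewrite -cE; apply: transition_differentiable => //;
      [exact: chart_at_atlas|exact: chart_at_dom].
  have dcf : differentiable ((chart_at (f y) \o cinv c) \o f0) y.
    exact: differentiable_comp.
  have := derive_comp b df0 dc; rewrite (deriveE _ dcf) (deriveE _ dc) /T cE.
  exact.
exists l, (euclidean R l), V, f; split.
- exact: oV.
- split; last first.
    move=> y Vy b b'; rewrite (push y b Vy) (push y b' Vy) => Tb.
    have [cy _] := fc y Vy.
    have {Tb} : 'D_b f0 y = 'D_b' f0 y.
      by rewrite -(frameK ('D_b f0 y) cy) -(frameK ('D_b' f0 y) cy) Tb.
    have df0 : differentiable f0 y by exact: smooth_on_differentiable Vy.
    move=> /eqP; rewrite -subr_eq0 (deriveE _ df0) (deriveE _ df0) -linearB -(deriveE _ df0).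
    by move=> /eqP/(fD y Vy).1/subr0_eq.
  split; first exact: cf.
  move=> c1 c2 -> ac2.
  pose V2 := V `&` [set y | cdom c2 (f y)].
  have oV2 : open V2.
    rewrite openE => y [Vy c2y]; rewrite /interior.
    have n1 : \forall y' \near y, V y' by exact: open_nbhs_nbhs.
    have n2 : \forall y' \near y, cdom c2 (f y').
      by apply: (cf y Vy); apply: open_nbhs_nbhs; split=> //; exact: cdom_open.
    by apply: filterS2 n1 n2.
  have s2 : smooth_on V2 ((c2 \o cinv c) \o f0).
    apply: (smooth_on_comp oV2 (open_chart_image (c := c) (cdom_open c2))
      _ _ (atlas_compatible ac ac2)).
      move=> y [Vy c2y]; have [cy cE] := fc y Vy.
      by exists (f y).
    by apply: smooth_on_sub sf => y [].
  by apply: smooth_on_sub s2 => _ [y [[_ Vy] c2y] <-].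
- move=> y y'; rewrite !inE => Vy Vy' ff; apply: fi => //.
  by rewrite -(fc y Vy).2 -(fc y' Vy').2 ff.
- split; first by move=> _ [y Vy <-]; exact: fUU.
  by exists 0 => //; rewrite /f /= f00 cmapK.
- move=> y Vy; have [cy cE] := fc y Vy; have [_ fDv] := fD y Vy.
  apply/seteqP; split=> [_ [b _ <-]|u uS].
    apply/(sorth_S _ (fUU y Vy)); rewrite push// frameK// cE.
    by apply/fDv; exists b.
  have [b bE] : exists b, 'D_b f0 y = S u.
    by apply/fDv; move/(sorth_S _ (fUU y Vy)): uS; rewrite cE.
  by exists b => //; rewrite push// bE frameVK.
Qed.

End Push.
End Transfer.

(** The bounds on l are stated through the dimension n, in the form that gives 0 < k <= l for k = n
    - l; the equality n = 2 l is the case k = l, in which ker dF is Lagrangian. *)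
Lemma local_integrable_system (R : realType) (n l : nat) (M : manifold R n)
    (w : two_form M) (H : M -> R) (m : M) :
  symplectic w -> smooth_fun H -> differential H m <> (fun=> 0) ->
  (l < n <= l.*2)%N ->
  exists (U : set M) (F : M -> euclidean R l),
    [/\ open U, U m, noncommutative_integrable w H U F &
        n = l.*2 -> commutative_integrable w H U F].
Proof.
move=> ws sH dH /andP[ln nl].
pose c := chart_at m; have ac : atlas c by exact: chart_at_atlas.
have cm : cdom c m by exact: chart_at_dom.
pose A0 := c @` cdom c; have A0m : A0 (c m) by exists m.
have sh : smooth_on A0 (H \o cinv c) by exact: sH.
have dh x : A0 x -> differentiable (H \o cinv c) x by exact: smooth_on_differentiable.
have [v0 dv0] : exists v0, 'D_v0 (H \o cinv c) (c m) != 0.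
  apply: contrapT => H0; apply: dH; apply/funext => v.
  rewrite /differential -deriveE; last exact: dh.
  by apply/eqP; apply: contrapT => /negP nz; apply: H0; exists v.
have kln : ((n - l) + l)%N = n by rewrite subnK// ltnW.
have k0l : (0 < n - l <= l)%N by rewrite subn_gt0 ln leq_subLR addnn.
have oA0 : open A0 by exact: cimg_open.
have [U0 [F0 [[oU0 [U0m U0A]] sF F0s F0P F0i]]] := local_system oA0
  (form_mx_smooth ws ac) (form_mx_unit ws ac) (form_mx_skew ws (c := c))
  (fun x i j k Ax => form_mx_closed ws ac i j k Ax) A0m sh dv0 kln k0l.
pose U := cdom c `&` c @^-1` U0; pose F : M -> euclidean R l := F0 \o c.
pose S (p : M) (v : tangent p) : 'rV[R]_n := 'd (c \o cinv (chart_at p)) (chart_at p p) v.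
have KE p (v : tangent p) : U p -> ker_push F p v <-> 'D_(S p v) F0 (c p) = 0.
  exact: (ker_push_S ac sF).
have iso : isotropic w U F.
  move=> p /[dup] Up [cp U0p] u /(KE p u Up) uK v /(KE p v Up) vK.
  have [_ iso _] := F0P _ U0p.
  by rewrite (form_S ws ac)// iso// mxE.
have nc : noncommutative_integrable w H U F.
  split.
  - exact: (submersion_F ac oU0 sF F0s).
  - move=> p /[dup] Up [cp U0p]; apply/(KE p _ Up).
    have [HF _ _] := F0P _ U0p; apply: HF => v.
    set X := hamiltonian_vf w H p.
    have XP : forall v, w p X v = differential H p v by apply/(hamiltonian_vfP H X ws).
    have := XP ('d (chart_at p \o cinv c) (c p) v).
    rewrite (form_S ws ac)// (differential_S ac _ sH cp).
    by rewrite frameK.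
  - exact: iso.
  - exact: (integrable_F ws ac U0A sF F0i).
exists U, F; split=> //.
- exact: open_chart_preimage.
- move=> n2l; split=> // p /[dup] Up [cp U0p].
  apply/seteqP; split=> [u|u uS]; first exact: iso.
  have [_ _ lag] := F0P _ U0p; apply/(KE p u Up)/lag.
    by rewrite n2l -addnn addnK.
  by move=> v Fv; move/(sorth_S ws ac sF u Up): uS; apply.
Qed.

Theorem theorem2 (R : realType) (s : nat) (M : manifold R (2 * s)%N)
  (w : two_form M) (w_symplectic : symplectic w)
  (H : M -> R) (H_smooth : smooth_fun H)
  (m : M) (dH_neq0 : differential H m <> (fun=> 0)) :
  forall l : nat, (s <= l < 2 * s)%N ->
    exists (U : set M) (F : M -> euclidean R l),
      [/\ open U, U m, noncommutative_integrable w H U F &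
          l = s -> commutative_integrable w H U F].
Proof.
move=> l /andP[sl ls].
have [|U [F [oU Um nc cc]]] := local_integrable_system w_symplectic H_smooth dH_neq0 (l := l).
  by rewrite ls mul2n leq_double.
by exists U, F; split=> // lsE; apply: cc; rewrite lsE mul2n.
Qed.
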